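(* Let $F(q)=\sum_{n=-1}^\infty f(n)q^n$ be a normalized $q$-series ($f(-1)=1$, $f(0)=0$, $f(n)\in\mathbb Z$ for $n\ge1$), let $\mathfrak L(F)=\bigoplus_{(m,n)\in II_{1,1}}\mathfrak L(F)_{(m,n)}$ be the associated Monstrous Lie superalgebra, and let $V=\bigoplus_{n=-1}^\infty V_n$ with $V_n=\mathfrak L(F)_{(-1,-n)}$. Suppose a group $G$ acts on $\mathfrak L(F)$ by Lie superalgebra automorphisms of $\mathfrak L(F)_\pm$ preserving the $II_{1,1}$-gradation, with $\mathrm{str}(g|\mathfrak L(F)_{(m,n)})=\mathrm{str}(g|\mathfrak L(F)_{(-m,-n)})$ for all $g\in G$, $m,n>0$, and $g\cdot f_{-1}=f_{-1}$, $g\cdot e_{-1}=e_{-1}$ for all $g\in G$. Let $f_g(n)=\mathrm{str}(g|V_n)$ and suppose that for every $g\in G$ the generalized supercharacter $F_g(q)=\sum_{n=-1}^\infty f_g(n)q^n$ of $V$ is replicable with replicates $F_g^{(a)}(q)=\sum_{n=-1}^\infty f_g^{(a)}(n)q^n$ $(a\ge1)$. Then for all $g\in G$ and $m,n>0$, $$\mathrm{str}(g|\mathfrak L(F)_{(m,n)})=\mathrm{str}(g|\mathfrak L(F)_{(-m,-n)})=\sum_{ad|(m,n)}\frac1{ad}\mu(d)\,f_{g^d}^{(a)}\Big(\frac{mn}{a^2d^2}\Big),$$ where the sum is over positive integers $a,d$ with $ad$ dividing both $m$ and $n$, and $\mu$ is the classical Möbius function.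
   Context: Replicable: a normalized $q$-series $F(q)=q^{-1}+\sum_{n\ge1}f(n)q^n$ (integer coefficients, zero constant term) converging for $q=e^{2\pi i\tau}$, $\mathrm{Im}\,\tau>0$. For each $m\ge1$ there is a unique polynomial $P_m(t)\in\mathbb Z[t]$ with $P_m(F)\equiv q^{-m}\bmod q\mathbb Z[[q]]$. $F$ is replicable if there are normalized $q$-series $F^{(a)}(q)=q^{-1}+\sum_{n\ge1}f^{(a)}(n)q^n$ with integer coefficients ($a\ge1$; the replicates) such that $F^{(1)}=F$ and $\sum_{ad=m,\,0\le b<d}F^{(a)}\big(\frac{a\tau+b}{d}\big)=P_m(F)$ for all $m>0$. It is known (Kang) that this is equivalent to $\prod_{m,n\ge1}\exp\big(-\sum_{k\ge1}\frac1kf^{(k)}(mn)p^{km}q^{kn}\big)=1-\sum_{i,j\ge1}f(i+j-1)p^iq^j$. The Monstrous Lie superalgebra $\mathfrak L(F)$: let $I=\{-1\}\cup\{1,2,3,\dots\}$, $a_{ij}=-(i+j)$ for $i,j\in I$, $m_i=|f(i)|$ (no generators $e_{ik},f_{ik}$ if $f(i)=0$), and let $C=(\theta_{ij})_{i,j\in I}$ be a complex matrix with $\theta_{ij}\theta_{ji}=1$, $\theta_{ii}=1$ if $f(i)>0$ and $\theta_{ii}=-1$ if $f(i)<0$. Let $Q=\bigoplus_{i\in I}\mathbb Z\alpha_i$ and let $\theta:Q\times Q\to\mathbb C^\times$ be bimultiplicative with $\theta(\alpha_i,\alpha_j)=\theta_{ij}$; $\psi(\alpha)=\theta(\alpha,\alpha)=\pm1$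 is the parity sign. $\mathfrak L(F)=\mathfrak g(A,\underline m,C)$ is the $\theta$-colored $Q$-graded Lie superalgebra (bracket with $[x,y]=-\theta(\alpha,\beta)[y,x]$, $[x,[y,z]]=[[x,y],z]+\theta(\alpha,\beta)[y,[x,z]]$ for $x,y$ of degrees $\alpha,\beta$) generated by $h_i,d_i$ ($i\in I$), $e_{ik},f_{ik}$ ($1\le k\le m_i$), of degrees $0,0,\alpha_i,-\alpha_i$, with relations $[h_i,h_j]=[h_i,d_j]=[d_i,d_j]=0$, $[h_i,e_{jl}]=a_{ij}e_{jl}$, $[h_i,f_{jl}]=-a_{ij}f_{jl}$, $[d_i,e_{jl}]=\delta_{ij}e_{jl}$, $[d_i,f_{jl}]=-\delta_{ij}f_{jl}$, $[e_{ik},f_{jl}]=\delta_{ij}\delta_{kl}h_i$, $(\mathrm{ad}\,e_{ik})^{1-a_{ij}}(e_{jl})=(\mathrm{ad}\,f_{ik})^{1-a_{ij}}(f_{jl})=0$ if $a_{ii}=2$ (i.e. $i=-1$) and $i\ne j$, and $[e_{ik},e_{jl}]=[f_{ik},f_{jl}]=0$ if $a_{ij}=0$. Write $e_{-1}=e_{-1,1}$, $f_{-1}=f_{-1,1}$. Grading: identifying $\alpha_{i}$ with $(1,i)\in II_{1,1}=\mathbb Z^2$ for $i\in I$ makes $\mathfrak L(F)$ $II_{1,1}$-graded; $\mathfrak L(F)_\pm$ are the subalgebras spanned by the root spaces of positive, resp. negative, roots (first coordinate positive, resp. negative). $V_{-1}=\mathbb Cf_{-1}$ and $V_i=\mathbb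 Cf_{i,1}\oplus\cdots\oplus\mathbb Cf_{i,|f(i)|}$ for $i\ge1$. The supertrace is the trace on the even part minus the trace on the odd part (parity given by $\psi$). *)

(* Defs.v *)
(* MathComp and MathComp-Analysis. The complex numbers are R[i], where R is an
   arbitrary realType. *)
From HB Require Import structures.
From mathcomp Require Export all_boot all_order all_algebra.
From mathcomp Require Export all_classical all_reals all_analysis.
From mathcomp Require Export complex.
From mathcomp.multinomials Require Export freeg.
Set Implicit Arguments.
Unset Strict Implicit.
Unset Printing Implicit Defensive.
Import Order.TTheory GRing.Theory Num.Theory.
Import numFieldNormedType.Exports.
Local Open Scope ring_scope.
Local Open Scope classical_set_scope.
Local Open Scope quotient_scope.
Local Open Scope complex_scope.

Definition mobius (n : nat) : int :=
  if all (fun p => logn p n == 1%N) (primes n) then (-1) ^+ size (primes n)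
  else 0.

Section LinearAlgebra.
Context {K : fieldType} {V : lmodType K}.

Definition lspan (S : set V) : set V :=
  [set x | exists (n : nat) (c : 'I_n -> K) (v : 'I_n -> V),
     (forall i, S (v i)) /\ x = \sum_i c i *: v i].

Definition is_basis (W : set V) (n : nat) (b : 'I_n -> V) : Prop :=
  (forall i, W (b i)) /\
  (forall x, W x -> exists! c : 'rV[K]_n, x = \sum_i c 0 i *: b i).

(* Trace of the restriction of phi to a finite-dimensional subspace W that phi
   preserves (0 in all other cases). *)
Definition trace_on (W : set V) (phi : V -> V) : K :=
  xget 0 [set t | exists (n : nat) (b : 'I_n -> V) (M : 'M[K]_n),
     [/\ is_basis W b, (forall j, phi (b j) = \sum_i M i j *: b i)
       & t = \tr M]].

End LinearAlgebra.

Section ReplicableSeries.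

(* A q-series q^-1 + f(1) q + f(2) q^2 + ... is given by f : int -> int; only
   the values of f at the integers n >= -1 matter. *)
Definition normalized (f : int -> int) : Prop := f (-1) = 1 /\ f 0 = 0.

(* The coefficient of q^n in F(q)^k. Here F(q)^k = q^-k (q F(q))^k, and only
   the terms up to q^(n+k) of the power series q F(q) contribute. *)
Definition coef_pow (f : int -> int) (k : nat) (n : int) : int :=
  if - k%:Z <= n then
    let N := absz (n + k%:Z) in
    ((\poly_(i < N.+1) f (i%:Z - 1)) ^+ k)`_N
  else 0.

(* P(F) = q^-m modulo q Z[[q]]; such a P is unique. *)
Definition is_faber_poly (f : int -> int) (m : nat) (P : {poly int}) : Prop :=
  forall n : int, n <= 0 ->
    \sum_(k < size P) P`_k * coef_pow f k n = (n == - m%:Z)%:R.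

Variable R : realType.

Definition cexp (z : R[i]) : R[i] :=
  (expR (complex.Re z) * cos (complex.Im z))
    +i* (expR (complex.Re z) * sin (complex.Im z)).

Definition nome (tau : R[i]) : R[i] := cexp (2 * pi%:C * 'i * tau).

Definition qterm (f : int -> int) (tau : R[i]) (k : nat) : R[i]^o :=
  (f (k%:Z - 1))%:~R * nome tau ^ (k%:Z - 1).

Definition qconvergent (f : int -> int) : Prop :=
  forall tau : R[i], 0 < complex.Im tau -> cvgn (series (qterm f tau)).

Definition qeval (f : int -> int) (tau : R[i]) : R[i] :=
  limn (series (qterm f tau)).

(* F is replicable, and its replicates are the series fr a, a >= 1. *)
Definition replicable_with (F : int -> int) (fr : nat -> int -> int) : Prop :=
  [/\ forall a, (0 < a)%N -> normalized (fr a) /\ qconvergent (fr a),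
      forall n, -1 <= n -> fr 1%N n = F n
    & forall m, (0 < m)%N ->
        exists2 P : {poly int}, is_faber_poly F m P &
        forall tau : R[i], 0 < complex.Im tau ->
          \sum_(d <- divisors m) \sum_(b < d)
             qeval (fr (m %/ d)%N) (((m %/ d)%:R * tau + b%:R) / d%:R)
          = (map_poly intr P).[qeval F tau]].

End ReplicableSeries.

(* The theta-colored Lie superalgebra g(A, m, C) of a Borcherds-Cartan matrix
   A : I x I -> Z, charges m and coloring matrix C, graded by Q = {freeg I}. *)
Section ColoredBKM.
Variables (R : realType) (I : choiceType).
Variables (A : I -> I -> int) (m : I -> nat) (C : I -> I -> R[i]).

Local Notation Q := {freeg I}.

Definition coloring_form (a b : Q) : R[i] :=
  \prod_(i <- dom a) \prod_(j <- dom b) C i j ^ (coeff i a * coeff j b).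

Definition parity_sign (a : Q) : R[i] := coloring_form a a.

Inductive bkm_gen : Type :=
  | GenH of I
  | GenD of I
  | GenE (i : I) of 'I_(m i)
  | GenF (i : I) of 'I_(m i).

Definition gen_degree (x : bkm_gen) : Q :=
  match x with
  | GenH _ | GenD _ => 0
  | GenE i _ => << i >>
  | GenF i _ => - << i >>
  end.

Inductive lie_term : Type :=
  | LGen of bkm_gen
  | LZero
  | LAdd of lie_term & lie_term
  | LScale of R[i] & lie_term
  | LBr of lie_term & lie_term.

HB.instance Definition _ := gen_eqMixin lie_term.
HB.instance Definition _ := gen_choiceMixin lie_term.

(* lie_homog a t : t is a formal combination of bracket monomials of degree a *)
Inductive lie_homog : Q -> lie_term -> Prop :=
  | homog_gen x : lie_homog (gen_degree x) (LGen x)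
  | homog_zero a : lie_homog a LZero
  | homog_add a s t : lie_homog a s -> lie_homog a t -> lie_homog a (LAdd s t)
  | homog_scale a c t : lie_homog a t -> lie_homog a (LScale c t)
  | homog_br a b s t :
      lie_homog a s -> lie_homog b t -> lie_homog (a + b) (LBr s t).

Local Notation h i := (LGen (GenH i)).
Local Notation d i := (LGen (GenD i)).
Local Notation e k := (LGen (GenE k)).
Local Notation f k := (LGen (GenF k)).

Inductive bkm_rel : lie_term -> lie_term -> Prop :=
  | rel_hh i j : bkm_rel (LBr (h i) (h j)) LZero
  | rel_hd i j : bkm_rel (LBr (h i) (d j)) LZero
  | rel_dd i j : bkm_rel (LBr (d i) (d j)) LZero
  | rel_he i j (l : 'I_(m j)) :
      bkm_rel (LBr (h i) (e l)) (LScale (A i j)%:~R (e l))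
  | rel_hf i j (l : 'I_(m j)) :
      bkm_rel (LBr (h i) (f l)) (LScale (- (A i j)%:~R) (f l))
  | rel_de i j (l : 'I_(m j)) :
      bkm_rel (LBr (d i) (e l)) (LScale (i == j)%:R (e l))
  | rel_df i j (l : 'I_(m j)) :
      bkm_rel (LBr (d i) (f l)) (LScale (- (i == j)%:R) (f l))
  | rel_ef i (k l : 'I_(m i)) :
      bkm_rel (LBr (e k) (f l)) (LScale (k == l)%:R (h i))
  | rel_ef_neq i j (k : 'I_(m i)) (l : 'I_(m j)) :
      i != j -> bkm_rel (LBr (e k) (f l)) LZero
  (* 1 - A i j > 0 in a Borcherds-Cartan matrix when A i i = 2 and i != j *)
  | rel_serre_e i j (k : 'I_(m i)) (l : 'I_(m j)) :
      A i i = 2 -> i != j ->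
      bkm_rel (iter (absz (1 - A i j)) (LBr (e k)) (e l)) LZero
  | rel_serre_f i j (k : 'I_(m i)) (l : 'I_(m j)) :
      A i i = 2 -> i != j ->
      bkm_rel (iter (absz (1 - A i j)) (LBr (f k)) (f l)) LZero
  | rel_ee i j (k : 'I_(m i)) (l : 'I_(m j)) :
      A i j = 0 -> bkm_rel (LBr (e k) (e l)) LZero
  | rel_ff i j (k : 'I_(m i)) (l : 'I_(m j)) :
      A i j = 0 -> bkm_rel (LBr (f k) (f l)) LZero.

(* The least congruence that makes terms a vector space with a bilinear
   bracket, satisfying the colored identities and the defining relations. *)
Inductive lie_eq : lie_term -> lie_term -> Prop :=
  | lie_refl t : lie_eq t t
  | lie_sym s t : lie_eq s t -> lie_eq t s
  | lie_trans s t u : lie_eq s t -> lie_eq t u -> lie_eq s u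
  | lie_add s s' t t' :
      lie_eq s s' -> lie_eq t t' -> lie_eq (LAdd s t) (LAdd s' t')
  | lie_scale c t t' : lie_eq t t' -> lie_eq (LScale c t) (LScale c t')
  | lie_br s s' t t' :
      lie_eq s s' -> lie_eq t t' -> lie_eq (LBr s t) (LBr s' t')
  | lie_addA s t u : lie_eq (LAdd s (LAdd t u)) (LAdd (LAdd s t) u)
  | lie_addC s t : lie_eq (LAdd s t) (LAdd t s)
  | lie_add0 t : lie_eq (LAdd LZero t) t
  | lie_addN t : lie_eq (LAdd (LScale (-1) t) t) LZero
  | lie_scaleA b c t : lie_eq (LScale b (LScale c t)) (LScale (b * c) t)
  | lie_scale1 t : lie_eq (LScale 1 t) t
  | lie_scaleDr c s t :
      lie_eq (LScale c (LAdd s t)) (LAdd (LScale c s) (LScale c t))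
  | lie_scaleDl b c t :
      lie_eq (LScale (b + c) t) (LAdd (LScale b t) (LScale c t))
  | lie_brDl s t u : lie_eq (LBr (LAdd s t) u) (LAdd (LBr s u) (LBr t u))
  | lie_brDr s t u : lie_eq (LBr u (LAdd s t)) (LAdd (LBr u s) (LBr u t))
  | lie_brZl c s t : lie_eq (LBr (LScale c s) t) (LScale c (LBr s t))
  | lie_brZr c s t : lie_eq (LBr s (LScale c t)) (LScale c (LBr s t))
  | lie_skew a b s t : lie_homog a s -> lie_homog b t ->
      lie_eq (LBr s t) (LScale (- coloring_form a b) (LBr t s))
  | lie_jacobi a b s t u : lie_homog a s -> lie_homog b t ->
      lie_eq (LBr s (LBr t u))
        (LAdd (LBr (LBr s t) u) (LScale (coloring_form a b) (LBr t (LBr s u))))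
  | lie_rel s t : bkm_rel s t -> lie_eq s t.

Definition lie_eqb : rel lie_term := fun s t => `[< lie_eq s t >].

Lemma lie_eqb_refl : reflexive lie_eqb.
Proof. by move=> t; apply/asboolP; apply: lie_refl. Qed.

Lemma lie_eqb_sym : symmetric lie_eqb.
Proof.
by move=> s t; apply/idP/idP => /asboolP H; apply/asboolP; apply: lie_sym.
Qed.

Lemma lie_eqb_trans : transitive lie_eqb.
Proof.
move=> t s u /asboolP st /asboolP tu; apply/asboolP; exact: lie_trans st tu.
Qed.

Canonical lie_equiv_rel :=
  EquivRel lie_eqb lie_eqb_refl lie_eqb_sym lie_eqb_trans.

Definition bkm : Type := {eq_quot lie_eqb}.
HB.instance Definition _ := Choice.on bkm.
HB.instance Definition _ := EqQuotient.on bkm.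

Definition bkm_class (t : lie_term) : bkm := \pi_bkm t.

Lemma bkm_classP s t : lie_eq s t <-> bkm_class s = bkm_class t.
Proof.
by split=> [st|/eqquotP/asboolP //]; apply/eqquotP/asboolP.
Qed.

Lemma bkm_reprK (x : bkm) : bkm_class (repr x) = x.
Proof. exact: reprK. Qed.

Lemma repr_bkm_class t : lie_eq (repr (bkm_class t)) t.
Proof. by apply/bkm_classP; rewrite bkm_reprK. Qed.

Definition bkm_add (x y : bkm) : bkm := bkm_class (LAdd (repr x) (repr y)).
Definition bkm_opp (x : bkm) : bkm := bkm_class (LScale (-1) (repr x)).
Definition bkm_scale (c : R[i]) (x : bkm) : bkm := bkm_class (LScale c (repr x)).
Definition bracket (x y : bkm) : bkm := bkm_class (LBr (repr x) (repr y)).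

Lemma bkm_class_add s t :
  bkm_class (LAdd s t) = bkm_add (bkm_class s) (bkm_class t).
Proof.
by apply/bkm_classP/lie_sym/lie_add; apply: repr_bkm_class.
Qed.

Lemma bkm_class_scale c t :
  bkm_class (LScale c t) = bkm_scale c (bkm_class t).
Proof. by apply/bkm_classP/lie_sym/lie_scale; apply: repr_bkm_class. Qed.

Lemma bkm_class_br s t :
  bkm_class (LBr s t) = bracket (bkm_class s) (bkm_class t).
Proof. by apply/bkm_classP/lie_sym/lie_br; apply: repr_bkm_class. Qed.

Lemma bkm_addA : associative bkm_add.
Proof.
move=> x y z; rewrite -(bkm_reprK x) -(bkm_reprK y) -(bkm_reprK z).
by rewrite -!bkm_class_add; apply/bkm_classP/lie_addA.
Qed.

Lemma bkm_addC : commutative bkm_add.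
Proof. by move=> x y; apply/bkm_classP/lie_addC. Qed.

Lemma bkm_add0 : left_id (bkm_class LZero) bkm_add.
Proof.
move=> x; rewrite -(bkm_reprK x) -bkm_class_add.
by apply/bkm_classP/lie_add0.
Qed.

Lemma bkm_addN : left_inverse (bkm_class LZero) bkm_opp bkm_add.
Proof.
move=> x; rewrite -{2}(bkm_reprK x) -bkm_class_add.
by apply/bkm_classP/lie_addN.
Qed.

HB.instance Definition _ :=
  GRing.isZmodule.Build bkm bkm_addA bkm_addC bkm_add0 bkm_addN.

Lemma bkm_scaleA b c x : bkm_scale b (bkm_scale c x) = bkm_scale (b * c) x.
Proof.
rewrite -(bkm_reprK x) -!bkm_class_scale; exact/bkm_classP/lie_scaleA.
Qed.

Lemma bkm_scale1 : left_id 1 bkm_scale.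
Proof.
by move=> x; rewrite -{2}(bkm_reprK x); apply/bkm_classP/lie_scale1.
Qed.

Lemma bkm_scaleDr : right_distributive bkm_scale +%R.
Proof.
move=> c x y; rewrite -(bkm_reprK x) -(bkm_reprK y).
rewrite -[bkm_class _ + _]/(bkm_add _ _) -[RHS]/(bkm_add _ _).
rewrite -bkm_class_add -!bkm_class_scale -bkm_class_add.
exact/bkm_classP/lie_scaleDr.
Qed.

Lemma bkm_scaleDl x : {morph bkm_scale^~ x : b c / b + c}.
Proof.
move=> b c; rewrite -(bkm_reprK x) -!bkm_class_scale.
rewrite -[RHS]/(bkm_add _ _) -bkm_class_add.
exact/bkm_classP/lie_scaleDl.
Qed.

HB.instance Definition _ := GRing.Zmodule_isLmodule.Build R[i] bkm
  bkm_scaleA bkm_scale1 bkm_scaleDr bkm_scaleDl.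

Definition bkm_e (i : I) (k : 'I_(m i)) : bkm := bkm_class (LGen (GenE k)).
Definition bkm_f (i : I) (k : 'I_(m i)) : bkm := bkm_class (LGen (GenF k)).

Definition root_space (a : Q) : set bkm :=
  [set x | exists2 t, lie_homog a t & x = bkm_class t].

Definition graded_part (P : set Q) : set bkm :=
  lspan [set x | exists2 a, P a & root_space a x].

End ColoredBKM.

Definition monster_idx : choiceType := {i : int | (i == -1) || (0 < i)}.

Definition idx_m1 : monster_idx := exist _ (-1 : int) isT.

Section MonstrousLieSuperalgebra.
Variables (R : realType) (f : int -> int).
Variable C : monster_idx -> monster_idx -> R[i].

Definition is_coloring : Prop :=
  [/\ forall i j, C i j * C j i = 1,
      forall i, 0 < f (val i) -> C i i = 1
    & forall i, f (val i) < 0 -> C i i = -1].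

Definition monster_matrix (i j : monster_idx) : int := - (val i + val j).
Definition monster_charge (i : monster_idx) : nat := `|f (val i)|%N.

Definition monstrous : lmodType R[i] := bkm monster_matrix monster_charge C.

(* The image of a under the linear map alpha_i |-> (1, i). *)
Definition II_degree (a : {freeg monster_idx}) : int * int :=
  (\sum_(i <- dom a) coeff i a, \sum_(i <- dom a) coeff i a * val i).

Local Notation part := (@graded_part R _ monster_matrix monster_charge C).

Definition L_ (m n : int) : set monstrous :=
  part [set a | II_degree a = (m, n)].
Definition L_pos : set monstrous := part [set a | 0 < (II_degree a).1].
Definition L_neg : set monstrous := part [set a | (II_degree a).1 < 0].

Definition L_even : set monstrous := part [set a | parity_sign C a = 1].
Definition L_odd : set monstrous := part [set a | parity_sign C a = -1].

Definition supertrace (phi : monstrous -> monstrous) (m n : int) : R[i] :=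
  trace_on (part [set a | II_degree a = (m, n) /\ parity_sign C a = 1]) phi
  - trace_on (part [set a | II_degree a = (m, n) /\ parity_sign C a = -1]) phi.

Definition monster_bracket : monstrous -> monstrous -> monstrous :=
  @bracket R _ monster_matrix monster_charge C.
(* When f(-1) = 1, the index k ranges over a singleton for i = -1, and
   monster_e k, monster_f k are the generators e_{-1}, f_{-1}. *)
Definition monster_e (i : monster_idx) (k : 'I_(monster_charge i)) : monstrous :=
  bkm_e monster_matrix C k.
Definition monster_f (i : monster_idx) (k : 'I_(monster_charge i)) : monstrous :=
  bkm_f monster_matrix C k.

Definition super_morphism_on (W : set monstrous)
    (phi : monstrous -> monstrous) : Prop :=
  [/\ forall x y, W x -> W y ->
        phi (monster_bracket x y) = monster_bracket (phi x) (phi y),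
      forall x, W x -> L_even x -> L_even (phi x)
    & forall x, W x -> L_odd x -> L_odd (phi x)].

(* The gradation is preserved, so each act g maps L_pos and L_neg to
   themselves; bijectivity comes from the group action. *)
Record super_action (G : groupType) (act : G -> monstrous -> monstrous) : Prop := {
  act_one : forall x, act 1%g x = x;
  act_mul : forall g h x, act (g * h)%g x = act g (act h x);
  act_linear : forall g, linear (act g);
  act_graded : forall g m n x, L_ m n x -> L_ m n (act g x);
  act_pos : forall g, super_morphism_on L_pos (act g);
  act_neg : forall g, super_morphism_on L_neg (act g)
}.

End MonstrousLieSuperalgebra.

(* Main.v *)
(* For m, n > 0 the root space L_(-m,-n) lies in the subalgebra generated by the elements
   w_{i,l,j} = (ad f_{-1})^j f_{i,l}, where 0 <= j < i and w_{i,l,j} has degree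
   (-(j + 1), -(i - j)). This subalgebra is free: L acts on the tensor algebra over the
   letters w_{i,l,j}, with f_{i,l} acting as left multiplication by w_{i,l,0} and f_{-1}
   as a derivation. Lazard elimination, one letter at a time, produces homogeneous
   elements z such that the z and the [z, z] with z odd form a basis of the free algebra,
   and at each step the identity 1 - sum (letters) = (1 - x) (1 - sum (new letters))
   holds for the generating functions. Choosing the f_{i,l} so that g acts triangularly
   on them makes g triangular on this basis, and taking logarithms gives
     sum_{k | (m,n)} 1/k str(g^k | L_(-m/k,-n/k))
       = [p^m q^n] -log (1 - sum_{i,j > 0} f_g(i + j - 1) p^i q^j).
   By the recursion for Faber polynomials the right-hand side is 1/m times the coefficient
   of q^n in P_m(F_g). Comparing asymptotic expansions as tau tends to i oo in the
   definition of replicability shows that it is also sum_{a | (m,n)} 1/a f_g^(a)(mn/a^2),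
   and Moebius inversion in the powers of g isolates str(g | L_(-m,-n)). *)
Require Import Defs.
From mathcomp Require Import ring zify spectral.
Set Implicit Arguments.
Unset Strict Implicit.
Unset Printing Implicit Defensive.
Import Order.TTheory GRing.Theory Num.Theory.
Import numFieldNormedType.Exports.
Local Open Scope ring_scope.
Local Open Scope complex_scope.

(** * Coloring forms and representations by operators *)

(** Two obstacles shape the proof. The algebra is given by generators and relations, so nothing is
    known to be nonzero in it; and a group element may have infinite order, so it need not be
    diagonalizable. Against the first, words in the letters are applied to the empty word of the
    tensor algebra. They give independent vectors, and elimination carries this independence along,
    so that neither enveloping algebras nor a Poincare-Birkhoff-Witt theorem is needed: only the
    operators 1, z and z^2 are compared, the last because [z, z] acts as 2 z^2 for odd z. Against
    the second, a Schur form of g on the span of the f_{i,l} for each i is enough, since traces of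
    powers depend only on the diagonal. The coloured commutator of two operators depends on their
    degrees, so a term acts by a family of homogeneous components rather than by one operator.
    Everything is cut off at a bound N: finitely many letters, brackets of bounded degree, and
    polynomials modulo x^(N+1) in place of power series. Logarithms enter through -x d/dx log, which
    is determined by a polynomial recursion on coefficients. *)

Section ColoringForm.
Variables (R : realType) (I : choiceType) (C : I -> I -> R[i]).
Hypothesis CC : forall i j, C i j * C j i = 1.
Implicit Types a b c : {freeg I}.
Local Notation cf := (coloring_form C).

Lemma coloring_neq0 i j : C i j != 0.
Proof.
by apply/eqP => c0; move/eqP: (CC i j); rewrite c0 mul0r eq_sym oner_eq0.
Qed.

Lemma prod_dom_sup a (g : int -> I -> R[i]) (s : seq I) :
  (forall i, g 0 i = 1) -> uniq s -> {subset dom a <= s} ->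
  \prod_(i <- dom a) g (coeff i a) i = \prod_(i <- s) g (coeff i a) i.
Proof.
move=> g0 us sub.
rewrite [RHS](bigID (mem (dom a))) /= [X in _ * X]big1 ?mulr1; last first.
  by move=> i Ni; rewrite coeff_outdom.
rewrite -[RHS]big_filter; apply: perm_big; apply: uniq_perm.
- exact: uniq_dom.
- exact: filter_uniq.
by move=> i; rewrite mem_filter /=; case: (boolP (i \in dom a)) => // /sub ->.
Qed.

(** The support of a + b may be smaller than the union of the supports, so bimultiplicativity is
    checked over one list that contains all supports involved. *)
Lemma coloring_formE a b s1 s2 : uniq s1 -> uniq s2 ->
  {subset dom a <= s1} -> {subset dom b <= s2} ->
  cf a b = \prod_(i <- s1) \prod_(j <- s2) C i j ^ (coeff i a * coeff j b).
Proof.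
move=> u1 u2 sub1 sub2; rewrite /coloring_form.
rewrite (@prod_dom_sup a (fun x i => \prod_(j <- dom b) C i j ^ (x * coeff j b)) s1) //.
  apply: eq_bigr => i _.
  apply: (@prod_dom_sup b (fun x j => C i j ^ (coeff i a * x)) s2) => // j.
  by rewrite mulr0 expr0z.
by move=> i; rewrite big1 // => j _; rewrite mul0r expr0z.
Qed.

Lemma coloring_formDl a b c : cf (a + b) c = cf a c * cf b c.
Proof.
pose s := undup (dom a ++ dom b).
have us : uniq s by exact: undup_uniq.
have sa : {subset dom a <= s} by move=> i ia; rewrite mem_undup mem_cat ia.
have sb : {subset dom b <= s} by move=> i ia; rewrite mem_undup mem_cat ia orbT.
have sab : {subset dom (a + b) <= s}.
  by move=> i /domD_subset; rewrite mem_undup.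
rewrite (coloring_formE us (uniq_dom c) sab (fun _ => id)).
rewrite (coloring_formE us (uniq_dom c) sa (fun _ => id)).
rewrite (coloring_formE us (uniq_dom c) sb (fun _ => id)).
rewrite -big_split; apply: eq_bigr => i _; rewrite -big_split.
by apply: eq_bigr => j _; rewrite coeffD mulrDl expfzDr ?coloring_neq0.
Qed.

Lemma coloring_form_skew a b : cf a b * cf b a = 1.
Proof.
rewrite /coloring_form [X in _ * X]exchange_big /= -big_split /= big1 // => i _.
rewrite -big_split /= big1 // => j _.
by rewrite [_ a * _]mulrC -exprMz_comm ?CC ?exp1rz //; rewrite ?unitfE ?coloring_neq0 //; exact: mulrC.
Qed.

Lemma coloring_form_neq0 a b : cf a b != 0.
Proof.
by apply/eqP => c0; move/eqP: (coloring_form_skew a b); rewrite c0 mul0r eq_sym oner_eq0.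
Qed.

Lemma coloring_formDr a b c : cf a (b + c) = cf a b * cf a c.
Proof.
have inv x : cf a x = (cf x a)^-1.
  by apply: (mulIf (coloring_form_neq0 x a)); rewrite coloring_form_skew mulVf // coloring_form_neq0.
by rewrite !inv coloring_formDl invfM.
Qed.

Lemma coloring_form0l a : cf 0 a = 1.
Proof. by rewrite /coloring_form dom0 big_nil. Qed.

Lemma coloring_form0r a : cf a 0 = 1.
Proof. by rewrite /coloring_form dom0 big1 // => i _; rewrite big_nil. Qed.

Lemma coloring_formU i j : cf << i >> << j >> = C i j.
Proof.
by rewrite /coloring_form !domU1 !big_seq1 !coeffU !eqxx.
Qed.

Lemma coloring_formNl a b : cf (- a) b = cf b a.
Proof.
apply: (mulIf (coloring_form_neq0 a b)).
by rewrite -coloring_formDl addNr coloring_form0l coloring_form_skew.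
Qed.

Lemma coloring_formNr a b : cf a (- b) = cf b a.
Proof.
apply: (mulIf (coloring_form_neq0 a b)).
by rewrite -coloring_formDr addNr coloring_form0r coloring_form_skew.
Qed.

(** The cross terms [cf a b * cf b a] cancel by skewness, so the parity sign is a character although
    it comes from a quadratic expression. *)
Lemma parity_signD a b :
  parity_sign C (a + b) = parity_sign C a * parity_sign C b.
Proof.
rewrite /parity_sign coloring_formDl !coloring_formDr.
by rewrite mulrA -[X in X * _]mulrA coloring_form_skew mulr1.
Qed.

End ColoringForm.

Section LinearMaps.
Variables (K : nzRingType) (U V : lmodType K) (X : U -> V).
Hypothesis lX : linear X.
Implicit Types u v : U.

Lemma lin0 : X 0 = 0.
Proof. by have := lX (-1) 0 0; rewrite scaler0 add0r scaleN1r addNr. Qed.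
Lemma linD u v : X (u + v) = X u + X v.
Proof. by rewrite -[u in LHS]scale1r lX scale1r. Qed.
Lemma linZ k u : X (k *: u) = k *: X u.
Proof. by rewrite -[k *: u]addr0 lX lin0 addr0. Qed.
Lemma linN u : X (- u) = - X u.
Proof. by rewrite -scaleN1r linZ scaleN1r. Qed.
Lemma linB u v : X (u - v) = X u - X v.
Proof. by rewrite linD linN. Qed.
Lemma lin_sum J (r : seq J) (P : pred J) (F : J -> U) :
  X (\sum_(j <- r | P j) F j) = \sum_(j <- r | P j) X (F j).
Proof. exact: (big_morph X linD lin0). Qed.

End LinearMaps.

Section ColoredCommutator.
Variables (R : realType) (I : choiceType) (C : I -> I -> R[i]).
Hypothesis CC : forall i j, C i j * C j i = 1.
Local Notation cf := (coloring_form C).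
Variable M : lmodType R[i].
Implicit Types (X Y Z : M -> M) (a b c : {freeg I}) (u : M).

Definition colored_comm a b X Y : M -> M := fun u => X (Y u) - cf a b *: Y (X u).

Lemma colored_comm_linear a b X Y :
  linear X -> linear Y -> linear (colored_comm a b X Y).
Proof.
move=> lX lY k u v; rewrite /colored_comm lX lY lX lY scalerBr !scalerDr.
by rewrite !scalerA [k * _]mulrC opprD addrACA.
Qed.

Lemma colored_comm_skew a b X Y u :
  colored_comm a b X Y u = - cf a b *: colored_comm b a Y X u.
Proof.
rewrite /colored_comm scalerBr scalerA mulNr coloring_form_skew //.
by rewrite !scaleNr scale1r opprK addrC.
Qed.

(** The labels a, b, d need not be degrees of the operators: the identity is formal and uses only
    bimultiplicativity and skewness of the form. *)
Lemma colored_comm_jacobi a b d X Y Z u : linear X -> linear Y -> linear Z ->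
  colored_comm a (b + d) X (colored_comm b d Y Z) u =
  colored_comm (a + b) d (colored_comm a b X Y) Z u
  + cf a b *: colored_comm b (a + d) Y (colored_comm a d X Z) u.
Proof.
move=> lS lT lV; rewrite /colored_comm.
rewrite !(linB lS, linB lT, linB lV, linZ lS, linZ lT, linZ lV).
rewrite !(coloring_formDl CC) !(coloring_formDr CC) !scalerBr !scalerA.
have e : cf a b * cf b a = 1 by exact: coloring_form_skew.
set x1 := X (Y (Z u)); set x2 := Y (X (Z u)); set x3 := X (Z (Y u)).
set x4 := Y (Z (X u)); set x5 := Z (X (Y u)); set x6 := Z (Y (X u)).
rewrite !(mulrA (cf a b) (cf b a)) e mul1r !opprB.
rewrite [cf b d * cf a d]mulrC [_ * cf a b]mulrC [cf a b * (_ * _)]mulrA.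
by rewrite [RHS](AC (2*2*(2*2)) ((1*8)*(3*6)*((2*5)*(4*7)))) /= !addNr !addr0.
Qed.

End ColoredCommutator.

Section OperatorRepresentation.
Variables (R : realType) (I : choiceType).
Variables (A : I -> I -> int) (m : I -> nat) (C : I -> I -> R[i]).
Hypothesis CC : forall i j, C i j * C j i = 1.
Local Notation Q := {freeg I}.
Local Notation cf := (coloring_form C).
Variable M : lmodType R[i].
Implicit Types (X Y Z : M -> M) (a b c : Q) (s t : lie_term R m) (u v : M).

Local Notation colored_comm := (colored_comm C).

Variable op : bkm_gen m -> M -> M.
Hypothesis op_lin : forall g, linear (op g).

(** Terms need not be homogeneous, so their components are indexed by degrees. This list contains
    every degree in which a component can be nonzero and keeps the sum in the bracket case of
    [component] finite. *)
Fixpoint degrees t : seq Q :=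
  match t with
  | LGen g => [:: gen_degree g]
  | LZero => [::]
  | LAdd s t => degrees s ++ degrees t
  | LScale c s => degrees s
  | LBr s t => [seq a + b | a <- degrees s, b <- degrees t]
  end.

(* The component of degree a of the operator by which t acts. *)
Fixpoint component t a : M -> M :=
  match t with
  | LGen g => fun u => if a == gen_degree g then op g u else 0
  | LZero => fun u => 0
  | LAdd s t => fun u => component s a u + component t a u
  | LScale c s => fun u => c *: component s a u
  | LBr s t => fun u => \sum_(b <- undup (degrees s))
      colored_comm b (a - b) (component s b) (component t (a - b)) u
  end.

Lemma component_linear t a : linear (component t a).
Proof.
elim: t a => [g||s IHs t IHt|c s IHs|s IHs t IHt] a k u v /=.
- by case: eqP => _; rewrite ?op_lin // scaler0 addr0.
- by rewrite scaler0 addr0.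
- by rewrite IHs IHt scalerDr addrACA.
- by rewrite IHs scalerDr !scalerA mulrC.
- rewrite scaler_sumr -big_split; apply: eq_bigr => b _.
  exact: colored_comm_linear.
Qed.

Lemma componentD s t a u :
  component (LAdd s t) a u = component s a u + component t a u.
Proof. by []. Qed.
Lemma componentZ k s a u : component (LScale k s) a u = k *: component s a u.
Proof. by []. Qed.

Lemma component0 t a : component t a 0 = 0.
Proof. exact/lin0/component_linear. Qed.

Lemma component_out t a u : a \notin degrees t -> component t a u = 0.
Proof.
elim: t a u => [g||s IHs t IHt|c s IHs|s IHs t IHt] a u //=.
- by rewrite inE => /negPf ->.
- by rewrite mem_cat negb_or => /andP[/IHs -> /IHt ->]; rewrite addr0.
- by move/IHs ->; rewrite scaler0.
move=> Na; rewrite big1_seq // => b; rewrite mem_undup => /andP[_ bs].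
have Nt : a - b \notin degrees t.
  apply: contra Na => abt; apply/allpairsP.
  by exists (b, a - b); split=> //=; rewrite addrC subrK.
by rewrite /colored_comm !IHt // component0 scaler0 subr0.
Qed.

(** Equal elements of the algebra may be represented by terms with different lists of degrees;
    enlarging the range of summation makes their brackets comparable. *)
Lemma component_br s t S c u : uniq S -> {subset degrees s <= S} ->
  component (LBr s t) c u =
  \sum_(b <- S) colored_comm b (c - b) (component s b) (component t (c - b)) u.
Proof.
move=> uS sub /=; rewrite [RHS](bigID (mem (degrees s))) /=.
rewrite [X in _ + X]big1 ?addr0; last first.
  move=> b Nb; rewrite /colored_comm !(component_out _ Nb) component0 scaler0 subr0 //.
rewrite -[RHS]big_filter; apply: perm_big; apply: uniq_perm.
- exact: undup_uniq.
- exact: filter_uniq.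
by move=> b; rewrite mem_undup mem_filter /=; case: (boolP (b \in _)) => // /sub ->.
Qed.

Lemma component_homog a t b u : lie_homog a t -> b != a -> component t b u = 0.
Proof.
move=> h; elim: h b u => {a t} [g|a|a s t _ IHs _ IHt|a c t _ IH|a b s t _ IHs _ IHt] e u Ne //=.
- by rewrite (negPf Ne).
- by rewrite IHs // IHt // addr0.
- by rewrite IH // scaler0.
rewrite big1 // => d _; rewrite /colored_comm.
case: (eqVneq d a) => [da|Nd]; last first.
  by rewrite !(IHs _ _ Nd) component0 scaler0 subr0.
have Nb : e - d != b by apply: contra Ne => /eqP <-; rewrite da addrC subrK.
by rewrite !(IHt _ _ Nb) component0 scaler0 subr0.
Qed.

Lemma component_homog_br a s t c : lie_homog a s ->
  component (LBr s t) c =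
  colored_comm a (c - a) (component s a) (component t (c - a)).
Proof.
move=> hs; apply/funext => u.
rewrite (@component_br s t (undup (a :: degrees s))) ?undup_uniq //; last first.
  by move=> b bs; rewrite mem_undup inE bs orbT.
rewrite (bigD1_seq a) ?undup_uniq ?mem_undup ?mem_head //.
rewrite big1 /= ?addr0 // => b Nb; rewrite /colored_comm !(component_homog _ hs Nb).
by rewrite component0 scaler0 subr0.
Qed.

Hypothesis op_rel : forall s t, bkm_rel A s t ->
  forall a u, component s a u = component t a u.

Lemma component_lie_eq s t : lie_eq A C s t ->
  forall a u, component s a u = component t a u.
Proof.
elim=> {s t}.
- by [].
- by move=> s t _ IH a u; rewrite IH.
- by move=> s t v _ IH1 _ IH2 a u; rewrite IH1.
- by move=> s s' t t' _ IH1 _ IH2 a u /=; rewrite IH1 IH2.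
- by move=> c t t' _ IH a u /=; rewrite IH.
- move=> s s' t t' _ IH1 _ IH2 a u.
  pose S := undup (degrees s ++ degrees s').
  have uS : uniq S by exact: undup_uniq.
  rewrite (component_br _ _ _ uS); last by move=> b bs; rewrite mem_undup mem_cat bs.
  rewrite (component_br _ _ _ uS); last by move=> b bs; rewrite mem_undup mem_cat bs orbT.
  by apply: eq_bigr => b _; rewrite /colored_comm !(IH1, IH2).
- by move=> s t v a u /=; rewrite addrA.
- by move=> s t a u /=; rewrite addrC.
- by move=> t a u /=; rewrite add0r.
- by move=> t a u /=; rewrite scaleN1r addNr.
- by move=> b c t a u /=; rewrite scalerA.
- by move=> t a u /=; rewrite scale1r.
- by move=> c s t a u /=; rewrite scalerDr.
- by move=> b c t a u /=; rewrite scalerDl.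
- move=> s t v a u.
  pose S := undup (degrees s ++ degrees t).
  have uS : uniq S by exact: undup_uniq.
  rewrite componentD.
  rewrite (component_br v a u uS); last by move=> b bs; rewrite mem_undup.
  rewrite (component_br v a u uS); last by move=> b bs; rewrite mem_undup mem_cat bs.
  rewrite (component_br v a u uS); last by move=> b bs; rewrite mem_undup mem_cat bs orbT.
  rewrite -big_split /=; apply: eq_bigr => b _; rewrite /colored_comm /=.
  rewrite (linD (component_linear _ _)).
  by rewrite scalerDr opprD addrACA.
- move=> s t v a u /=; rewrite -big_split; apply: eq_bigr => b _; rewrite /colored_comm /=.
  rewrite (linD (component_linear _ _)).
  by rewrite scalerDr opprD addrACA.
- move=> c s t a u /=; rewrite scaler_sumr; apply: eq_bigr => b _; rewrite /colored_comm /=.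
  rewrite (linZ (component_linear _ _)).
  by rewrite scalerBr !scalerA mulrC.
- move=> c s t a u /=; rewrite scaler_sumr; apply: eq_bigr => b _; rewrite /colored_comm /=.
  rewrite (linZ (component_linear _ _)).
  by rewrite scalerBr !scalerA mulrC.
(* Skew symmetry is imposed on homogeneous terms only, so a single degree c = a + b survives and the
   identity for coloured commutators applies there. *)
- move=> a b s t hs ht c u.
  rewrite componentZ.
  rewrite (component_homog_br _ _ hs) (component_homog_br _ _ ht).
  case: (eqVneq c (a + b)) => [->|Nc]; last first.
    have Nb : c - a != b by apply: contra Nc => /eqP <-; rewrite addrC subrK.
    have Na : c - b != a by apply: contra Nc => /eqP <-; rewrite subrK.
    rewrite /colored_comm !(component_homog _ hs Na) !(component_homog _ ht Nb).
    by rewrite !component0 !(scaler0, subr0).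
  rewrite addrK [a + b - a]addrAC subrr add0r /colored_comm.
  by rewrite scalerBr scalerA mulNr coloring_form_skew // !scaleNr scale1r opprK addrC.
- move=> a b s t v hs ht c u.
  rewrite componentD componentZ.
  rewrite !(component_homog_br _ _ hs) !(component_homog_br _ _ ht).
  rewrite (component_homog_br _ _ (homog_br hs ht)) !(component_homog_br _ _ hs).
  have -> : c - (a + b) = c - a - b by rewrite opprD addrA.
  have -> : a + b - a = b by rewrite addrAC subrr add0r.
  have -> : c - b - a = c - a - b by rewrite addrAC.
  have e1 : c - a = b + (c - a - b) by rewrite [RHS]addrC subrK.
  have e2 : c - b = a + (c - a - b) by rewrite [RHS]addrC addrAC subrK.
  by rewrite {1}e1 {1}e2 -colored_comm_jacobi //; apply: component_linear.
- by move=> s t /op_rel.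
Qed.

Local Notation L := (bkm A m C).

Definition rho a (x : L) : M -> M := component (repr x) a.

Lemma rho_class a t : rho a (bkm_class A C t) = component t a.
Proof. by apply/funext => u; apply/component_lie_eq/repr_bkm_class. Qed.

Lemma rho_linear a (x : L) : linear (rho a x).
Proof. exact: component_linear. Qed.

Lemma rho_linearl a u : linear (fun x : L => rho a x u).
Proof.
move=> k x y; rewrite -(bkm_reprK x) -(bkm_reprK y).
rewrite -[k *: _]/(bkm_scale _ _) -[_ + _]/(bkm_add _ _).
by rewrite -bkm_class_scale -bkm_class_add !rho_class.
Qed.

Lemma rho_br a b (x y : L) : root_space a x ->
  rho (a + b) (bracket x y) = colored_comm a b (rho a x) (rho b y).
Proof.
case=> t ht ->; rewrite -(bkm_reprK y) -bkm_class_br !rho_class.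
by rewrite (component_homog_br _ _ ht) addrAC subrr add0r.
Qed.

Lemma rho_homog a b (x : L) u : root_space a x -> b != a -> rho b x u = 0.
Proof. by case=> t ht -> Nb; rewrite rho_class (component_homog _ ht). Qed.
End OperatorRepresentation.

(** * Elimination in free colored Lie superalgebras *)

Section Span.
Variables (K : fieldType) (V : lmodType K).
Implicit Types (S T : V -> Prop) (x y : V).

Inductive lin_span S : V -> Prop :=
  | span0 : lin_span S 0
  | span_cons k x y : S x -> lin_span S y -> lin_span S (k *: x + y).

Lemma span_in S x : S x -> lin_span S x.
Proof. by move=> Sx; rewrite -[x]scale1r -[_ *: x]addr0; apply: span_cons => //; exact: span0. Qed.

Lemma spanD S x y : lin_span S x -> lin_span S y -> lin_span S (x + y).
Proof.
move=> Sx Sy; elim: Sx => [|k u v Su _ IH]; first by rewrite add0r.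
by rewrite -addrA; exact: span_cons.
Qed.

Lemma spanZ S k x : lin_span S x -> lin_span S (k *: x).
Proof.
elim=> [|c u v Su _ IH]; first by rewrite scaler0; exact: span0.
by rewrite scalerDr scalerA; exact: span_cons.
Qed.

Lemma spanN S x : lin_span S x -> lin_span S (- x).
Proof. by rewrite -scaleN1r; exact: spanZ. Qed.

Lemma spanB S x y : lin_span S x -> lin_span S y -> lin_span S (x - y).
Proof. by move=> Sx Sy; apply: spanD => //; exact: spanN. Qed.

Lemma span_sum S J (r : seq J) (P : pred J) (F : J -> V) :
  (forall j, P j -> lin_span S (F j)) -> lin_span S (\sum_(j <- r | P j) F j).
Proof. by move=> h; apply: (big_ind (lin_span S)) => //; [exact: span0 | exact: spanD]. Qed.

Lemma span_bind S T x : lin_span S x -> (forall y, S y -> lin_span T y) -> lin_span T x.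
Proof.
move=> Sx h; elim: Sx => [|k u v Su _ IH]; first exact: span0.
by apply: spanD => //; apply/spanZ/h.
Qed.

Lemma span_sub S T x : (forall y, S y -> T y) -> lin_span S x -> lin_span T x.
Proof. by move=> h Sx; apply: span_bind Sx _ => y /h; exact: span_in. Qed.

End Span.

Lemma span_image (K : fieldType) (U V : lmodType K) (X : U -> V) (S : U -> Prop)
    (T : V -> Prop) x : linear X -> lin_span S x ->
  (forall y, S y -> lin_span T (X y)) -> lin_span T (X x).
Proof.
move=> lX Sx h; elim: Sx => [|k u v Su _ IH].
  by have := lX (-1) 0 0; rewrite scaler0 add0r scaleN1r addNr => ->; exact: span0.
by rewrite lX; apply: spanD => //; apply/spanZ/h.
Qed.

Section Independence.
Variables (K : fieldType) (V : lmodType K).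

Definition indep (J : eqType) (v : J -> V) := forall (s : seq J) (k : J -> K),
  uniq s -> \sum_(j <- s) k j *: v j = 0 -> forall j, j \in s -> k j = 0.

Lemma span_comb (J : eqType) (v : J -> V) (P : J -> Prop) x :
  lin_span (fun y => exists2 j, P j & y = v j) x ->
  exists (s : seq J) (k : J -> K), [/\ uniq s, forall j, j \in s -> P j
     & x = \sum_(j <- s) k j *: v j].
Proof.
elim=> [|c _ y [j Pj ->] _ [s [k [us sP ->]]]].
  by exists [::], (fun=> 0); rewrite big_nil.
case: (boolP (j \in s)) => js.
  exists s, (fun i => if i == j then c + k j else k i); split => //.
  rewrite !(bigD1_seq j js us) /= eqxx scalerDl addrA; congr (_ + _).
  by apply: eq_bigr => i /negPf ->.
exists (j :: s), (fun i => if i == j then c else k i); split.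
- by rewrite /= js.
- by move=> i; rewrite inE => /orP[/eqP ->|/sP].
rewrite big_cons eqxx; congr (_ + _); apply: eq_big_seq => i si.
by case: eqP => // ij; rewrite -ij si in js.
Qed.

Lemma indep_notin (J : eqType) (v : J -> V) j0 : indep v ->
  ~ lin_span (fun y => exists2 j, j != j0 & y = v j) (v j0).
Proof.
move=> iv /span_comb [s [k [us sP e]]].
have j0s : j0 \notin s by apply/negP => /sP; rewrite eqxx.
have := iv (j0 :: s) (fun j => if j == j0 then 1 else - k j).
rewrite /= j0s us big_cons eqxx scale1r {1}e => /(_ isT).
rewrite -big_split big1_seq => [|j /andP[_ js]]; last first.
  by rewrite ifN ?sP // scaleNr /= addrN.
by move=> /(_ erefl j0 (mem_head _ _)) /eqP; rewrite eqxx oner_eq0.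
Qed.

(** In a relation among the v', take an index j0 with nonzero coefficient and [mu (phi j0)] maximal.
    Solving for [v (phi j0)] writes it through other members of the family v, since all lower terms
    have smaller [mu]. *)
Lemma indep_triangular (I J : eqType) (v : I -> V) (v' : J -> V) (phi : J -> I)
    (mu : I -> nat) : indep v -> injective phi ->
  (forall j, lin_span (fun y => exists2 i, (mu i < mu (phi j))%N & y = v i)
       (v' j - v (phi j))) -> indep v'.
Proof.
move=> iv phiI tri s k us e j1 j1s; apply/eqP/negPn/negP => k1.
pose D := [seq j <- s | k j != 0].
have j1D : j1 \in D by rewrite mem_filter k1.
have [j0 j0D jmax] : exists2 j0, j0 \in D &
    forall j, j \in D -> (mu (phi j) <= mu (phi j0))%N.
  have : D != [::] by apply/eqP => D0; rewrite D0 in j1D.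
  elim: (D) => // j [|j2 E] IH _.
    by exists j; rewrite ?mem_head // => ?; rewrite inE => /eqP ->.
  have [//|j3 h3 m3] := IH.
  case: (leqP (mu (phi j)) (mu (phi j3))) => h.
    by exists j3 => [|j4]; rewrite inE ?h3 ?orbT // => /orP[/eqP ->|/m3].
  exists j; first exact: mem_head.
  by move=> j4; rewrite inE => /orP[/eqP -> //|/m3 m4]; exact: leq_trans m4 (ltnW h).
have := j0D; rewrite mem_filter => /andP[k0 j0s].
have eD : \sum_(j <- D) k j *: v' j = 0.
  rewrite big_filter -[RHS]e [RHS](bigID (fun j => k j != 0)) /= [X in _ = _ + X]big1 ?addr0 //.
  by move=> j /negPn /eqP ->; rewrite scale0r.
have uD : uniq D by exact: filter_uniq.
apply: (indep_notin (j0 := phi j0) iv).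
have -> : v (phi j0) = (k j0)^-1 *: (- (\sum_(j <- D | j != j0) k j *: v (phi j))
    - \sum_(j <- D) k j *: (v' j - v (phi j))).
  under [X in _ - X]eq_bigr do rewrite scalerBr.
  rewrite sumrB eD sub0r opprK [X in _ + X](bigD1_seq j0) //= addrCA addNr addr0.
  by rewrite scalerA mulVf // scale1r.
apply/spanZ/spanB; first apply: spanN.
  by apply: span_sum => j jj0; apply/spanZ/span_in; exists (phi j) => //; rewrite (inj_eq phiI).
rewrite big_seq; apply: span_sum => j jD; apply: spanZ.
apply: span_sub (tri j) => y [i ilt ->]; exists i => //.
by apply: contraTneq ilt => ->; rewrite -leqNgt; exact: jmax.
Qed.

Lemma indep_sub (I J : eqType) (v : I -> V) (v' : J -> V) (phi : J -> I) :
  indep v -> injective phi -> (forall j, v' j = v (phi j)) -> indep v'.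
Proof.
move=> iv phiI e; apply: (@indep_triangular I J v v' phi (fun=> 0%N)) => // j.
by rewrite e subrr; exact: span0.
Qed.

End Independence.

(* For p without constant term, H is the logarithmic derivative -x d/dx log(1 - p)
   up to degree N exactly when (1 - p) H = x p' modulo x^(N+1). *)
Section LogDerivative.
Variables (A : comNzRingType) (N : nat).
Implicit Types p q r H : {poly A}.

Definition eqX p q := exists r, p = q + 'X^(N.+1) * r.

Lemma eqX_refl p : eqX p p. Proof. by exists 0; rewrite mulr0 addr0. Qed.
Lemma eqX_sym p q : eqX p q -> eqX q p.
Proof. by case=> r ->; exists (- r); ring. Qed.
Lemma eqX_trans p q r : eqX p q -> eqX q r -> eqX p r.
Proof. by case=> r1 -> [r2 ->]; exists (r2 + r1); ring. Qed.
Lemma eqXD p q p' q' : eqX p q -> eqX p' q' -> eqX (p + p') (q + q').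
Proof. by case=> r -> [r' ->]; exists (r + r'); ring. Qed.
Lemma eqXM p q p' q' : eqX p q -> eqX p' q' -> eqX (p * p') (q * q').
Proof. by case=> r -> [r' ->]; exists (r * q' + q * r' + 'X^(N.+1) * (r * r')); ring. Qed.
Lemma eqX_deriv p q : eqX p q -> eqX ('X * p^`()) ('X * q^`()).
Proof.
case=> r ->; exists (N.+1%:R * r + 'X * r^`()).
by rewrite derivD derivM derivXn -mulr_natl /= [in RHS]exprS exprS; ring.
Qed.
Lemma eqX_coef p q i : eqX p q -> (i <= N)%N -> p`_i = q`_i.
Proof. by case=> r -> iN; rewrite coefD coefXnM ltnS iN addr0. Qed.

Definition logderiv p H := eqX ((1 - p) * H) ('X * p^`()).

(** Logarithmic derivatives turn products into sums; d is the Leibniz rule modulo x^(N+1). *)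
Lemma logderiv_mul p q r Hq Hr : eqX (1 - p) ((1 - q) * (1 - r)) ->
  logderiv q Hq -> logderiv r Hr -> logderiv p (Hq + Hr).
Proof.
move=> e hq hr; apply: eqX_trans (eqXM e (eqX_refl _)) _.
have d : eqX ('X * p^`()) ((1 - r) * ('X * q^`()) + (1 - q) * ('X * r^`())).
  have := eqX_deriv e; rewrite derivM !derivB derivC !sub0r.
  by case=> s es; exists (- s); rewrite -[LHS]opprK -mulrN es; ring.
apply: eqX_trans (eqX_sym d).
have -> : (1 - q) * (1 - r) * (Hq + Hr)
  = (1 - r) * ((1 - q) * Hq) + (1 - q) * ((1 - r) * Hr) by ring.
by apply: eqXD; apply: eqXM => //; exact: eqX_refl.
Qed.

(** Truncated expansion of [d a x^d / (1 - a x^d)], which is -x d/dx log(1 - a x^d). *)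
Definition log_monomial (d : nat) (a : A) : {poly A} :=
  \sum_(k < N) (d%:R * a ^+ k.+1) *: 'X^(d * k.+1).

Lemma logderiv_monomial d a : (0 < d)%N -> logderiv (a *: 'X^d) (log_monomial d a).
Proof.
move=> d0; rewrite /logderiv; set t := a *: 'X^d.
have -> : log_monomial d a = d%:R * (t * \sum_(k < N) t ^+ k).
  rewrite mulr_sumr mulr_sumr; apply: eq_bigr => k _.
  by rewrite -exprS /t exprZn -exprM -scalerA scaler_nat mulr_natl.
have -> : 'X * t^`() = d%:R * t.
  rewrite /t derivZ derivXn -mulr_natl -!scalerAr; congr (_ *: _).
  by rewrite mulrCA -exprS prednK.
have e : (1 - t) * \sum_(k < N) t ^+ k = 1 - t ^+ N.
  by rewrite -[RHS]opprB subrX1 -mulNr opprB.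
have [c ec] : exists c, t ^+ N.+1 = 'X^(N.+1) * c.
  exists ((a *: 'X^(d.-1)) ^+ N.+1); rewrite -exprMn; congr (_ ^+ _).
  by rewrite -scalerAr -exprS prednK.
exists (- d%:R * c).
transitivity (d%:R * t * ((1 - t) * \sum_(k < N) t ^+ k)); first by ring.
rewrite e mulrBr mulr1 -mulrA -exprS ec; ring.
Qed.

(** The coefficient of x^n in (1 - p) H = x p'. The term with i = n drops out because H has no
    constant term, so p determines H up to degree N. *)
Lemma logderiv_coef p H n : p`_0 = 0 -> logderiv p H -> (n <= N)%N ->
  H`_n = n%:R * p`_n + \sum_(i < n) p`_i * H`_(n - i).
Proof.
move=> p0 h nN; have H0 : H`_0 = 0.
  have := eqX_coef h (leq0n N); rewrite mulrBl mul1r coefB coefXM coefM big_ord1 p0.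
  by rewrite mul0r subr0.
have := eqX_coef h nN.
rewrite mulrBl mul1r coefB coefXM => /eqP; rewrite subr_eq => /eqP ->.
rewrite coefM big_ord_recr /= subnn H0 mulr0 addr0; congr (_ + _).
case: n nN => [|n] _ /=; first by rewrite mul0r.
by rewrite coef_deriv mulr_natl.
Qed.

Lemma log_monomial_coef d a n : (0 < d)%N -> (n <= N)%N -> (0 < n)%N ->
  (log_monomial d a)`_n = if (d %| n)%N then d%:R * a ^+ (n %/ d) else 0.
Proof.
move=> d0 nN n0; rewrite /log_monomial coef_sum.
under eq_bigr => k _ do rewrite coefZ coefXn.
case: ifP => [/dvdnP[q e]|dn].
  have q0 : (0 < q)%N by case: q e n0 => [|q] // ->.
  have qN : (q.-1 < N)%N by rewrite prednK // (leq_trans _ nN) // e leq_pmulr.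
  rewrite (bigD1 (Ordinal qN)) //= prednK // e mulnC eqxx mulr1 mulKn //.
  rewrite big1 ?addr0 // => k kq; rewrite eqn_pmul2l //.
  case: eqP => [ek|]; last by rewrite mulr0.
  by case/eqP: kq; apply: val_inj; rewrite /= ek.
rewrite big1 // => k _; case: eqP => [ek|]; last by rewrite mulr0.
by rewrite ek dvdn_mulr in dn.
Qed.

End LogDerivative.

(** * Lazard elimination in a coloured Lie algebra acting on a module *)

Section Elimination.
Variables (K : numFieldType) (L M : lmodType K) (G : nmodType).
Variables (br : L -> L -> L) (hom : G -> L -> Prop) (theta : G -> G -> K).
Hypothesis br_linl : forall y, linear (fun x => br x y).
Hypothesis br_linr : forall x, linear (br x).
Hypothesis hom_br : forall a b x y, hom a x -> hom b y -> hom (a + b) (br x y).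
Hypothesis thetaDl : forall a b c, theta (a + b) c = theta a c * theta b c.
Hypothesis theta_skew : forall a b, theta a b * theta b a = 1.
Hypothesis br_skew : forall a b x y, hom a x -> hom b y ->
  br x y = - theta a b *: br y x.
Hypothesis br_jacobi : forall a b x y z, hom a x -> hom b y ->
  br x (br y z) = br (br x y) z + theta a b *: br y (br x z).
Variable deg : G -> nat.
Hypothesis degD : forall a b, deg (a + b) = (deg a + deg b)%N.
Hypothesis deg0 : deg 0 = 0%N.

Lemma degMn a n : deg (a *+ n) = (n * deg a)%N.
Proof. by elim: n => [|n IH]; rewrite ?mulr0n // mulrS degD IH mulSn. Qed.

Lemma theta_sqr a : theta a a = 1 \/ theta a a = -1.
Proof.
by have /eqP := theta_skew a a; rewrite -expr2 sqrf_eq1 => /orP[] /eqP ->; [left|right].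
Qed.

Lemma brC a b x y : hom a x -> hom b y -> exists k, br y x = k *: br x y.
Proof. by move=> hx hy; exists (- theta b a); exact: br_skew. Qed.

Lemma br_even a x : hom a x -> theta a a = 1 -> br x x = 0.
Proof.
move=> hx e; have := br_skew hx hx; rewrite e scaleN1r => /eqP.
rewrite -subr_eq0 opprK -mulr2n -scaler_nat scaler_eq0 => /orP[|/eqP //].
by rewrite pnatr_eq0.
Qed.

(** For odd x, Jacobi reads [x,[x,x]] = [[x,x],x] - [x,[x,x]], and the first term on the right is
    -[x,[x,x]] by skewness; hence 3 [x,[x,x]] = 0. *)
Lemma br_cube a x : hom a x -> theta a a = -1 -> br x (br x x) = 0.
Proof.
move=> hx e; have := br_jacobi x hx hx.
rewrite (br_skew (hom_br hx hx) hx) thetaDl e mulrNN mulr1 scaleN1r => /eqP.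
rewrite -subr_eq0 opprD !opprK addrA -mulr2n -mulrSr -scaler_nat scaler_eq0.
by rewrite pnatr_eq0 => /orP[//|/eqP].
Qed.

(** By Jacobi, ad [x,x] = 2 (ad x)^2 for odd x. Thus bracketing a letter with the square of the
    eliminated letter gives a multiple of a letter of the new alphabet. *)
Lemma br_square a b x y : hom a x -> hom b y -> theta a a = -1 ->
  exists k, br y (br x x) = k *: br x (br x y).
Proof.
move=> hx hy e; have [k ->] := brC (hom_br hx hx) hy.
have := br_jacobi y hx hx; rewrite e scaleN1r => /eqP; rewrite -subr_eq opprK => /eqP <-.
by exists (k * 2); rewrite -scalerA scaler_nat.
Qed.

Section Family.
Variables (I : Type) (y : I -> L) (c : I -> G).

(** Right-normed brackets only; their spans are closed under the bracket by Jacobi, so no other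
    shape of monomial is required. *)
Inductive lie_mono : G -> L -> Prop :=
  | lie_mono1 i : lie_mono (c i) (y i)
  | lie_monoS i g x : lie_mono g x -> lie_mono (c i + g) (br (y i) x).

Hypothesis hom_y : forall i, hom (c i) (y i).

Lemma lie_mono_hom g x : lie_mono g x -> hom g x.
Proof. by elim=> [i|i g' x' _ IH] //; exact: hom_br. Qed.

Lemma lie_mono_br g h x u : lie_mono g x -> lie_mono h u ->
  lin_span (lie_mono (g + h)) (br x u).
Proof.
move=> mx; elim: mx h u => [i|i g' x' mx IH] h u mu.
  exact/span_in/lie_monoS.
have hx := lie_mono_hom mx; have hi := hom_y i.
have := br_jacobi u hi hx => /eqP; rewrite -subr_eq => /eqP <-.
apply: spanB; last apply: spanZ.
  apply: span_image (br_linr _) (IH _ _ mu) _ => v mv; rewrite -addrA.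
  exact/span_in/lie_monoS.
have -> : c i + g' + h = g' + (c i + h) by rewrite addrCA addrA.
by apply: IH; exact: lie_monoS.
Qed.

Lemma lie_span_br g h x u : lin_span (lie_mono g) x -> lin_span (lie_mono h) u ->
  lin_span (lie_mono (g + h)) (br x u).
Proof.
move=> sx su; apply: (span_image (X := fun x => br x u)) sx _ => [|v mv]; first exact: br_linl.
apply: span_image (br_linr _) su _ => w mw; exact: lie_mono_br.
Qed.

End Family.

Section Step.
Variables (N : nat) (I : finType) (y : I -> L) (c : I -> G) (i0 : I).
Hypothesis hom_y : forall i, hom (c i) (y i).
Hypothesis deg_c : forall i, (0 < deg (c i))%N.

(** The new alphabet consists of the (ad y_{i0})^j y_i with i != i0. Exponents above N are left out:
    letters have positive degree, so such an element has degree above N. *)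
Definition elim_idx : finType := ('I_N.+1 * {i : I | i != i0})%type.
Definition elim_elt (p : elim_idx) : L := iter p.1 (br (y i0)) (y (val p.2)).
Definition elim_content (p : elim_idx) : G := c i0 *+ p.1 + c (val p.2).
Local Notation mono' := (lie_mono elim_elt elim_content).

Lemma hom_iter j i : hom (c i0 *+ j + c i) (iter j (br (y i0)) (y i)).
Proof.
elim: j => [|j IH] /=; first by rewrite mulr0n add0r.
by rewrite mulrS -addrA; apply: hom_br.
Qed.

Lemma hom_elim p : hom (elim_content p) (elim_elt p).
Proof. exact: hom_iter. Qed.

Lemma deg_elim p : deg (elim_content p) = (p.1 * deg (c i0) + deg (c (val p.2)))%N.
Proof. by rewrite degD degMn. Qed.

Lemma elim_letter j i : i != i0 -> (deg (c i0 *+ j + c i) <= N)%N ->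
  mono' (c i0 *+ j + c i) (iter j (br (y i0)) (y i)).
Proof.
move=> Ni dN; have jN : (j < N.+1)%N.
  rewrite ltnS; apply: leq_trans dN; rewrite degD degMn.
  by apply: leq_trans (leq_addr _ _); rewrite leq_pmulr.
exact: (lie_mono1 elim_elt elim_content (Ordinal jN, exist _ i Ni)).
Qed.

(** ad y_{i0} is a coloured derivation that sends each new letter to the next one, hence it
    preserves the span of the new monomials below the cut-off. *)
Lemma ad_elim g z : mono' g z -> (deg (c i0 + g) <= N)%N ->
  lin_span (mono' (c i0 + g)) (br (y i0) z).
Proof.
have adl (p : elim_idx) : (deg (c i0 + elim_content p) <= N)%N ->
    mono' (c i0 + elim_content p) (br (y i0) (elim_elt p)).
  case: p => j [i Ni]; rewrite /elim_content /elim_elt /= addrA -mulrS => dN.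
  exact: (elim_letter (j := j.+1)).
elim=> [p|p h u mu IH] dN; first exact/span_in/adl.
rewrite (br_jacobi u (hom_y i0) (hom_elim p)).
apply: spanD; last apply: spanZ.
  rewrite addrA; apply: (lie_mono_br hom_elim) => //; apply: adl.
  by apply: leq_trans dN; rewrite !degD; lia.
rewrite addrCA; apply: span_image (br_linr _) (IH _) _ => [|v mv].
  by apply: leq_trans dN; rewrite !degD; lia.
exact/span_in/lie_monoS.
Qed.

Lemma elim_span g x : lie_mono y c g x -> (deg g <= N)%N ->
  lin_span (fun z => mono' g z \/ (z = y i0 /\ g = c i0) \/
    [/\ z = br (y i0) (y i0), g = c i0 + c i0 & theta (c i0) (c i0) = -1]) x.
Proof.
elim=> [i|i h u mu IH] dN.
  apply: span_in; case: (eqVneq i i0) => [->|Ni]; first by right; left.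
  by left; have := elim_letter (j := 0) Ni; rewrite /= mulr0n add0r; apply.
have dh : (deg h <= N)%N by apply: leq_trans dN; rewrite degD leq_addl.
apply: span_image (br_linr _) (IH dh) _ => z [mz|[[-> eh]|[-> eh odd]]].
- case: (eqVneq i i0) => [ei|Ni].
    by move: dN; rewrite ei => dN; apply: span_sub (ad_elim mz dN) => v; left.
  apply: span_in; left; have := elim_letter (j := 0) Ni.
  rewrite /= mulr0n add0r => h0.
  have /h0 m1 : (deg (c i) <= N)%N by apply: leq_trans dN; rewrite degD leq_addr.
  have h00 : (0 < N.+1)%N by [].
  have := lie_monoS (y := elim_elt) (Ordinal h00, exist _ i Ni) mz.
  by rewrite /elim_content /elim_elt /= mulr0n add0r.
- rewrite eh; case: (eqVneq i i0) => [->|Ni].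
    have [e1|e1] := theta_sqr (c i0).
      by rewrite (br_even (hom_y i0)) //; exact: span0.
    by apply: span_in; right; right.
  have [k ->] := brC (hom_y i0) (hom_y i).
  apply/spanZ/span_in; left.
  have := elim_letter (j := 1) Ni; rewrite /= mulr1n addrC; apply.
  by rewrite -eh [h + _]addrC.
- rewrite eh; case: (eqVneq i i0) => [->|Ni].
    by rewrite (br_cube (hom_y i0)) //; exact: span0.
  have [k ->] := br_square (hom_y i0) (hom_y i) odd.
  apply/spanZ/span_in; left.
  have := elim_letter (j := 2) Ni; rewrite /= mulr2n addrC; apply.
  by rewrite -eh [h + _]addrC.
Qed.

Lemma elim_mono_span g x : mono' g x -> lin_span (lie_mono y c g) x.
Proof.
have e p : lie_mono y c (elim_content p) (elim_elt p).
  case: p => j i; rewrite /elim_content /elim_elt /=.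
  elim: {j}(val j) => [|j IH] /=; first by rewrite mulr0n add0r; constructor.
  by rewrite mulrS -addrA; constructor.
elim=> [p|p h u mu IH]; first exact: span_in.
apply: span_image (br_linr _) IH _ => v mv; exact: lie_mono_br.
Qed.

End Step.

Variable rho : G -> L -> M -> M.
Hypothesis rho_linear : forall g x, linear (rho g x).
Hypothesis rho_br : forall a b x y u, hom a x ->
  rho (a + b) (br x y) u = rho a x (rho b y u) - theta a b *: rho b y (rho a x u).

Definition act_word I (y : I -> L) (c : I -> G) (s : seq I) (u : M) : M :=
  foldr (fun i v => rho (c i) (y i) v) u s.

Section Independence.
Variables (N : nat) (I : finType) (y : I -> L) (c : I -> G) (i0 : I).
Hypothesis hom_y : forall i, hom (c i) (y i).
Local Notation x0 := (y i0).
Local Notation X := (rho (c i0) (y i0)).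
Local Notation vec := (act_word y c).
Local Notation idx := (elim_idx N i0).
Local Notation vec' := (act_word (@elim_elt N I y i0) (@elim_content N I c i0)).

Definition others (s : seq I) := count (predC1 i0) s.

(* The number of pairs consisting of an occurrence of i0 and of a later letter
   other than i0: it drops when ad x0 moves some x0 to the right. *)
Fixpoint inversions (s : seq I) : nat :=
  if s is i :: s' then ((i == i0) * others s' + inversions s')%N else 0.

Lemma others_nseq j s : others (nseq j i0 ++ s) = others s.
Proof. by rewrite /others count_cat count_nseq /= eqxx. Qed.

Lemma inversions_nseq j s : inversions (nseq j i0 ++ s) = (j * others s + inversions s)%N.
Proof. by elim: j => [|j IH] //=; rewrite eqxx mul1n others_nseq IH; lia. Qed.

Section FixedVector.
Variable u : M.

(** The error terms of the triangular comparison: the number of letters other than i0 is kept, and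
    the number of inversions is smaller. *)
Definition lower_words n m (z : M) :=
  exists2 t, others t = n /\ (inversions t < m)%N & z = vec t u.

Lemma lower_words_le n m m' z : (m <= m')%N ->
  lin_span (lower_words n m) z -> lin_span (lower_words n m') z.
Proof.
move=> mm; apply: span_sub => v [t [tn tm] ->]; exists t => //; split=> //.
exact: leq_trans tm mm.
Qed.

Lemma lower_words_ad n m z : lin_span (lower_words n m) z ->
  lin_span (lower_words n (m + n)) (X z).
Proof.
move=> sz; apply: span_image (rho_linear _ _) sz _ => v [t [tn tm] ->].
apply: span_in; exists (i0 :: t) => //; split; first by rewrite /others /= eqxx.
by rewrite /= eqxx mul1n tn addnC ltn_add2r.
Qed.

(** Expanding (ad x0)^j y_i, the leading word is x0^j y_i; in every other word some x0 has passed to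
    the right of y_i, which removes inversions. *)
Lemma act_iter_ad j i t : i != i0 ->
  lin_span (lower_words (others t).+1 (j * (others t).+1 + inversions t))
    (rho (c i0 *+ j + c i) (iter j (br x0) (y i)) (vec t u)
     - vec (nseq j i0 ++ i :: t) u).
Proof.
move=> Ni; elim: j t => [|j IH] t.
  by rewrite mulr0n add0r /= subrr; exact: span0.
rewrite mulrS -addrA /= (rho_br _ _ _ (hom_y i0)).
set w := iter j _ _; set b := c i0 *+ j + c i.
rewrite addrAC -(linB (rho_linear _ _)); apply: spanB; last apply: spanZ.
  have := lower_words_ad (IH t); apply: lower_words_le; lia.
have O0 : others (i0 :: t) = others t by rewrite /others /= eqxx.
have := IH (i0 :: t); rewrite O0 /= eqxx mul1n.
rewrite -/w -/b => h; rewrite -[rho b w _](subrK (vec (nseq j i0 ++ i :: i0 :: t) u)).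
apply: spanD; first by apply: lower_words_le h; lia.
apply: span_in; exists (nseq j i0 ++ i :: i0 :: t) => //; split.
  by rewrite others_nseq /others /= Ni eqxx.
rewrite inversions_nseq /= (negPf Ni) eqxx /others /=. lia.
Qed.

Definition flat (s : seq idx) : seq I :=
  flatten [seq nseq p.1 i0 ++ [:: val p.2] | p : idx <- s].

Lemma act_elim s t :
  lin_span (lower_words (others (flat s ++ t)) (inversions (flat s ++ t)))
    (vec' s (vec t u) - vec (flat s ++ t) u).
Proof.
elim: s => [|[j i] s IH] /=; first by rewrite subrr; exact: span0.
set w := flat s ++ t in IH *.
have -> : flat ((j, i) :: s) ++ t = nseq j i0 ++ val i :: w.
  by rewrite /flat /= -!catA /= -/(flat s).
have Ni := valP i; set i' := val i in Ni *.
have Oi t0 : others (nseq j i0 ++ i' :: t0) = (others t0).+1.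
  by rewrite others_nseq /others /= Ni.
have Mi t0 : inversions (nseq j i0 ++ i' :: t0) = (j * (others t0).+1 + inversions t0)%N.
  by rewrite inversions_nseq /others /= Ni (negPf Ni).
rewrite Oi Mi.
have -> : vec' s (vec t u) = (vec' s (vec t u) - vec w u) + vec w u by rewrite subrK.
rewrite (linD (rho_linear _ _)) -addrA; apply: spanD; last exact: act_iter_ad.
apply: span_image (rho_linear _ _) IH _ => _ [t0 [tn tm] ->].
rewrite -[rho _ _ _](subrK (vec (nseq j i0 ++ i' :: t0) u)); apply: spanD.
  by rewrite -tn; apply: lower_words_le (act_iter_ad j t0 Ni); rewrite leq_add2l ltnW.
apply: span_in; exists (nseq j i0 ++ i' :: t0) => //.
by rewrite Oi Mi tn; split=> //; rewrite ltn_add2l.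
Qed.

End FixedVector.

Lemma nseq_cons_inj j1 j2 i1 i2 (w1 w2 : seq I) : i1 != i0 -> i2 != i0 ->
  nseq j1 i0 ++ i1 :: w1 = nseq j2 i0 ++ i2 :: w2 -> [/\ j1 = j2, i1 = i2 & w1 = w2].
Proof.
move=> N1 N2; elim: j1 j2 => [|j1 IH] [|j2] /=.
- by case=> -> ->.
- by case=> e _; rewrite e eqxx in N1.
- by case=> e _; rewrite -e eqxx in N2.
- by case=> /IH[-> -> ->].
Qed.

(** A word in the old letters is cut in a unique way into blocks i0^j i with i != i0, followed by a
    power of i0. *)
Lemma flat_inj s1 s2 k1 k2 : flat s1 ++ nseq k1 i0 = flat s2 ++ nseq k2 i0 ->
  s1 = s2 /\ k1 = k2.
Proof.
have nn k j i (w : seq I) : i != i0 -> nseq k i0 = nseq j i0 ++ i :: w -> False.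
  move=> Ni e; have : i \in nseq k i0 by rewrite e mem_cat mem_head orbT.
  by rewrite mem_nseq (negPf Ni) andbF.
have fc (j : 'I_N.+1) (i : {i | i != i0}) (s : seq idx) k :
    flat ((j, i) :: s) ++ nseq k i0 = nseq j i0 ++ val i :: (flat s ++ nseq k i0).
  by rewrite /flat /= -!catA.
elim: s1 s2 => [|[j1 i1] s1 IH] [|[j2 i2] s2].
- by move=> /(congr1 size); rewrite !size_nseq.
- by rewrite fc => e; case: (nn _ _ _ _ (valP i2) e).
- by rewrite fc => /esym e; case: (nn _ _ _ _ (valP i1) e).
by rewrite !fc => /(nseq_cons_inj (valP i1) (valP i2))[/val_inj -> /val_inj -> /IH[-> ->]].
Qed.

(** A free algebra is free as a module over the algebra of the new letters, with basis the powers of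
    y_{i0}. The vectors X^k vu therefore replace the vu as free generators; the comparison with old
    words is triangular in the number of inversions. *)
Lemma elim_indep (U : eqType) (vu : U -> M) :
  indep (fun p : seq I * U => vec p.1 (vu p.2)) ->
  indep (fun p : seq idx * (nat * U) => vec' p.1 (iter p.2.1 X (vu p.2.2))).
Proof.
move=> iv; pose phi (p : seq idx * (nat * U)) : seq I * U :=
  (flat p.1 ++ nseq p.2.1 i0, p.2.2).
apply: (@indep_triangular _ _ _ _ _ _ phi (fun p => inversions p.1) iv).
  by move=> [s1 [k1 u1]] [s2 [k2 u2]] [/flat_inj /= [-> ->] ->].
case=> s [k u] /=.
have -> : iter k X (vu u) = vec (nseq k i0) (vu u) by elim: k => //= k ->.
apply: span_sub (act_elim (vu u) s (nseq k i0)) => z [t [_ tm] ->].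
by exists (t, u).
Qed.

End Independence.

Definition weight_poly (A : comNzRingType) (w : G -> A) (I : finType) (c : I -> G) : {poly A} :=
  \sum_i w (c i) *: 'X^(deg (c i)).

Lemma sum_sub (A : nmodType) (I : finType) (i0 : I) (F : I -> A) :
  \sum_(i : {i | i != i0}) F (val i) = \sum_(i | i != i0) F i.
Proof. exact/esym/(big_sub (fun i => i != i0)). Qed.

Lemma sum_option (A : nmodType) (J : finType) (F : option J -> A) :
  \sum_o F o = F None + \sum_j F (Some j).
Proof.
rewrite (bigD1 None) //=; congr (_ + _); rewrite (reindex_omap Some id) /=.
  by apply: eq_bigl => j; rewrite eqxx.
by case.
Qed.

(** With t the weight of i0 and q the sum of the other weights, the new letters sum to (1 + t + ...
    + t^N) q, and (1 - t)(1 - q / (1 - t)) = 1 - t - q. *)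
Lemma weight_poly_elim (A : comNzRingType) (w : G -> A) N (I : finType) (c : I -> G) i0 :
  (forall a b, w (a + b) = w a * w b) -> (0 < deg (c i0))%N ->
  eqX N (1 - weight_poly w c)
    ((1 - w (c i0) *: 'X^(deg (c i0))) * (1 - weight_poly w (@elim_content N I c i0))).
Proof.
move=> wM d0; set t := w (c i0) *: _.
pose q := \sum_(i | i != i0) w (c i) *: 'X^(deg (c i)).
have ep : weight_poly w c = t + q by rewrite /weight_poly (bigD1 i0).
have ep' : weight_poly w (@elim_content N I c i0) = (\sum_(j < N.+1) t ^+ j) * q.
  rewrite mulr_suml /weight_poly.
  rewrite -(pair_bigA _ (fun (j : 'I_N.+1) (i : {i | i != i0}) =>
    w (elim_content c (j, i)) *: 'X^(deg (elim_content c (j, i))))) /=.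
  apply: eq_bigr => j _; rewrite mulr_sumr -sum_sub; apply: eq_bigr => i _.
  rewrite deg_elim /elim_content /=; elim: {j}(val j) => [|j IH].
    by rewrite mulr0n add0r mul0n add0n expr0 mul1r.
  rewrite mulrS -addrA wM exprS -mulrA -IH /t mulSn -addnA exprD.
  by rewrite -scalerAl -scalerAr scalerA.
have e : (1 - t) * \sum_(j < N.+1) t ^+ j = 1 - t ^+ N.+1.
  by rewrite -[RHS]opprB subrX1 -mulNr opprB.
have [r er] : exists r, t ^+ N.+1 = 'X^(N.+1) * r.
  exists ((w (c i0) *: 'X^((deg (c i0)).-1)) ^+ N.+1); rewrite -exprMn; congr (_ ^+ _).
  by rewrite -scalerAr -exprS prednK.
apply: eqX_sym; exists (r * q); rewrite mulrBr mulr1 ep' [(1 - t) * (_ * q)]mulrA e ep er; ring.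
Qed.

(** Independence is stated for the operators 1, z_j and z_j^2 applied to an arbitrary family of free
    generators. This is what the induction needs: after a letter is eliminated, the generators
    become its powers applied to the old ones. Weights take values in any commutative ring so that
    eigenvalues, signs and a second variable can be substituted later. *)
Record elim_basis N (I : finType) (y : I -> L) (c : I -> G)
    (J : finType) (z : J -> L) (b : J -> G) : Prop := {
  elim_basis_deg : forall j, (0 < deg (b j))%N;
  elim_basis_in : forall j, lin_span (lie_mono y c (b j)) (z j);
  elim_basis_span : forall g x, lie_mono y c g x -> (deg g <= N)%N ->
    lin_span (fun t => (exists2 j, b j = g & t = z j) \/
      (exists2 j, b j + b j = g /\ theta (b j) (b j) = -1 & t = br (z j) (z j))) x;
  elim_basis_indep : forall (U : eqType) (vu : U -> M),
    indep (fun p : seq I * U => act_word y c p.1 (vu p.2)) ->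
    indep (fun p : option (J * bool) * U =>
      if p.1 is Some (j, sq) then
        if sq then rho (b j) (z j) (rho (b j) (z j) (vu p.2)) else rho (b j) (z j) (vu p.2)
      else vu p.2);
  elim_basis_weight : forall (A : comNzRingType) (w : G -> A),
    (forall a b, w (a + b) = w a * w b) ->
    logderiv N (weight_poly w c) (\sum_j log_monomial N (deg (b j)) (w (b j)))
}.

Lemma elim_basis_base N (I : finType) (y : I -> L) (c : I -> G) :
  (forall i, (N < deg (c i))%N) ->
  @elim_basis N I y c void (fun v => match v with end) (fun v => match v with end).
Proof.
move=> hN; split => [[]|[]|g x mx gN|U vu iv|A w wM].
- have : (N < deg g)%N by elim: mx => [//|i h u _ IH]; rewrite degD ltn_addr.
  by rewrite ltnNge gN.
- pose phi (p : option (void * bool) * U) : seq I * U := ([::], p.2).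
  apply: (indep_sub (phi := phi) iv); last by case=> [[[[]]|] u].
  by move=> [[[[]]|] u1] [[[[]]|] u2] [->].
- have [r er] : exists r, weight_poly w c = 'X^(N.+1) * r.
    exists (\sum_i w (c i) *: 'X^(deg (c i) - N.+1)).
    rewrite mulr_sumr; apply: eq_bigr => i _.
    by rewrite -scalerAr -exprD subnKC.
  rewrite /logderiv big1 ?mulr0 => [|[]] ; apply: eqX_sym.
  exists (N.+1%:R * r + 'X * r^`()).
  rewrite er derivM derivXn -mulr_natl /= exprS; ring.
Qed.

Lemma elim_basis_step N (I : finType) (y : I -> L) (c : I -> G) i0
    (J : finType) (z : J -> L) (b : J -> G) :
  (forall i, hom (c i) (y i)) -> (forall i, (0 < deg (c i))%N) -> 
  @elim_basis N (elim_idx N i0) (@elim_elt N I y i0) (@elim_content N I c i0) J z b ->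
  @elim_basis N I y c (option J) (fun j => if j is Some j then z j else y i0)
     (fun j => if j is Some j then b j else c i0).
Proof.
move=> hom_y deg_c [bd bin bspan bind bw]; split.
- by case.
- case=> [j|]; last exact/span_in/lie_mono1.
  by apply: span_bind (bin j) _ => v; exact: elim_mono_span.
- move=> g x mx gN; apply: span_bind (elim_span (N := N) i0 hom_y deg_c mx gN) _ => v.
  case=> [mv|[[-> ->]|[-> -> odd]]].
  + apply: span_sub (bspan _ _ mv gN) => t [[j <- ->]|[j [<- odd] ->]].
      by left; exists (Some j).
    by right; exists (Some j).
  + by apply: span_in; left; exists None.
  + by apply: span_in; right; exists None.
- move=> U vu iv.
  have iv' := bind _ (fun q : nat * U => iter q.1 (rho (c i0) (y i0)) (vu q.2))
    (elim_indep (N := N) (i0 := i0) hom_y (vu := vu) iv).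
  (* The eliminated letter and its square appear as the powers 1 and 2 of its operator on the
     generators; later basis elements act on the power 0. *)
  pose phi (p : option (option J * bool) * U) : option (J * bool) * (nat * U) :=
    match p.1 with
    | None => (None, (0%N, p.2))
    | Some (None, sq) => (None, ((sq.+1)%N, p.2))
    | Some (Some j, sq) => (Some (j, sq), (0%N, p.2))
    end.
  apply: (indep_sub (phi := phi) iv').
    by move=> [[[[j1|] [|]]|] u1] [[[[j2|] [|]]|] u2] // => -[]; try move=> ->; try move=> ->.
  by move=> [[[[j1|] [|]]|] u1].
- move=> A w wM; rewrite sum_option /=.
  apply: logderiv_mul (weight_poly_elim N (c := c) (i0 := i0) wM (deg_c i0)) _ (bw _ _ wM).
  exact: logderiv_monomial.
Qed.

(** Double induction. Eliminating a letter of least degree d leaves as letters of degree d only the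
    other old ones, with exponent 0, so their number drops; when none is left, the least degree
    rises. Above N there is nothing to do. *)
Theorem elim_basis_exists N d (I : finType) (y : I -> L) (c : I -> G) :
  (0 < d)%N -> (forall i, hom (c i) (y i)) -> (forall i, (d <= deg (c i))%N) ->
  exists (J : finType) (z : J -> L) (b : J -> G), @elim_basis N I y c J z b.
Proof.
move=> d0; have [e] := ubnP (N.+1 - d); elim: e d d0 I y c => // e IHe d d0 I y c eN.
case: (leqP d N) => [dN|Nd] hom_y dmin; last first.
  by do 3!eexists; apply: elim_basis_base => i; exact: leq_trans Nd (dmin i).
have [k] := ubnP #|[pred i | deg (c i) == d]|.
elim: k I y c hom_y dmin => // k IHk I y c hom_y dmin; rewrite ltnS => kI.
case: (pickP [pred i | deg (c i) == d]) => [i0 /= /eqP di0|none]; last first.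
  apply: (IHe d.+1) => //; first by lia.
  by move=> i; rewrite ltn_neqAle dmin eq_sym andbT; have /= -> := none i.
have c0 i : (0 < deg (c i))%N by exact: leq_trans d0 (dmin i).
have j0 j i : (j * deg (c i0) + deg (c i))%N = d -> j = 0%N.
  move=> ej; have /eqP : (j * deg (c i0))%N = 0%N by have := dmin i; lia.
  by rewrite muln_eq0 => /orP[/eqP //|/eqP e0]; have := c0 i0; rewrite e0.
have [||| J [z [b h]]] := IHk (elim_idx N i0) (@elim_elt N I y i0) (@elim_content N I c i0).
- exact: hom_elim.
- by move=> p; rewrite deg_elim; apply: leq_trans (dmin (val p.2)) (leq_addl _ _).
- apply: leq_trans kI; rewrite [X in (_ < X)%N](cardD1 i0) inE di0 eqxx ltnS.
  have inj : {in [pred p | deg (elim_content c p) == d] &, injective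
      (fun p : elim_idx N i0 => val p.2)}.
    move=> [[j1 h1] i1] [[j2 h2] i2]; rewrite !inE !deg_elim /= => /eqP e1 /eqP e2 ei.
    by congr (_, _); apply: val_inj => //=; rewrite (j0 _ _ e1) (j0 _ _ e2).
  rewrite -(card_in_image inj); apply: subset_leq_card; apply/fintype.subsetP => i /fintype.imageP[[[j h] i1]].
  rewrite !inE deg_elim /= => /eqP e1 ->; rewrite (valP i1) /=.
  by have := j0 _ _ e1; lia.
by do 3!eexists; exact: elim_basis_step hom_y c0 h.
Qed.

End Elimination.

(** * The action on the tensor algebra *)

Section FreegLift.
Variables (K : nzRingType) (T : choiceType) (M : lmodType K).

Lemma fgliftE (g : T -> M) (D : {freeg T / K}) :
  fglift g D = \sum_(x <- dom D) coeff x D *: g x.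
Proof.
pose L (D : {freeg T / K}) := fglift g D.
rewrite -[D in LHS]freeg_sumE.
have LD D1 D2 : L (D1 + D2) = L D1 + L D2.
  have e := lift_is_additive g; rewrite /L.
  have e0 : fglift g 0 = 0 by have := e 0 0; rewrite !subrr.
  have eN x : fglift g (- x) = - fglift g x by rewrite -sub0r e e0 sub0r.
  by rewrite -[D2 in LHS]opprK e eN opprK.
have L0 : L 0 = 0 by apply: (addrI (L 0)); rewrite -LD !addr0.
rewrite -[LHS]/(L _) (big_morph L LD L0); apply: eq_bigr => x _.
by rewrite /L liftU.
Qed.

Lemma fglift_linear (g : T -> M) : linear (fglift g : {freeg T / K} -> M).
Proof.
move=> k D1 D2.
have e := lift_is_additive g.
have e0 : fglift g 0 = 0 by have := e 0 0; rewrite !subrr.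
have eN x : fglift g (- x) = - fglift g x by rewrite -sub0r e e0 sub0r.
have LD x y : fglift g (x + y) = fglift g x + fglift g y.
  by rewrite -[y in LHS]opprK e eN opprK.
rewrite LD; congr (_ + _).
rewrite [fglift g D1]fgliftE -[k *: D1]/(fgscale k D1) /fgscale.
rewrite (big_morph (fglift g) LD e0) scaler_sumr; apply: eq_bigr => x _.
by rewrite liftU scalerA.
Qed.

Lemma freeg_scaleU (k : K) (x : T) : << k *g x >> = k *: << x >>.
Proof.
by apply/eqP/freeg_eqP => y; rewrite coeffZ !coeffU mul1r.
Qed.

Lemma freeg_lin_ext (X Y : {freeg T / K} -> M) : linear X -> linear Y ->
  (forall x, X << x >> = Y << x >>) -> X = Y.
Proof.
move=> lX lY e; apply/funext => D.
rewrite -[D]freeg_sumE !(lin_sum lX, lin_sum lY); apply: eq_bigr => x _.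
by rewrite freeg_scaleU (linZ lX) (linZ lY) e.
Qed.

Lemma fgliftU (g : T -> M) x : fglift g << x >> = g x.
Proof. by rewrite liftU scale1r. Qed.

End FreegLift.

(** The index i = n + 1. With this shift f_{i,l} has weight n for the [sl2] spanned by e_{-1},
    h_{-1}, f_{-1} and generates a module of dimension n + 1. *)
Definition idx_pos (n : nat) : monster_idx := exist _ (n.+1%:Z) isT.

Lemma idx_cases (i : monster_idx) : i = idx_m1 \/ exists n, i = idx_pos n.
Proof.
case: i => [[[|n]|[|n]] h].
- by exfalso; move: h.
- by right; exists n; apply: val_inj.
- by left; apply: val_inj.
- by exfalso; move: h.
Qed.

Section WordModule.
Variables (R : realType) (f : int -> int).
Variable C : monster_idx -> monster_idx -> R[i].
Hypothesis fm1 : f (-1) = 1.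
Hypothesis hC : is_coloring f C.
Local Notation I := monster_idx.
Local Notation Q := {freeg monster_idx}.
Local Notation K := R[i].
Local Notation cf := (coloring_form C).
Local Notation alpha := (<< idx_m1 >> : Q).
Local Notation beta n := (<< idx_pos n >> : Q).

Lemma coloringCC i j : C i j * C j i = 1. Proof. by case: hC. Qed.
Let CC := coloringCC.

Lemma coloring_m1 : C idx_m1 idx_m1 = 1.
Proof. by case: hC => _ h _; apply: h; rewrite /= fm1. Qed.

Lemma cf_alpha : cf alpha alpha = 1.
Proof. by rewrite coloring_formU coloring_m1. Qed.

(* The letter (l, j, j') is the monomial X^j' Y^j of the sl2-module of dimension
   i = j + j' + 1 generated by the l-th generator f_{i,l}; it spans the weight
   space of (ad f_{-1})^j f_{i,l}. *)
Definition letter : choiceType := (nat * nat * nat)%type.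
Local Notation M := {freeg (seq letter) / K}.

Implicit Types (X Y Z : M -> M) (u v : M) (a b : Q).

Definition letter_degree (x : letter) : Q :=
  - (beta (x.1.2 + x.2) + alpha *+ x.1.2).

Definition word_degree (w : seq letter) : Q := \sum_(x <- w) letter_degree x.

Definition mul_letter (x : letter) : M -> M := fglift (fun w => << x :: w >> : M).

Lemma mul_letter_linear x : linear (mul_letter x).
Proof. exact: fglift_linear. Qed.

Definition diag_op (chi : Q -> K) : M -> M :=
  fglift (fun w => chi (word_degree w) *: (<< w >> : M)).

Lemma diag_op_linear chi : linear (diag_op chi).
Proof. exact: fglift_linear. Qed.

(** The coloured derivation of degree a that kills the empty word and has commutator [phi x] with
    left multiplication by x. Here [phi x] may be any operator: for e_{i,l} it is a multiple of h_i
    or of f_{-1}. *)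
Fixpoint deriv_word (phi : letter -> M -> M) (a : Q) (w : seq letter) : M :=
  match w with
  | [::] => 0
  | x :: w' => phi x << w' >>
      + cf a (letter_degree x) *: mul_letter x (deriv_word phi a w')
  end.

Definition deriv_op phi a : M -> M := fglift (deriv_word phi a).

Lemma deriv_op_linear phi a : linear (deriv_op phi a).
Proof. exact: fglift_linear. Qed.

Lemma deriv_op_nil phi a : deriv_op phi a << [::] >> = 0.
Proof. by rewrite /deriv_op fgliftU. Qed.

Lemma deriv_op_comm phi a x : linear (phi x) ->
  colored_comm C a (letter_degree x) (deriv_op phi a) (mul_letter x) = phi x.
Proof.
move=> lphi; apply: freeg_lin_ext => //.
  by apply: colored_comm_linear; [exact: deriv_op_linear | exact: mul_letter_linear].
by move=> w; rewrite /colored_comm /mul_letter /deriv_op !fgliftU /= addrK.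
Qed.

Definition addf (chi : Q -> K) := forall a b, chi (a + b) = chi a + chi b.

Lemma addf0 chi : addf chi -> chi 0 = 0.
Proof. by move=> h; apply: (addrI (chi 0)); rewrite -h !addr0. Qed.

(** Homogeneity of degree a, tested by commutators with the diagonal operators of all additive
    characters. The operators of h_i and d_i are of this diagonal kind. *)
Definition weighted (a : Q) (X : M -> M) := forall chi, addf chi -> forall u,
  diag_op chi (X u) = X (diag_op chi u) + chi a *: X u.

Lemma diag_opU chi w : diag_op chi << w >> = chi (word_degree w) *: << w >>.
Proof. exact: fgliftU. Qed.

Lemma mul_letterU x w : mul_letter x << w >> = << x :: w >>.
Proof. exact: fgliftU. Qed.

Lemma word_degree_cons x w : word_degree (x :: w) = letter_degree x + word_degree w.
Proof. by rewrite /word_degree big_cons. Qed.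

Lemma weightedP a X : linear X ->
  (forall chi, addf chi -> forall w,
    diag_op chi (X << w >>) = (chi (word_degree w) + chi a) *: X << w >>) ->
  weighted a X.
Proof.
move=> lX h chi ac u.
have ld := diag_op_linear chi.
suff e : (fun u => diag_op chi (X u)) = (fun u => X (diag_op chi u) + chi a *: X u).
  exact: (congr1 (fun g => g u) e).
apply: freeg_lin_ext => [k v v'|k v v'|w].
- by rewrite lX ld.
- by rewrite ld !lX !scalerDr !scalerA [_ * k]mulrC addrACA.
- by rewrite h // diag_opU (linZ lX) scalerDl.
Qed.

Lemma weightedU a X chi w : weighted a X -> addf chi ->
  linear X ->
  diag_op chi (X << w >>) = (chi (word_degree w) + chi a) *: X << w >>.
Proof. by move=> wX ac lX; rewrite wX // diag_opU (linZ lX) scalerDl. Qed.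

Lemma weighted_mul_letter x : weighted (letter_degree x) (mul_letter x).
Proof.
apply: weightedP => [|chi ac w]; first exact: mul_letter_linear.
by rewrite mul_letterU diag_opU word_degree_cons ac addrC.
Qed.

Lemma weighted_diag chi : weighted 0 (diag_op chi).
Proof.
apply: weightedP => [|chi' ac w]; first exact: diag_op_linear.
by rewrite diag_opU (linZ (diag_op_linear _)) diag_opU (addf0 ac) addr0 !scalerA mulrC.
Qed.

Lemma weightedZ a X k : weighted a X -> weighted a (fun u => k *: X u).
Proof.
move=> wX chi ac u; rewrite (linZ (diag_op_linear _)) wX // scalerDr !scalerA.
by rewrite mulrC.
Qed.

Lemma weighted0 a : weighted a (fun=> 0).
Proof. by move=> chi ac u; rewrite (lin0 (diag_op_linear _)) scaler0 addr0. Qed.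

Lemma weighted_sum a J (r : seq J) (X : J -> M -> M) : (forall j, weighted a (X j)) ->
  weighted a (fun u => \sum_(j <- r) X j u).
Proof.
move=> wX chi ac u; rewrite (lin_sum (diag_op_linear _)) scaler_sumr -big_split /=.
by apply: eq_bigr => j _; exact: wX.
Qed.

Lemma weighted_deriv phi a : (forall x, linear (phi x)) ->
  (forall x, weighted (a + letter_degree x) (phi x)) -> weighted a (deriv_op phi a).
Proof.
move=> lphi wphi; have lD := deriv_op_linear phi a.
apply: weightedP => // chi ac w; rewrite /deriv_op fgliftU.
have ld := diag_op_linear chi.
elim: w => [|x w IH] /=; first by rewrite (lin0 ld) scaler0.
rewrite (linD ld) (linZ ld) (weighted_mul_letter _ ac) IH.
rewrite (weightedU _ (wphi x) ac (lphi x)) word_degree_cons (linZ (mul_letter_linear x)).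
rewrite -scalerDl scalerA [cf _ _ * _]mulrC -scalerA !ac scalerDr; congr (_ *: _ + _ *: _); ring.
Qed.

Lemma colored_comm_diag chi a X : addf chi -> weighted a X ->
  colored_comm C 0 a (diag_op chi) X = fun u => chi a *: X u.
Proof.
move=> ac wX; apply/funext => u.
by rewrite /colored_comm coloring_form0l scale1r wX // addrAC subrr add0r.
Qed.

Lemma colored_comm_diagr chi a X u : addf chi -> weighted a X ->
  colored_comm C a 0 X (diag_op chi) u = - chi a *: X u.
Proof.
move=> ac wX.
rewrite /colored_comm coloring_form0r scale1r wX // opprD addrA subrr add0r.
by rewrite scaleNr.
Qed.

Lemma weighted_comm a b X Y : linear X -> linear Y -> weighted a X -> weighted b Y ->
  weighted (a + b) (colored_comm C a b X Y).
Proof.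
move=> lX lY wX wY; apply: weightedP; first exact: colored_comm_linear.
move=> chi ac w; rewrite /colored_comm (linB (diag_op_linear _)) (linZ (diag_op_linear _)).
rewrite wX // wY // diag_opU (linZ lY) (linD lX) !(linZ lX).
rewrite wY // wX // diag_opU (linZ lX) (linD lY) !(linZ lY) ac.
rewrite -!scalerDl scalerBr !scalerA; congr (_ - _ *: _).
  by congr (_ *: _); ring.
by ring.
Qed.

(** Words arise from the empty word by left multiplications. This is the tool for verifying
    relations: the difference of two operators is shown to kill the empty word and to commute with
    letters up to scalars. *)
Lemma mul_letterP Z : linear Z -> Z << [::] >> = 0 ->
  (forall x, exists s : K, forall u, Z (mul_letter x u) = s *: mul_letter x (Z u)) ->
  forall u, Z u = 0.
Proof.
move=> lZ Z1 h u; suff -> : Z = fun=> 0 by [].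
apply: freeg_lin_ext => //; first by move=> k v v'; rewrite scaler0 addr0.
elim=> [|x w IH] //; have [s e] := h x.
by rewrite -mul_letterU e IH (lin0 (mul_letter_linear x)) scaler0.
Qed.

Lemma colored_jacobi_rev a b d X Y Z u : linear X -> linear Y -> linear Z ->
  colored_comm C (a + b) d (colored_comm C a b X Y) Z u =
  colored_comm C a (b + d) X (colored_comm C b d Y Z) u
  - cf a b *: colored_comm C b (a + d) Y (colored_comm C a d X Z) u.
Proof. by move=> lX lY lZ; rewrite (colored_comm_jacobi CC) // addrK. Qed.

Lemma colored_commZr a b X k Y : linear X ->
  colored_comm C a b X (fun u => k *: Y u) = fun u => k *: colored_comm C a b X Y u.
Proof.
move=> lX; apply/funext => u; rewrite /colored_comm (linZ lX) scalerBr !scalerA.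
by rewrite mulrC.
Qed.

Lemma linear_scale k X : linear X -> linear (fun u : M => k *: X u : M).
Proof. by move=> lX c u v; rewrite lX scalerDr !scalerA mulrC. Qed.

Lemma linear_zero : linear (fun _ : M => 0 : M).
Proof. by move=> c u v; rewrite scaler0 addr0. Qed.

Lemma addfN chi a : addf chi -> chi (- a) = - chi a.
Proof. by move=> ac; apply/eqP; rewrite -addr_eq0 -ac addNr addf0. Qed.

Lemma addfMn chi a n : addf chi -> chi (a *+ n) = chi a *+ n.
Proof.
by move=> ac; elim: n => [|n IH]; rewrite ?mulr0n ?addf0 // !mulrS ac IH.
Qed.

Definition h_weight (i : I) (a : Q) : K :=
  (fglift (fun j => (monster_matrix i j : int^o)) a)%:~R.
Definition d_weight (i : I) (a : Q) : K := (coeff i a)%:~R.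

Lemma addf_h i : addf (h_weight i).
Proof.
move=> a b; rewrite /h_weight -rmorphD /=; congr (_%:~R).
by rewrite -[a in LHS]scale1r fglift_linear scale1r.
Qed.

Lemma addf_d i : addf (d_weight i).
Proof. by move=> a b; rewrite /d_weight coeffD rmorphD. Qed.

Lemma h_weightU i j : h_weight i << j >> = (monster_matrix i j)%:~R.
Proof. by rewrite /h_weight fgliftU. Qed.

Lemma d_weightU i j : d_weight i << j >> = (i == j)%:R.
Proof. by rewrite /d_weight coeffU mul1r eq_sym; case: eqP. Qed.

Lemma hm1_alpha : h_weight idx_m1 alpha = 2.
Proof. by rewrite h_weightU. Qed.
Lemma hm1_beta n : h_weight idx_m1 (beta n) = - n%:R.
Proof.
by rewrite h_weightU /monster_matrix /= -addn1 PoszD addrC addrK rmorphN.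
Qed.
Lemma hpos_alpha n : h_weight (idx_pos n) alpha = - n%:R.
Proof.
by rewrite h_weightU /monster_matrix /= -addn1 PoszD addrK rmorphN.
Qed.

Definition lower_letter (x : letter) : letter := (x.1.1, x.1.2.+1, x.2.-1).
Definition raise_letter (x : letter) : letter := (x.1.1, x.1.2.-1, x.2.+1).

(** f_{-1} acts as Y d/dX and e_{-1} as X d/dY on the monomials X^j' Y^j. When an exponent is 0, the
    truncated predecessor in the target letter is harmless because the coefficient vanishes. *)
Definition phiF (x : letter) : M -> M := fun u => x.2%:R *: mul_letter (lower_letter x) u.
Definition phiE (x : letter) : M -> M := fun u => x.1.2%:R *: mul_letter (raise_letter x) u.
Definition opF : M -> M := deriv_op phiF (- alpha).
Definition opE : M -> M := deriv_op phiE alpha.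
Definition opH (i : I) : M -> M := diag_op (h_weight i).
Definition opD (i : I) : M -> M := diag_op (d_weight i).

Lemma lower_letter_degree x : (0 < x.2)%N ->
  letter_degree (lower_letter x) = - alpha + letter_degree x.
Proof.
case: x => [[l j] [|j']] //= _; rewrite /letter_degree /= addSnnS.
by rewrite mulrS !opprD [LHS]addrCA.
Qed.

Lemma raise_letter_degree x : (0 < x.1.2)%N ->
  letter_degree (raise_letter x) = alpha + letter_degree x.
Proof.
case: x => [[l [|j]] j'] //= _; rewrite /letter_degree /= addSnnS.
by rewrite mulrS !opprD [RHS]addrCA (addrA alpha) subrr add0r.
Qed.

Lemma linear_phiF x : linear (phiF x).
Proof. exact/linear_scale/mul_letter_linear. Qed.
Lemma linear_phiE x : linear (phiE x).
Proof. exact/linear_scale/mul_letter_linear. Qed.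
Lemma linear_opF : linear opF. Proof. exact: deriv_op_linear. Qed.
Lemma linear_opE : linear opE. Proof. exact: deriv_op_linear. Qed.
Lemma linear_opH i : linear (opH i). Proof. exact: diag_op_linear. Qed.
Lemma linear_opD i : linear (opD i). Proof. exact: diag_op_linear. Qed.
Hint Resolve linear_phiF linear_phiE linear_opF linear_opE linear_opH linear_opD
  mul_letter_linear linear_zero : core.

Lemma weighted_phiF x : weighted (- alpha + letter_degree x) (phiF x).
Proof.
case: (posnP x.2) => [x0|x0].
  by move=> chi ac u; rewrite /phiF x0 !scale0r (lin0 (diag_op_linear _)) scaler0 addr0.
by rewrite -lower_letter_degree //; apply: weightedZ; exact: weighted_mul_letter.
Qed.

Lemma weighted_phiE x : weighted (alpha + letter_degree x) (phiE x).
Proof.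
case: (posnP x.1.2) => [x0|x0].
  by move=> chi ac u; rewrite /phiE x0 !scale0r (lin0 (diag_op_linear _)) scaler0 addr0.
by rewrite -raise_letter_degree //; apply: weightedZ; exact: weighted_mul_letter.
Qed.

Lemma weighted_opF : weighted (- alpha) opF.
Proof. by apply: weighted_deriv => // x; exact: weighted_phiF. Qed.
Lemma weighted_opE : weighted alpha opE.
Proof. by apply: weighted_deriv => // x; exact: weighted_phiE. Qed.

Lemma opF_comm x : colored_comm C (- alpha) (letter_degree x) opF (mul_letter x) = phiF x.
Proof. exact: deriv_op_comm. Qed.
Lemma opE_comm x : colored_comm C alpha (letter_degree x) opE (mul_letter x) = phiE x.
Proof. exact: deriv_op_comm. Qed.

Lemma colored_comm0 a b X Y u : colored_comm C a b X Y u = 0 ->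
  X (Y u) = cf a b *: Y (X u).
Proof. by move/eqP; rewrite subr_eq0 => /eqP. Qed.

Lemma h_weight_letter i (x : letter) : h_weight i (letter_degree x) =
  - (h_weight i (beta (x.1.2 + x.2)) + h_weight i alpha *+ x.1.2).
Proof. by rewrite (addfN _ (addf_h i)) addf_h addfMn //; exact: addf_h. Qed.

Lemma linear_sub X Y : linear X -> linear Y -> linear (fun u : M => X u - Y u : M).
Proof. by move=> lX lY k u v; rewrite lX lY opprD [k *: (_ - _)]scalerBr addrACA. Qed.

Lemma lower_letterK x : (0 < x.2)%N -> raise_letter (lower_letter x) = x.
Proof. by case: x => [[l j] [|j']]. Qed.
Lemma raise_letterK x : (0 < x.1.2)%N -> lower_letter (raise_letter x) = x.
Proof. by case: x => [[l [|j]] j']. Qed.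

Lemma opE_phiF x u :
  colored_comm C alpha (- alpha + letter_degree x) opE (phiF x) u =
  (x.2 * x.1.2.+1)%:R *: mul_letter x u.
Proof.
rewrite (colored_commZr _ _ _ _ linear_opE) natrM -scalerA.
case: (posnP x.2) => [->|x0]; first by rewrite !scale0r.
by rewrite -lower_letter_degree // opE_comm /phiE lower_letterK.
Qed.

Lemma opF_phiE x u :
  colored_comm C (- alpha) (alpha + letter_degree x) opF (phiE x) u =
  (x.1.2 * x.2.+1)%:R *: mul_letter x u.
Proof.
rewrite (colored_commZr _ _ _ _ linear_opF) natrM -scalerA.
case: (posnP x.1.2) => [->|x0]; first by rewrite !scale0r.
by rewrite -raise_letter_degree // opF_comm /phiF raise_letterK.
Qed.

Lemma cf_alphaN : cf alpha (- alpha) = 1.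
Proof. by rewrite (coloring_formNr CC) cf_alpha. Qed.

(** On a letter, [e_{-1}, f_{-1}] acts by j' (j + 1) - j (j' + 1) = j' - j, which is the weight of
    h_{-1}; both sides are derivations killing the empty word. *)
Lemma opEF_comm : colored_comm C alpha (- alpha) opE opF = opH idx_m1.
Proof.
pose Z := fun u => colored_comm C alpha (- alpha) opE opF u - opH idx_m1 u.
have lc : linear (colored_comm C alpha (- alpha) opE opF) by exact: colored_comm_linear.
suff Z0 : forall u, Z u = 0 by apply/funext => u; apply/eqP; rewrite -subr_eq0; exact/eqP/Z0.
apply: mul_letterP => [||x].
- exact: linear_sub.
- rewrite /Z /colored_comm /opE /opF !deriv_op_nil !(lin0 (deriv_op_linear _ _)) scaler0 subr0.
  by rewrite /opH diag_opU /word_degree big_nil addf0 ?scale0r ?subr0 //; exact: addf_h.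
exists 1 => u; rewrite scale1r.
have := colored_jacobi_rev alpha (- alpha) (letter_degree x) u linear_opE linear_opF (mul_letter_linear x).
rewrite opF_comm opE_comm opE_phiF opF_phiE cf_alphaN scale1r -scalerBl.
rewrite addrN {1}/colored_comm coloring_form0l scale1r => /eqP; rewrite subr_eq => /eqP e.
rewrite /Z e (linB (mul_letter_linear x) (colored_comm C alpha (- alpha) opE opF u)) /opH (weighted_mul_letter x (addf_h idx_m1)).
rewrite h_weight_letter hm1_alpha hm1_beta.
rewrite opprD [- _ - _]addrC addrACA -scalerBl [X in X *: _](_ : _ = 0) ?scale0r ?add0r //.
ring.
Qed.

Variables ca cb : nat -> nat -> nat -> K.

(* e_{n,k} maps f_{n,l} to a multiple of h_n, hence [f_{-1}, f_{n,l}] to a multiple of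
   [f_{-1}, h_n], and kills the other letters. *)
Definition phiEn n k (x : letter) : M -> M :=
  if (x.1.2 + x.2 == n)%N then
    match x.1.2 with
    | 0 => fun u => cb n x.1.1 k *: opH (idx_pos n) u
    | 1 => fun u => - (cb n x.1.1 k * cf (beta n) (- alpha)) *: opF u
    | _ => fun _ => 0
    end
  else fun _ => 0.
Definition opEn n k : M -> M := deriv_op (phiEn n k) (beta n).
(** The letters stand for a basis of the span of the f_{n,k} adapted to a group element, so a
    generator acts through a combination of letters with matrix [ca]; [cb] is the inverse matrix. *)
Definition opFn n k : M -> M :=
  fun u => \sum_(l < monster_charge f (idx_pos n)) ca n k l *: mul_letter (l : nat, 0, n) u.

Lemma linear_phiEn n k x : linear (phiEn n k x).
Proof.
by rewrite /phiEn; case: eqP => // _; case: x.1.2 => [|[|j]] //; exact: linear_scale.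
Qed.

Lemma linear_opEn n k : linear (opEn n k). Proof. exact: deriv_op_linear. Qed.

Lemma linear_opFn n k : linear (opFn n k).
Proof.
move=> c u v; rewrite /opFn scaler_sumr -big_split /=; apply: eq_bigr => l _.
by rewrite mul_letter_linear scalerDr !scalerA mulrC.
Qed.
Hint Resolve linear_phiEn linear_opEn linear_opFn : core.

Lemma opEn_comm n k x :
  colored_comm C (beta n) (letter_degree x) (opEn n k) (mul_letter x) = phiEn n k x.
Proof. exact: deriv_op_comm. Qed.

Lemma letter_degree0 l n : letter_degree (l, 0, n) = - beta n.
Proof. by rewrite /letter_degree /= add0n mulr0n addr0. Qed.

Lemma weighted_phiEn n k x : weighted (beta n + letter_degree x) (phiEn n k x).
Proof.
rewrite /phiEn /letter_degree; case: eqP => [->|_]; last exact: weighted0.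
case: x.1.2 => [|[|j]].
- by rewrite mulr0n addr0 subrr; apply/weightedZ/weighted_diag.
- by rewrite mulr1n opprD addrA subrr add0r; apply/weightedZ/weighted_opF.
- exact: weighted0.
Qed.

Lemma weighted_opEn n k : weighted (beta n) (opEn n k).
Proof. by apply: weighted_deriv => // x; exact: weighted_phiEn. Qed.

Lemma weighted_opFn n k : weighted (- beta n) (opFn n k).
Proof.
apply: weighted_sum => l; apply: weightedZ; rewrite -(letter_degree0 l).
exact: weighted_mul_letter.
Qed.

Lemma colored_comm_opFn a b X n k u : linear X ->
  colored_comm C a b X (opFn n k) u = \sum_(l < monster_charge f (idx_pos n))
    ca n k l *: colored_comm C a b X (mul_letter (l : nat, 0, n)) u.
Proof.
move=> lX; rewrite /colored_comm /opFn (lin_sum lX) scaler_sumr -sumrB.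
by apply: eq_bigr => l _; rewrite (linZ lX) scalerBr !scalerA [_ * cf _ _]mulrC.
Qed.

Hypothesis ab : forall n k k', (k < monster_charge f (idx_pos n))%N ->
  (k' < monster_charge f (idx_pos n))%N ->
  \sum_(l < monster_charge f (idx_pos n)) ca n k l * cb n l k' = (k == k')%:R.

Lemma opEn_opFn n k k' : (k < monster_charge f (idx_pos n))%N ->
  (k' < monster_charge f (idx_pos n))%N ->
  colored_comm C (beta n) (- beta n) (opEn n k) (opFn n k') =
  fun u => (k == k')%:R *: opH (idx_pos n) u.
Proof.
move=> hk hk'; apply/funext => u; rewrite colored_comm_opFn // eq_sym -(ab hk' hk) scaler_suml.
apply: eq_bigr => l _; rewrite -(letter_degree0 l) opEn_comm /phiEn /= add0n eqxx.
by rewrite scalerA.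
Qed.

Lemma opEn_opFn_neq n p k k' : n != p ->
  colored_comm C (beta n) (- beta p) (opEn n k) (opFn p k') = fun u => 0.
Proof.
move=> np; apply/funext => u; rewrite colored_comm_opFn // big1 // => l _.
by rewrite -(letter_degree0 l) opEn_comm /phiEn /= add0n eq_sym (negPf np) scaler0.
Qed.

Lemma opE_opFn n k : colored_comm C alpha (- beta n) opE (opFn n k) = fun u => 0.
Proof.
apply/funext => u; rewrite colored_comm_opFn // big1 // => l _.
by rewrite -(letter_degree0 l) opE_comm /phiE /= scale0r scaler0.
Qed.

Lemma opF_comm_opH n u :
  colored_comm C (- alpha) 0 opF (opH (idx_pos n)) u = - n%:R *: opF u.
Proof.
rewrite colored_comm_diagr; [|exact: addf_h|exact: weighted_opF].
by rewrite (addfN _ (addf_h _)) hpos_alpha opprK.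
Qed.

Lemma colored_comm_zeror a b X u : linear X -> colored_comm C a b X (fun=> 0) u = 0.
Proof. by move=> lX; rewrite /colored_comm (lin0 lX) scaler0 subr0. Qed.

Lemma opF_comm_self u : colored_comm C (- alpha) (- alpha) opF opF u = 0.
Proof.
by rewrite /colored_comm (coloring_formNl CC) (coloring_formNl CC) cf_alpha scale1r subrr.
Qed.

Lemma beta_alpha n : beta n - (beta n + alpha *+ 1) = - alpha.
Proof. by rewrite mulr1n opprD addrA subrr add0r. Qed.

(** This relation forces the value of [phiEn] on letters with j = 1: lowering a letter with j = 0
    brings the factor n, and [f_{-1}, h_n] = -n f_{-1} cancels it. *)
Lemma opEn_opF n k : colored_comm C (beta n) (- alpha) (opEn n k) opF = fun u => 0.
Proof.
have lc : linear (colored_comm C (beta n) (- alpha) (opEn n k) opF) by exact: colored_comm_linear.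
apply/funext; apply: mul_letterP => // [|x].
  by rewrite /colored_comm /opEn /opF !deriv_op_nil !(lin0 (deriv_op_linear _ _)) scaler0 subr0.
exists (cf (beta n - alpha) (letter_degree x)) => u; apply: colored_comm0.
rewrite colored_jacobi_rev // opF_comm opEn_comm (colored_commZr _ _ _ _ (linear_opEn n k)).
case: x => [[l j] j'].
have -> : j'%:R *: colored_comm C (beta n) (- alpha + letter_degree (l, j, j')) (opEn n k)
     (mul_letter (lower_letter (l, j, j'))) u = 
   j'%:R *: phiEn n k (lower_letter (l, j, j')) u.
  by case: j' => [|j']; rewrite ?scale0r // -lower_letter_degree // opEn_comm.
rewrite /phiEn /=; case: j' => [|j'] /=.
  rewrite scale0r; case: eqP => [jn|_]; last by rewrite colored_comm_zeror // scaler0 subr0.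
  case: j jn => [|[|j]] jn; last by rewrite colored_comm_zeror // scaler0 subr0.
  - rewrite (colored_commZr _ _ _ _ linear_opF) /letter_degree /= jn mulr0n addr0 subrr.
    by rewrite opF_comm_opH -jn oppr0 scale0r !scaler0 subr0.
  - rewrite (colored_commZr _ _ _ _ linear_opF) /letter_degree /= jn beta_alpha.
    by rewrite opF_comm_self !scaler0 subr0.
rewrite addSnnS; case: eqP => [jn|_]; last by rewrite colored_comm_zeror // !scaler0 subr0.
case: j jn => [|[|j]] jn /=; last by rewrite colored_comm_zeror // !scaler0 subr0.
- rewrite (colored_commZr _ _ _ _ linear_opF) /letter_degree /= jn mulr0n addr0 subrr.
  rewrite opF_comm_opH -jn add0n !scalerA -scalerBl.
  by rewrite [X in X *: _](_ : _ = 0) ?scale0r //; ring.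
- rewrite (colored_commZr _ _ _ _ linear_opF) /letter_degree /= jn beta_alpha.
  by rewrite opF_comm_self !scaler0 subr0.
Qed.

Fixpoint adF n k j : M -> M :=
  if j is j'.+1 then colored_comm C (- alpha) (- alpha *+ j' - beta n) opF (adF n k j')
  else opFn n k.

(** Y d/dX applied j times to X^n gives a falling factorial times X^(n-j) Y^j. It vanishes for j = n
    + 1, which is the Serre relation for the f. *)
Lemma adFE n k j u : adF n k j u = (n ^_ j)%:R *:
  \sum_(l < monster_charge f (idx_pos n)) ca n k l *: mul_letter (l : nat, j, n - j)%N u.
Proof.
elim: j u => [|j IH] u /=; first by rewrite ffactn0 scale1r subn0.
have -> : adF n k j = fun u => (n ^_ j)%:R *:
  \sum_(l < monster_charge f (idx_pos n)) ca n k l *: mul_letter (l : nat, j, n - j)%N u.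
  by apply/funext.
rewrite (colored_commZr _ _ _ _ linear_opF) ffactnSr natrM.
case: (leqP j n) => jn; last first.
  by rewrite ffact_small // mul0r !scale0r.
rewrite -scalerA; congr (_ *: _); rewrite /colored_comm (lin_sum linear_opF).
rewrite !scaler_sumr -sumrB; apply: eq_bigr => l _.
rewrite (linZ linear_opF) !scalerA [_ * ca _ _ _]mulrC [_ * ca _ _ _]mulrC -!scalerA -scalerBr.
congr (_ *: _).
have := congr1 (fun g => g u) (opF_comm (l : nat, j, n - j)%N).
rewrite /colored_comm /letter_degree /= subnKC // /phiF /lower_letter /= subnS.
by rewrite opprD -mulNrn [- beta n + _]addrC.
Qed.

Lemma adF_serre n k u : adF n k n.+1 u = 0.
Proof. by rewrite adFE ffact_small // scale0r. Qed.

Fixpoint adE n k j : M -> M :=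
  if j is j'.+1 then colored_comm C alpha (alpha *+ j' + beta n) opE (adE n k j')
  else opEn n k.

Lemma linear_adE n k j : linear (adE n k j).
Proof. by elim: j => [|j IH] //=; exact: colored_comm_linear. Qed.

Lemma weighted_adE n k j : weighted (alpha *+ j + beta n) (adE n k j).
Proof.
elim: j => [|j IH] /=; first by rewrite mulr0n add0r; exact: weighted_opEn.
rewrite mulrS -addrA; apply: weighted_comm => //; first exact: linear_adE.
exact: weighted_opE.
Qed.

Lemma adE_nil n k j : adE n k j << [::] >> = 0.
Proof.
elim: j => [|j IH] /=; first exact: deriv_op_nil.
rewrite /colored_comm IH /opE deriv_op_nil !(lin0 (deriv_op_linear _ _)).
by rewrite (lin0 (linear_adE _ _ _)) scaler0 subr0.
Qed.

Lemma cf_alpha_adE n j : cf alpha (alpha *+ j + beta n) = cf alpha (beta n).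
Proof.
elim: j => [|j IH]; first by rewrite mulr0n add0r.
by rewrite mulrS -addrA (coloring_formDr CC) IH cf_alpha mul1r.
Qed.

(** The usual [sl2] computation for a lowest weight vector of weight -n, with a colour factor. The
    scalar vanishes at j = n + 1. *)
Lemma adE_opF n k j :
  colored_comm C (alpha *+ j + beta n) (- alpha) (adE n k j) opF =
  fun u => cf alpha (beta n) * (j%:R * (j%:R - n.+1%:R)) *: adE n k j.-1 u.
Proof.
elim: j => [|j IH] /=.
  by rewrite mulr0n add0r opEn_opF; apply/funext => u; rewrite mul0r mulr0 scale0r.
have lj := linear_adE n k j.
apply/funext => u; rewrite mulrS -addrA colored_jacobi_rev //.
rewrite addrN opEF_comm [colored_comm C _ 0 _ _ _]colored_comm_diagr; last first.
- exact: weighted_adE.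
- exact: addf_h.
rewrite IH (colored_commZr _ _ _ _ linear_opE) cf_alpha_adE.
have -> : (cf alpha (beta n) * (j%:R * (j%:R - n.+1%:R))) *:
   colored_comm C alpha (alpha *+ j + beta n - alpha) opE (adE n k j.-1) u =
   (cf alpha (beta n) * (j%:R * (j%:R - n.+1%:R))) *: adE n k j u.
  case: j {IH lj} => [|j]; first by rewrite mul0r mulr0 !scale0r.
  have -> // : alpha *+ j.+1 + beta n - alpha = alpha *+ j + beta n.
  by rewrite mulrS [LHS]addrC !addrA addNr add0r.
rewrite (addf_h _) (addfMn _ _ (addf_h _)) hm1_alpha hm1_beta scalerA -scalerBl.
congr (_ *: _); ring.
Qed.

Lemma adE_letter0 n k l p :
  colored_comm C (alpha *+ 1 + beta n) (- beta p) (adE n k 1) (mul_letter (l, 0, p)) =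
  fun u => (p == n)%:R * (cb n l k * n%:R) *: opE u.
Proof.
apply/funext => u; rewrite /= mulr1n mulr0n add0r -(letter_degree0 l) colored_jacobi_rev //.
rewrite opE_comm opEn_comm /phiE /=.
have -> : (fun u => 0%:R *: mul_letter (raise_letter (l, 0, p)) u) = (fun u => 0 : M).
  by apply/funext => v; rewrite scale0r.
rewrite colored_comm_zeror // scaler0 subr0 /phiEn /= add0n letter_degree0.
case: eqP => [->|_]; last by rewrite mul0r scale0r colored_comm_zeror.
rewrite subrr (colored_commZr _ _ _ _ linear_opE) mul1r.
rewrite colored_comm_diagr; [|exact: addf_h|exact: weighted_opE].
by rewrite hpos_alpha opprK scalerA.
Qed.

(** One application of ad e_{-1} already turns the commutator with a letter having j = 0 into a
    multiple of e_{-1}, and [e_{-1}, e_{-1}] = 0. *)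
Lemma adE_letter0S n k j l p :
  colored_comm C (alpha *+ j.+2 + beta n) (- beta p) (adE n k j.+2) (mul_letter (l, 0, p)) =
  fun u => 0.
Proof.
have red i u : colored_comm C (alpha *+ i.+1 + beta n) (- beta p) (adE n k i.+1) (mul_letter (l, 0, p)) u
  = colored_comm C alpha (alpha *+ i + beta n - beta p) opE
      (colored_comm C (alpha *+ i + beta n) (- beta p) (adE n k i) (mul_letter (l, 0, p))) u.
  rewrite mulrS -addrA -(letter_degree0 l) colored_jacobi_rev //; last exact: linear_adE.
  rewrite opE_comm /phiE /=.
  have -> : (fun u => 0%:R *: mul_letter (raise_letter (l, 0, p)) u) = (fun u => 0 : M).
    by apply/funext => v; rewrite scale0r.
  by rewrite colored_comm_zeror ?scaler0 ?subr0 //; exact: linear_adE.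
elim: j => [|j IH]; apply/funext => u; rewrite red; last by rewrite IH colored_comm_zeror.
rewrite adE_letter0 (colored_commZr _ _ _ _ linear_opE).
case: (eqVneq p n) => [->|_]; last by rewrite mul0r scale0r.
by rewrite addrK mulr1n /colored_comm cf_alpha scale1r subrr scaler0.
Qed.

Lemma mul_letterS l j j' u : mul_letter (l, j.+1, j') u =
  (j'.+1%:R)^-1 *: colored_comm C (- alpha) (letter_degree (l, j, j'.+1)) opF
    (mul_letter (l, j, j'.+1)) u.
Proof.
by rewrite opF_comm /phiF /= scalerA mulVf ?scale1r // pnatr_eq0.
Qed.

(** The element (ad e_{-1})^(n+1) e_n commutes, up to scalars, with f_{-1} and with the letters
    having j = 0. The other letters are obtained from these by ad f_{-1}, so it commutes with all
    letters and is zero. *)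
Lemma adE_serre n k u : adE n k n.+1 u = 0.
Proof.
have lZ := linear_adE n k n.+1.
move: u; apply: mul_letterP => //; first exact: adE_nil.
have [s sF] : exists s : K, forall u, adE n k n.+1 (opF u) = s *: opF (adE n k n.+1 u).
  exists (cf (alpha *+ n.+1 + beta n) (- alpha)) => u; apply: colored_comm0.
  by rewrite adE_opF subrr !mulr0 scale0r.
case=> [[l j] j']; elim: j j' => [|j IH] j'.
  exists (cf (alpha *+ n.+1 + beta n) (- beta j')) => u; apply: colored_comm0.
  (* For n = 0 only one bracket with e_{-1} is taken, and the scalar in [adE_letter0] contains the
     factor n = 0. *)
  case: n {lZ s sF} => [|n]; last by rewrite adE_letter0S.
  by rewrite adE_letter0 !mulr0 scale0r.
have [s' sL] := IH j'.+1.
exists (s * s') => u; rewrite !mul_letterS (linZ lZ) [RHS]scalerA [_ * _^-1]mulrC -scalerA.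
congr (_ *: _); rewrite /colored_comm (linB lZ) (linZ lZ) !(sF, sL).
rewrite (linZ linear_opF) (linZ (mul_letter_linear _)) scalerBr !scalerA.
by congr (_ - _ *: _); ring.
Qed.

(** An index with nonnegative value p is [idx_pos p.-1]; the only index with negative value is
    -1. *)
Definition word_op (g : bkm_gen (monster_charge f)) : M -> M :=
  match g with
  | GenH i => opH i
  | GenD i => opD i
  | GenE i k => if val i is Posz p then opEn p.-1 k else opE
  | GenF i k => if val i is Posz p then opFn p.-1 k else opF
  end.

Lemma word_op_linear g : linear (word_op g).
Proof.
by case: g => [i|i|i k|i k] //=; case: (val i) => p; auto.
Qed.

Lemma word_op_weighted g : weighted (gen_degree g) (word_op g).
Proof.
case: g => [i|i|i k|i k] /=; try exact: weighted_diag.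
- have [e|[n e]] := idx_cases i; subst i; [exact: weighted_opE | exact: weighted_opEn].
- have [e|[n e]] := idx_cases i; subst i; [exact: weighted_opF | exact: weighted_opFn].
Qed.

Local Notation cmp := (component C word_op).
Local Notation term := (lie_term R (monster_charge f)).

Lemma cmp_br_gen g (t : term) b c u : lie_homog b t ->
  cmp (LBr (LGen R g) t) c u =
  if c == gen_degree g + b
  then colored_comm C (gen_degree g) b (word_op g) (cmp t b) u else 0.
Proof.
move=> ht; rewrite (component_homog_br C word_op_linear _ _ (homog_gen R g)).
have -> : cmp (LGen R g) (gen_degree g) = word_op g by apply/funext => v /=; rewrite eqxx.
case: eqP => [->|/eqP Nc]; first by rewrite addrAC subrr add0r.
have Nb : c - gen_degree g != b by apply: contra Nc => /eqP <-; rewrite addrC subrK.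
have -> : cmp t (c - gen_degree g) = fun=> 0.
  by apply/funext => v; rewrite (component_homog C word_op_linear _ ht).
by rewrite colored_comm_zeror //; exact: word_op_linear.
Qed.

Lemma cmp_br_gen2 g g' c u :
  cmp (LBr (LGen R g) (LGen R g')) c u =
  if c == gen_degree g + gen_degree g'
  then colored_comm C (gen_degree g) (gen_degree g') (word_op g) (word_op g') u else 0.
Proof.
rewrite (cmp_br_gen _ _ _ (homog_gen R g')).
have -> // : cmp (LGen R g') (gen_degree g') = word_op g'.
by apply/funext => v /=; rewrite eqxx.
Qed.

Lemma cmp_br_diag chi g g' c u : addf chi -> word_op g = diag_op chi ->
  gen_degree g = 0 -> cmp (LBr (LGen R g) (LGen R g')) c u =
  cmp (LScale (chi (gen_degree g')) (LGen R g')) c u.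
Proof.
move=> ac e e0; rewrite cmp_br_gen2 e e0 add0r /=.
rewrite colored_comm_diag //; last exact: word_op_weighted.
by case: eqP => // _; rewrite scaler0.
Qed.

Lemma cmp_serreE (i : 'I_(monster_charge f idx_m1)) n (l : 'I_(monster_charge f (idx_pos n))) j :
  lie_homog (alpha *+ j + beta n) (iter j (LBr (LGen R (GenE i))) (LGen R (GenE l))) /\
  (forall u, cmp (iter j (LBr (LGen R (GenE i))) (LGen R (GenE l))) (alpha *+ j + beta n) u
   = adE n l j u).
Proof.
elim: j => [|j [IHh IH]].
  rewrite mulr0n add0r; split; first exact: (homog_gen R (GenE l)).
  by move=> u /=; rewrite eqxx.
have e : alpha *+ j.+1 + beta n = gen_degree (GenE i) + (alpha *+ j + beta n).
  by rewrite mulrS addrA.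
split; first by rewrite e; exact: (homog_br (homog_gen R (GenE i)) IHh).
move=> u; rewrite iterS (cmp_br_gen _ _ _ IHh) e eqxx.
by have -> : cmp (iter j (LBr (LGen R (GenE i))) (LGen R (GenE l))) (alpha *+ j + beta n) =
  adE n l j by apply/funext.
Qed.

Lemma cmp_serreF (i : 'I_(monster_charge f idx_m1)) n (l : 'I_(monster_charge f (idx_pos n))) j :
  lie_homog (- alpha *+ j - beta n) (iter j (LBr (LGen R (GenF i))) (LGen R (GenF l))) /\
  (forall u, cmp (iter j (LBr (LGen R (GenF i))) (LGen R (GenF l))) (- alpha *+ j - beta n) u
   = adF n l j u).
Proof.
elim: j => [|j [IHh IH]].
  rewrite mulr0n add0r; split; first exact: (homog_gen R (GenF l)).
  by move=> u /=; rewrite eqxx.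
have e : - alpha *+ j.+1 - beta n = gen_degree (GenF i) + (- alpha *+ j - beta n).
  by rewrite mulrS addrA.
split; first by rewrite e; exact: (homog_br (homog_gen R (GenF i)) IHh).
move=> u; rewrite iterS (cmp_br_gen _ _ _ IHh) e eqxx.
by have -> : cmp (iter j (LBr (LGen R (GenF i))) (LGen R (GenF l))) (- alpha *+ j - beta n) =
  adF n l j by apply/funext.
Qed.

Lemma monster_matrix_m1 n : monster_matrix idx_m1 (idx_pos n) = - n%:Z.
Proof. by rewrite /monster_matrix /= -addn1 PoszD addrC addrK. Qed.

Lemma serre_exponent n : absz (1 - monster_matrix idx_m1 (idx_pos n)) = n.+1.
Proof. by rewrite monster_matrix_m1 opprK -PoszD. Qed.

Lemma cmp_swap g g' c u :
  (forall c u, cmp (LBr (LGen R g') (LGen R g)) c u = 0) ->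
  cmp (LBr (LGen R g) (LGen R g')) c u = 0.
Proof.
move=> h; have := h (gen_degree g' + gen_degree g) u.
rewrite !cmp_br_gen2 eqxx; case: eqP => // _.
by move=> e; rewrite (colored_comm_skew CC) e scaler0.
Qed.

Lemma word_op_rel s t : bkm_rel monster_matrix s t ->
  forall a u, cmp s a u = cmp t a u.
Proof.
have z0 g g' c u chi : addf chi -> word_op g = diag_op chi -> gen_degree g = 0 ->
  gen_degree g' = 0 -> cmp (LBr (LGen R g) (LGen R g')) c u = 0.
  move=> ac e e0 e0'.
  by rewrite (cmp_br_diag _ _ _ ac) // componentZ e0' (addf0 ac) scale0r.
have cst g c u (k : K) : cmp (LScale k (LGen R g)) c u =
  if c == gen_degree g then k *: word_op g u else 0.
  by rewrite componentZ /=; case: eqP => // _; rewrite scaler0.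
have m11 (k l : 'I_(monster_charge f idx_m1)) : k = l.
  have c1 : monster_charge f idx_m1 = 1%N by rewrite /monster_charge /= fm1.
  have := ltn_ord k; have := ltn_ord l; rewrite [X in (_ < X)%N -> _]c1.
  rewrite [X in _ -> (_ < X)%N -> _]c1 !ltnS !leqn0 => /eqP l0 /eqP k0.
  by apply/val_inj; rewrite /= l0 k0.
case=> {s t}.
- by move=> i j a u; apply: (z0 _ _ _ _ (h_weight i)) => //; exact: addf_h.
- by move=> i j a u; apply: (z0 _ _ _ _ (h_weight i)) => //; exact: addf_h.
- by move=> i j a u; apply: (z0 _ _ _ _ (d_weight i)) => //; exact: addf_d.
- move=> i j l a u; rewrite (cmp_br_diag _ _ _ (addf_h i)) //= h_weightU.
  by case: eqP.
- move=> i j l a u; rewrite (cmp_br_diag _ _ _ (addf_h i)) //= (addfN _ (addf_h i)) h_weightU.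
  by case: eqP.
- move=> i j l a u; rewrite (cmp_br_diag _ _ _ (addf_d i)) //= d_weightU.
  by case: eqP.
- move=> i j l a u; rewrite (cmp_br_diag _ _ _ (addf_d i)) //= (addfN _ (addf_d i)) d_weightU.
  by case: eqP.
- move=> i k l a u; rewrite cmp_br_gen2 cst subrr; case: eqP => // _.
  have [e|[n e]] := idx_cases i; subst i.
    by rewrite (m11 k l) eqxx scale1r /= opEF_comm.
  by rewrite /= opEn_opFn.
- move=> i j k l ij a u; rewrite cmp_br_gen2; case: eqP => // _.
  have [e|[n e]] := idx_cases i; have [e'|[p e']] := idx_cases j; subst i j => /=.
  + by rewrite eqxx in ij.
  + by rewrite opE_opFn.
  + by rewrite opEn_opF.
  + by rewrite opEn_opFn_neq //; apply: contra ij => /eqP ->.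
- move=> i j k l ii ij a u.
  have [e|[n e]] := idx_cases i; subst i; last by [].
  have [e'|[p e']] := idx_cases j; subst j; first by rewrite eqxx in ij.
  rewrite serre_exponent; have [hh hc] := cmp_serreE k l p.+1.
  case: (eqVneq a (alpha *+ p.+1 + beta p)) => [->|Na]; first by rewrite hc adE_serre.
  by rewrite (component_homog C word_op_linear _ hh).
- move=> i j k l ii ij a u.
  have [e|[n e]] := idx_cases i; subst i; last by [].
  have [e'|[p e']] := idx_cases j; subst j; first by rewrite eqxx in ij.
  rewrite serre_exponent; have [hh hc] := cmp_serreF k l p.+1.
  case: (eqVneq a (- alpha *+ p.+1 - beta p)) => [->|Na]; first by rewrite hc adF_serre.
  by rewrite (component_homog C word_op_linear _ hh).
(* a_{ij} = -(i + j) vanishes only for the pair -1 and 1, so this relation is the Serre relation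
   with n = 0, in either order. *)
- have ee k (l : 'I_(monster_charge f (idx_pos 0))) c u : 
    cmp (LBr (LGen R (GenE (i := idx_m1) k)) (LGen R (GenE l))) c u = 0.
    have [hh hc] := cmp_serreE k l 1.
    case: (eqVneq c (alpha *+ 1 + beta 0)) => [->|Na]; first by rewrite hc adE_serre.
    by rewrite (component_homog C word_op_linear _ hh).
  move=> i j k l A0 a u.
  have [e|[n e]] := idx_cases i; have [e'|[p e']] := idx_cases j; subst i j => //.
  + by case: p l A0 => [|p] l A0; [exact: ee | by []].
  + case: n k A0 => [|n] k A0; [|by []].
    by apply: cmp_swap => c v; exact: ee.
- have ee k (l : 'I_(monster_charge f (idx_pos 0))) c u : 
    cmp (LBr (LGen R (GenF (i := idx_m1) k)) (LGen R (GenF l))) c u = 0.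
    have [hh hc] := cmp_serreF k l 1.
    case: (eqVneq c (- alpha *+ 1 - beta 0)) => [->|Na]; first by rewrite hc adF_serre.
    by rewrite (component_homog C word_op_linear _ hh).
  move=> i j k l A0 a u.
  have [e|[n e]] := idx_cases i; have [e'|[p e']] := idx_cases j; subst i j => //.
  + by case: p l A0 => [|p] l A0; [exact: ee | by []].
  + case: n k A0 => [|n] k A0; [|by []].
    by apply: cmp_swap => c v; exact: ee.
Qed.

End WordModule.

(** * Generators of the negative part *)

Section Bracket.
Variables (R : realType) (I : choiceType).
Variables (A : I -> I -> int) (m : I -> nat) (C : I -> I -> R[i]).
Hypothesis CC : forall i j, C i j * C j i = 1.
Local Notation Q := {freeg I}.
Local Notation L := (bkm A m C).
Local Notation cf := (coloring_form C).
Local Notation br := (@bracket R I A m C).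
Local Notation cls := (@bkm_class R I A m C).

Lemma bkm_classD s t : cls (LAdd s t) = cls s + cls t.
Proof. exact: bkm_class_add. Qed.
Lemma bkm_classZ k s : cls (LScale k s) = k *: cls s.
Proof. exact: bkm_class_scale. Qed.
Lemma bkm_class0 : cls (LZero R m) = 0. Proof. by []. Qed.

Lemma br_linl (y : L) : linear (fun x => br x y).
Proof.
move=> k x x'; rewrite -(bkm_reprK x) -(bkm_reprK x') -(bkm_reprK y).
rewrite -bkm_classZ -bkm_classD -!bkm_class_br -bkm_classZ -bkm_classD.
apply/bkm_classP; apply: lie_trans; first exact: lie_brDl.
by apply: lie_add; [exact: lie_brZl | exact: lie_refl].
Qed.

Lemma br_linr (y : L) : linear (br y).
Proof.
move=> k x x'; rewrite -(bkm_reprK x) -(bkm_reprK x') -(bkm_reprK y).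
rewrite -bkm_classZ -bkm_classD -!bkm_class_br -bkm_classZ -bkm_classD.
apply/bkm_classP; apply: lie_trans; first exact: lie_brDr.
by apply: lie_add; [exact: lie_brZr | exact: lie_refl].
Qed.

Local Notation hom := (@root_space R I A m C).

Lemma root_space_br a b (x y : L) : hom a x -> hom b y -> hom (a + b) (br x y).
Proof.
case=> s hs -> [t ht ->]; exists (LBr s t); first exact: homog_br.
by rewrite bkm_class_br.
Qed.

Lemma root_space_skew a b (x y : L) : hom a x -> hom b y -> br x y = - cf a b *: br y x.
Proof.
case=> s hs -> [t ht ->]; rewrite -!bkm_class_br -bkm_classZ.
by apply/bkm_classP/lie_skew.
Qed.

Lemma root_space_jacobi a b (x y z : L) : hom a x -> hom b y ->
  br x (br y z) = br (br x y) z + cf a b *: br y (br x z).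
Proof.
case=> s hs -> [t ht ->]; rewrite -(bkm_reprK z) -!bkm_class_br -bkm_classZ -bkm_classD.
by apply/bkm_classP/lie_jacobi.
Qed.

Lemma root_space0 a : hom a (0 : L).
Proof. by exists (LZero R m); [exact: homog_zero | exact: bkm_class0]. Qed.
Lemma root_spaceD a (x y : L) : hom a x -> hom a y -> hom a (x + y).
Proof.
by case=> s hs -> [t ht ->]; exists (LAdd s t); [exact: homog_add | rewrite bkm_classD].
Qed.
Lemma root_spaceZ a k (x : L) : hom a x -> hom a (k *: x).
Proof.
by case=> s hs ->; exists (LScale k s); [exact: homog_scale | rewrite bkm_classZ].
Qed.

Lemma root_space_span a (S : L -> Prop) x : (forall y, S y -> hom a y) ->
  lin_span S x -> hom a x.
Proof.
move=> h; elim=> [|k u v Su _ IH]; first exact: root_space0.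
by apply: root_spaceD => //; apply: root_spaceZ; exact: h.
Qed.

Definition gen_elt (g : bkm_gen m) : L := cls (LGen R g).

Lemma gen_elt_root g : hom (gen_degree g) (gen_elt g).
Proof. by exists (LGen R g) => //; exact: homog_gen. Qed.

Lemma rel_class s t : bkm_rel A s t -> cls s = cls t.
Proof. by move=> r; apply/bkm_classP/lie_rel. Qed.

Definition lie_mono_brQ I0 (y : I0 -> L) c :=
  @lie_mono_br _ L Q br hom cf br_linr root_space_br root_space_jacobi I0 y c.

Lemma gen_mono_span a t : lie_homog a t ->
  lin_span (lie_mono br gen_elt (@gen_degree I m) a) (cls t).
Proof.
elim=> {a t} [g|a|a s t _ IHs _ IHt|a k s _ IHs|a b s t hs IHs ht IHt].
- by apply: span_in; exact: (lie_mono1 br gen_elt (@gen_degree I m) g).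
- by rewrite bkm_class0; exact: span0.
- by rewrite bkm_classD; exact: spanD.
- by rewrite bkm_classZ; exact: spanZ.
rewrite bkm_class_br.
apply: (span_image (X := fun x => br x (cls t))) IHs _ => [|u mu]; first exact: br_linl.
apply: span_image IHt _ => [|v mv]; first exact: br_linr.
exact: (lie_mono_brQ gen_elt_root).
Qed.

Lemma br0l (y : L) : br 0 y = 0. Proof. exact: (lin0 (br_linl y)). Qed.
Lemma brZl k (x y : L) : br (k *: x) y = k *: br x y. Proof. exact: (linZ (br_linl y)). Qed.
Lemma brZr k (x y : L) : br x (k *: y) = k *: br x y. Proof. exact: (linZ (br_linr x)). Qed.

Local Notation gen_mono := (lie_mono br gen_elt (@gen_degree I m)).

Lemma lie_mono_map I0 I1 (phi : I0 -> I1) (y0 : I0 -> L) (c0 : I0 -> Q) y1 c1 g x :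
  (forall i, y0 i = y1 (phi i)) -> (forall i, c0 i = c1 (phi i)) ->
  lie_mono br y0 c0 g x -> lie_mono br y1 c1 g x.
Proof. by move=> ey ec; elim=> [i|i h u _ IH]; rewrite ey ec; constructor. Qed.

Lemma lie_mono_cast I0 (y0 : I0 -> L) (c0 : I0 -> Q) g g' x :
  lie_mono br y0 c0 g x -> g = g' -> lie_mono br y0 c0 g' x.
Proof. by move=> h <-. Qed.

Definition cartan_gen (i : I + I) : bkm_gen m := match i with inl i => GenH m i | inr i => GenD m i end.

Lemma cartan_degree i : gen_degree (cartan_gen i) = 0. Proof. by case: i. Qed.

Lemma cartan_gen_weight i g : exists k : R[i],
  br (gen_elt (cartan_gen i)) (gen_elt g) = k *: gen_elt g.
Proof.
have swap i' j : br (gen_elt (GenD m i')) (gen_elt (GenH m j)) = 0.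
  rewrite (root_space_skew (gen_elt_root _) (gen_elt_root _)) -bkm_class_br.
  by rewrite (rel_class (rel_hd _ _ _ _ _)) bkm_class0 scaler0.
case: i g => i [j|j|j l|j l] /=.
- by exists 0; rewrite scale0r -bkm_class_br (rel_class (rel_hh _ _ _ _ _)).
- by exists 0; rewrite scale0r -bkm_class_br (rel_class (rel_hd _ _ _ _ _)).
- by eexists; rewrite -bkm_class_br (rel_class (@rel_he R I A m _ _ l)) bkm_classZ.
- by eexists; rewrite -bkm_class_br (rel_class (@rel_hf R I A m _ _ l)) bkm_classZ.
- by exists 0; rewrite scale0r swap.
- by exists 0; rewrite scale0r -bkm_class_br (rel_class (rel_dd _ _ _ _ _)).
- by eexists; rewrite -bkm_class_br (rel_class (@rel_de R I A m _ _ l)) bkm_classZ.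
- by eexists; rewrite -bkm_class_br (rel_class (@rel_df R I A m _ _ l)) bkm_classZ.
Qed.

Lemma cartan_weight i g x : gen_mono g x -> exists k : R[i],
  br (gen_elt (cartan_gen i)) x = k *: x.
Proof.
elim=> [g0|g0 h u _ [k IH]]; first exact: cartan_gen_weight.
have [k0 e0] := cartan_gen_weight i g0.
rewrite (root_space_jacobi _ (gen_elt_root (cartan_gen i)) (gen_elt_root g0)) e0 IH.
by rewrite brZl brZr scalerA -scalerDl; eexists.
Qed.

Local Notation idx := {i : I & 'I_(m i)}.
Definition f_elt (p : idx) : L := gen_elt (GenF (tagged p)).
Definition e_elt (p : idx) : L := gen_elt (GenE (tagged p)).
Definition f_degree (p : idx) : Q := - << tag p >>.
Local Notation f_mono := (lie_mono br f_elt f_degree).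

Definition borel_gen (b : (I + I) + idx) : bkm_gen m :=
  match b with inl i => cartan_gen i | inr p => GenE (tagged p) end.
Local Notation b_mono := (lie_mono br (gen_elt \o borel_gen) (@gen_degree I m \o borel_gen)).

Lemma f_mono_gen g x : f_mono g x -> gen_mono g x.
Proof. exact: (lie_mono_map (phi := fun p : idx => GenF (tagged p))). Qed.
Lemma b_mono_gen g x : b_mono g x -> gen_mono g x.
Proof. exact: (lie_mono_map (phi := borel_gen)). Qed.

Lemma br_ef (p q : idx) : br (e_elt p) (f_elt q) = 0 \/ 
  tag p = tag q /\ exists k, br (e_elt p) (f_elt q) = k *: gen_elt (GenH m (tag p)).
Proof.
case: p q => i k [j l]; rewrite /e_elt /f_elt /= -bkm_class_br.
case: (eqVneq i j) => [e|ij]; last by left; rewrite (rel_class (@rel_ef_neq R I A m _ _ k l ij)).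
case: _ / e l => l; right; split=> //.
by exists (k == l)%:R; rewrite (rel_class (@rel_ef R I A m _ k l)) bkm_classZ.
Qed.

Lemma br_fh (p : idx) i : exists k, br (f_elt p) (gen_elt (cartan_gen i)) = k *: f_elt p.
Proof.
rewrite (root_space_skew (gen_elt_root _) (gen_elt_root _)).
have [k ->] := cartan_gen_weight i (GenF (tagged p)).
by rewrite scalerA; eexists.
Qed.

(** [e_p, f_q] is zero or a multiple of an h, which acts on the rest of the monomial by a scalar:
    one letter is lost. In degree zero the h itself can remain. *)
Lemma br_e_mono p g x : f_mono g x ->
  lin_span (fun z => f_mono (<< tag p >> + g) z \/
    << tag p >> + g = 0 /\ exists i, z = gen_elt (GenH m i)) (br (e_elt p) x).
Proof.
elim=> [q|q b y my IH].
  have [->|[epq [k ->]]] := br_ef p q; first exact: span0.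
  apply/spanZ/span_in; right; rewrite /f_degree epq subrr; split => //.
  by exists (tag q).
rewrite (root_space_jacobi _ (gen_elt_root (GenE (tagged p))) (gen_elt_root (GenF (tagged q)))).
apply: spanD; last apply: spanZ.
  have [->|[epq [k ->]]] := br_ef p q; first by rewrite br0l; exact: span0.
  have [k' e'] := cartan_weight (inl (tag p)) (f_mono_gen my).
  rewrite brZl e'; apply/spanZ/spanZ/span_in; left.
  by apply: lie_mono_cast my _; rewrite /f_degree epq addrA subrr add0r.
apply: (span_image (br_linr _) IH) => z [mz|[e0 [i ->]]].
  apply: span_in; left; apply: lie_mono_cast (lie_monoS q mz) _.
  by rewrite addrCA.
have [k ek] := br_fh q (inl i); rewrite [br _ _]ek; apply/spanZ/span_in; left.
apply: lie_mono_cast (lie_mono1 br f_elt f_degree q) _.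
by rewrite addrCA e0 addr0.
Qed.

Lemma br_f_mono q g x : b_mono g x ->
  lin_span (fun z => f_mono (f_degree q + g) z \/ b_mono (f_degree q + g) z) (br (f_elt q) x).
Proof.
have hfe p : br (f_elt q) (e_elt p) = 0 \/
    tag p = tag q /\ exists k, br (f_elt q) (e_elt p) = k *: gen_elt (GenH m (tag p)).
  rewrite (root_space_skew (gen_elt_root _) (gen_elt_root _)).
  have [->|[epq [k ->]]] := br_ef p q; first by left; rewrite scaler0.
  by right; split=> //; rewrite scalerA; eexists.
have eq0 p b : tag p = tag q -> b = f_degree q + (<< tag p >> + b).
  by rewrite /f_degree => ->; rewrite addrA addNr add0r.
elim=> [[i|p]|[i|p] b y my IH] /=.
- have [k ->] := br_fh q i; rewrite cartan_degree addr0.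
  by apply/spanZ/span_in; left; exact: lie_mono1.
- have [->|[epq [k ->]]] := hfe p; first exact: span0.
  apply/spanZ/span_in; right.
  have := lie_mono1 br (gen_elt \o borel_gen) (@gen_degree I m \o borel_gen) (inl (inl (tag p))).
  by move=> h; apply: lie_mono_cast h _; rewrite /= /f_degree epq addNr.
- rewrite cartan_degree add0r.
  rewrite (root_space_jacobi _ (gen_elt_root (GenF (tagged q))) (gen_elt_root _)).
  have [k ek] := br_fh q i; rewrite -/(f_elt q) ek brZl.
  apply: spanD; first exact: spanZ; apply: spanZ.
  apply: (span_image (br_linr _) IH) => z mz.
  have [k' e'] : exists k, br (gen_elt (cartan_gen i)) z = k *: z.
    by case: mz => [/f_mono_gen|/b_mono_gen]; exact: cartan_weight.
  by rewrite e'; apply/spanZ/span_in.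
- rewrite (root_space_jacobi _ (gen_elt_root (GenF (tagged q))) (gen_elt_root (GenE (tagged p)))).
  apply: spanD; last apply: spanZ.
    have [h|[epq [k h]]] := hfe p; rewrite [X in br X _]h; first by rewrite br0l; exact: span0.
    have [k' e'] := cartan_weight (inl (tag p)) (b_mono_gen my).
    rewrite brZl e'; apply/spanZ/spanZ/span_in; right.
    by rewrite -eq0.
  apply: (span_image (br_linr _) IH) => z [mz|mz].
    apply: span_bind (br_e_mono p mz) _ => t [mt|[e0 [i ->]]].
      by apply: span_in; left; apply: lie_mono_cast mt _; rewrite addrCA.
    apply: span_in; right.
    have := lie_mono1 br (gen_elt \o borel_gen) (@gen_degree I m \o borel_gen) (inl (inl i)).
    by move=> h; apply: lie_mono_cast h _; rewrite /= -e0 addrCA.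
  apply: span_in; right.
  have := lie_monoS (inr p) mz.
  by move=> h; apply: lie_mono_cast h _; rewrite /= addrCA.
Qed.

(** The span of the f-monomials and of the monomials in h, d, e is stable under bracketing with
    every generator, hence it is everything. Only spanning is claimed; independence comes from the
    module of words. *)
Lemma triangular_span g x : gen_mono g x -> lin_span (fun z => f_mono g z \/ b_mono g z) x.
Proof.
have gens g0 : (exists p : idx, g0 = GenF (tagged p)) \/ exists b, g0 = borel_gen b.
  case: g0 => [i|i|i k|i k].
  - by right; exists (inl (inl i)).
  - by right; exists (inl (inr i)).
  - by right; exists (inr (Tagged (fun i => 'I_(m i)) k)).
  - by left; exists (Tagged (fun i => 'I_(m i)) k).
elim=> [g0|g0 b y my IH].
  have [[p ->]|[b ->]] := gens g0; apply: span_in.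
    by left; exact: (lie_mono1 br f_elt f_degree p).
  right; exact: (lie_mono1 br (gen_elt \o borel_gen) (@gen_degree I m \o borel_gen) b).
apply: (span_image (br_linr _) IH) => z mz.
have [[p ->]|[[i|p] ->]] := gens g0.
- case: mz => mz; last exact: (br_f_mono p mz).
  by apply: span_in; left; exact: (lie_monoS p mz).
- have [k e'] : exists k, br (gen_elt (cartan_gen i)) z = k *: z.
    by case: mz => [/f_mono_gen|/b_mono_gen]; exact: cartan_weight.
  by rewrite /= e' cartan_degree add0r; apply/spanZ/span_in.
- case: mz => mz.
    apply: span_bind (br_e_mono p mz) _ => t [mt|[e0 [i ->]]]; apply: span_in; first by left.
    right; have := lie_mono1 br (gen_elt \o borel_gen) (@gen_degree I m \o borel_gen) (inl (inl i)).
    by move=> h; apply: lie_mono_cast h _; rewrite /= -e0.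
  apply: span_in; right.
  exact: (lie_monoS (inr p) mz).
Qed.

(** A monomial in h, d, e has a degree on which [lam] is nonnegative, so in a degree where [lam] is
    negative only f-monomials occur. *)
Lemma negative_span (lam : Q -> int) a x : (forall b c, lam (b + c) = lam b + lam c) ->
  (forall i, 0 <= lam << i >>) -> lam a < 0 -> hom a x -> lin_span (f_mono a) x.
Proof.
move=> lamD lam0 la [t ht ->].
apply: span_bind (gen_mono_span ht) _ => z /triangular_span.
apply: span_sub => u [//|mb]; exfalso.
have l0 : lam 0 = 0 by apply: (addrI (lam 0)); rewrite -lamD !addr0.
suff : 0 <= lam a by rewrite leNgt la.
elim: {la ht t x z u} mb => [[i|p]|[i|p] b y _ IH] /=; rewrite ?cartan_degree ?l0 // lamD.
  by rewrite l0 add0r.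
by rewrite addr_ge0 //= lam0.
Qed.

End Bracket.

Definition II_first (a : {freeg monster_idx}) : int := (II_degree a).1.
Definition II_second (a : {freeg monster_idx}) : int := (II_degree a).2.

Lemma II_firstE a : II_first a = fglift (fun _ => (1 : int^o)) a.
Proof. by rewrite fgliftE; apply: eq_bigr => i _; rewrite [RHS]mulr1. Qed.
Lemma II_secondE a : II_second a = fglift (fun i : monster_idx => (val i : int^o)) a.
Proof. by rewrite fgliftE. Qed.

Lemma II_firstD a b : II_first (a + b) = II_first a + II_first b.
Proof. by rewrite !II_firstE (linD (fglift_linear _)). Qed.
Lemma II_secondD a b : II_second (a + b) = II_second a + II_second b.
Proof. by rewrite !II_secondE (linD (fglift_linear _)). Qed.
Lemma II_firstN a : II_first (- a) = - II_first a.
Proof. by rewrite !II_firstE (linN (fglift_linear _)). Qed.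
Lemma II_secondN a : II_second (- a) = - II_second a.
Proof. by rewrite !II_secondE (linN (fglift_linear _)). Qed.
Lemma II_firstU i : II_first << i >> = 1.
Proof. by rewrite II_firstE fgliftU. Qed.
Lemma II_secondU i : II_second << i >> = val i.
Proof. by rewrite II_secondE fgliftU. Qed.
Lemma II_firstMn a n : II_first (a *+ n) = II_first a *+ n.
Proof.
elim: n => [|n IH]; last by rewrite !mulrS II_firstD IH.
by rewrite !mulr0n II_firstE (lin0 (fglift_linear _)).
Qed.
Lemma II_secondMn a n : II_second (a *+ n) = II_second a *+ n.
Proof.
elim: n => [|n IH]; last by rewrite !mulrS II_secondD IH.
by rewrite !mulr0n II_secondE (lin0 (fglift_linear _)).
Qed.
Lemma II_degreeE a : II_degree a = (II_first a, II_second a).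
Proof. by []. Qed.

(** * Reduction of the negative root spaces to the letters *)

Section Letters.
Variables (R : realType) (f : int -> int).
Variable C : monster_idx -> monster_idx -> R[i].
Hypothesis fm1 : f (-1) = 1.
Hypothesis hC : is_coloring f C.
Local Notation I := monster_idx.
Local Notation Q := {freeg monster_idx}.
Local Notation K := R[i].
Local Notation L := (monstrous f C).
Local Notation ch := (monster_charge f).
Local Notation cf := (coloring_form C).
Local Notation br := (@bracket R I monster_matrix ch C).
Local Notation hom := (@root_space R I monster_matrix ch C).
Local Notation alpha := (<< idx_m1 >> : Q).
Local Notation beta n := (<< idx_pos n >> : Q).
Local Notation felt := (@f_elt R I monster_matrix ch C).
Let CC := coloringCC hC.

Lemma charge_m1 : ch idx_m1 = 1%N.
Proof. by rewrite /monster_charge /= fm1. Qed.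

Definition k_m1 : 'I_(ch idx_m1) := cast_ord (esym charge_m1) ord0.

Lemma k_m1_unique k : k = k_m1.
Proof.
apply: val_inj; have := ltn_ord k; rewrite [X in (_ < X)%N]charge_m1 ltnS leqn0.
by move=> /eqP /= ->.
Qed.

Definition f_m1 : L := felt (Tagged (fun i => 'I_(ch i)) k_m1).
Definition f_pos n (k : 'I_(ch (idx_pos n))) : L := felt (Tagged (fun i => 'I_(ch i)) k).

Lemma f_m1_root : hom (- alpha) f_m1.
Proof. exact: (gen_elt_root _ _ (GenF k_m1)). Qed.
Lemma f_pos_root n k : hom (- beta n) (@f_pos n k).
Proof. exact: (gen_elt_root _ _ (GenF k)). Qed.

Lemma f_m1_even : br f_m1 f_m1 = 0.
Proof.
have skew := @root_space_skew R I monster_matrix ch C.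
apply: (@br_even _ _ _ br hom cf skew _ _ f_m1_root).
by rewrite (coloring_formNl CC) (coloring_formNl CC) (cf_alpha fm1 hC).
Qed.

Lemma f_serre n k : iter n.+1 (br f_m1) (@f_pos n k) = 0.
Proof.
have e j : iter j (br f_m1) (f_pos k) =
    bkm_class monster_matrix C (iter j (LBr (LGen R (GenF k_m1))) (LGen R (GenF k))).
  by elim: j => [|j IH] //=; rewrite IH bkm_class_br.
rewrite e -serre_exponent.
by rewrite (rel_class C (@rel_serre_f R I monster_matrix ch idx_m1 (idx_pos n) k_m1 k erefl isT)).
Qed.

Variables ca cb : forall n, 'M[K]_(ch (idx_pos n)).
Hypothesis cab : forall n, ca n *m cb n = 1%:M.

Definition v_pos n (l : 'I_(ch (idx_pos n))) : L := \sum_k cb n l k *: f_pos k.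

Lemma f_posE n (k : 'I_(ch (idx_pos n))) : f_pos k = \sum_l ca n k l *: v_pos l.
Proof.
transitivity (\sum_k' (ca n *m cb n) k k' *: f_pos k').
  rewrite cab (bigD1 k) //= mxE eqxx scale1r big1 ?addr0 // => k' nk.
  by rewrite mxE eq_sym (negPf nk) scale0r.
under eq_bigr do rewrite mxE scaler_suml.
rewrite exchange_big; apply: eq_bigr => l _; rewrite /v_pos scaler_sumr.
by apply: eq_bigr => k' _; rewrite scalerA.
Qed.

Lemma v_pos_root n l : hom (- beta n) (@v_pos n l).
Proof.
apply: (big_ind (hom (- beta n))) => [|x y|k _]; [exact: root_space0|exact: root_spaceD|].
by apply: root_spaceZ; exact: f_pos_root.
Qed.

Definition w_elt n (l : 'I_(ch (idx_pos n))) j : L := iter j (br f_m1) (v_pos l).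
Definition w_degree n j : Q := - (beta n + alpha *+ j).

Lemma w_degreeS n j : w_degree n j.+1 = - alpha + w_degree n j.
Proof. by rewrite /w_degree mulrS !opprD addrCA. Qed.
Lemma w_degree0 n : w_degree n 0 = - beta n.
Proof. by rewrite /w_degree mulr0n addr0. Qed.

Lemma w_elt_root n l j : hom (w_degree n j) (@w_elt n l j).
Proof.
elim: j => [|j IH]; first by rewrite w_degree0; exact: v_pos_root.
by rewrite w_degreeS; apply: root_space_br => //; exact: f_m1_root.
Qed.

Lemma iter_br_linear j : linear (iter j (br f_m1) : L -> L).
Proof. by elim: j => [|j IH] k x y //=; rewrite IH (br_linr f_m1). Qed.

Lemma w_serre n l : @w_elt n l n.+1 = 0.
Proof.
rewrite /w_elt /v_pos (lin_sum (iter_br_linear _)) big1 // => k _.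
by rewrite (linZ (iter_br_linear _)) f_serre scaler0.
Qed.

Variable N : nat.

(** Up to sign, the two coordinates of every letter with index n add up to n + 2, so root spaces
    with m + n <= N involve only letters with index below N. *)
Definition letters : finType := {n : 'I_N & ('I_(ch (idx_pos n)) * 'I_n.+1)%type}.
Definition mk_letter n (nN : (n < N)%N) (l : 'I_(ch (idx_pos n))) j (jn : (j < n.+1)%N) : letters :=
  Tagged (fun n : 'I_N => ('I_(ch (idx_pos n)) * 'I_n.+1)%type) (i := Ordinal nN) (l, Ordinal jn).
Definition letter_elt (x : letters) : L := w_elt (tagged x).1 (tagged x).2.
Definition letter_deg (x : letters) : Q := w_degree (tag x) (tagged x).2.
Local Notation w_mono := (lie_mono br letter_elt letter_deg).

Lemma letter_elt_root x : hom (letter_deg x) (letter_elt x).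
Proof. exact: w_elt_root. Qed.

Lemma w_elt_mono n l j : (n < N)%N -> lin_span (w_mono (w_degree n j)) (@w_elt n l j).
Proof.
move=> nN; case: (ltnP j n.+1) => jn.
  by apply: span_in; exact: (lie_mono1 br letter_elt letter_deg (mk_letter nN l jn)).
rewrite (_ : w_elt l j = 0); first exact: span0.
rewrite /w_elt -(subnK jn) iterD -/(w_elt l n.+1).
by rewrite w_serre (lin0 (iter_br_linear _)).
Qed.

(** ad f_{-1} is a derivation that permutes the letters over a given v_l; the Serre relation closes
    the alphabet after the last exponent. *)
Lemma f_m1_mono g z : w_mono g z -> lin_span (w_mono (- alpha + g)) (br f_m1 z).
Proof.
elim=> [x|x h u mu IH].
  by rewrite -w_degreeS; exact: (w_elt_mono (tagged x).1 (tagged x).2.+1 (ltn_ord _)).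
rewrite (root_space_jacobi _ f_m1_root (letter_elt_root x)).
apply: spanD; last apply: spanZ.
  have h1 : lin_span (w_mono (- alpha + letter_deg x)) (br f_m1 (letter_elt x)).
    by rewrite -w_degreeS; exact: (w_elt_mono (tagged x).1 (tagged x).2.+1 (ltn_ord _)).
  rewrite addrA; apply: (span_image (br_linl u)) h1 _ => t mt.
  exact: (lie_mono_brQ letter_elt_root).
rewrite addrCA; apply: (span_image (br_linr _)) IH _ => t mt.
exact/span_in/lie_monoS.
Qed.

(** An outer f_{-1} is absorbed as a derivation of the algebra of letters, and [f_{-1}, f_{-1}] = 0,
    so f_{-1} alone is the one exception. In the measure minus the sum of the coordinates, f_{-1}
    counts 0 and f_{n,k} counts n + 2, which bounds the indices that occur. *)
Lemma f_mono_span g x : lie_mono br felt (@f_degree I ch) g x ->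
  - (II_first g + II_second g) <= N%:Z ->
  lin_span (fun z => w_mono g z \/ (g = - alpha /\ z = f_m1)) x.
Proof.
have s0 (p : {i : I & 'I_(ch i)}) : 0 <= - (II_first (f_degree p) + II_second (f_degree p)).
  rewrite /f_degree II_firstN II_secondN II_firstU II_secondU.
  by have [->|[n ->]] := idx_cases (tag p); rewrite //= ; lia.
have pcase (p : {i : I & 'I_(ch i)}) : p = Tagged (fun i => 'I_(ch i)) k_m1 \/
    exists n k, p = Tagged (fun i => 'I_(ch i)) (k : 'I_(ch (idx_pos n))).
  case: p => i k; have [e|[n e]] := idx_cases i; subst i.
    by left; rewrite (k_m1_unique k).
  by right; exists n, k.
have sb n : - (II_first (- beta n) + II_second (- beta n)) = n.+2%:Z.
  by rewrite II_firstN II_secondN II_firstU II_secondU /=; lia.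
elim=> [p|p b y my IH] sN.
  have [->|[n [k ep]]] := pcase p; first by apply: span_in; right.
  move: sN; rewrite ep /f_degree /= sb => sN; have nN : (n < N)%N by lia.
  rewrite -/(f_pos k) f_posE; apply: span_sum => l _; apply: spanZ.
  rewrite -w_degree0; apply: span_sub (w_elt_mono l 0 nN) => z; by left.
have sbN : - (II_first b + II_second b) <= N%:Z.
  by have := s0 p; move: sN; rewrite II_firstD II_secondD; lia.
have [ep|[n [k ep]]] := pcase p.
  rewrite ep /f_degree /= -/f_m1; apply: (span_image (br_linr _) (IH sbN)) => z [mz|[-> ->]].
    by apply: span_sub (f_m1_mono mz) => t; left.
  by rewrite f_m1_even; exact: span0.
have nN : (n < N)%N.
  suff : n.+2%:Z <= N%:Z by lia.
  have key u v : 0 <= - (II_first v + II_second v) ->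
      - (II_first u + II_second u) <= - (II_first (u + v) + II_second (u + v)).
    by rewrite II_firstD II_secondD; lia.
  rewrite -sb; apply: le_trans (key _ b _) _; last by move: sN; rewrite ep.
  elim: {IH sN sbN ep} my => [q|q b' u _ IH']; first exact: s0.
  by apply: le_trans (s0 q) _; exact: key.
rewrite ep /f_degree /= -/(f_pos k) f_posE.
apply: (span_image (br_linr _) (IH sbN)) => z.
rewrite (lin_sum (br_linl z)) => hz; apply: span_sum => l _.
rewrite (linZ (br_linl z)); apply: spanZ; case: hz => [mz|[-> ->]].
  apply: span_in; left; rewrite -w_degree0.
  exact: (lie_monoS (mk_letter nN l (ltn0Sn n)) mz).
rewrite (root_space_skew (v_pos_root l) f_m1_root) addrC -w_degree0 -w_degreeS.
apply: spanZ; apply: span_sub (w_elt_mono l 1 nN) => t; by left.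
Qed.

Lemma letters_span a m n x : II_degree a = (- m%:Z, - n%:Z) -> (0 < m)%N -> (0 < n)%N ->
  (m + n <= N)%N -> hom a x -> lin_span (w_mono a) x.
Proof.
move=> ea m0 n0 mnN hx; have [e1 e2] : II_first a = - m%:Z /\ II_second a = - n%:Z.
  by rewrite /II_first /II_second ea.
have l1 : II_first a < 0 by rewrite e1; lia.
have lU i : 0 <= II_first << i >> by rewrite II_firstU.
apply: span_bind (negative_span II_firstD lU l1 hx) _ => z mz.
apply: span_sub (f_mono_span mz _) => [t [//|[ea' _]]|]; last by rewrite e1 e2; lia.
by move: e2; rewrite ea' II_secondN II_secondU /=; lia.
Qed.

End Letters.

(** * A homogeneous basis of the algebra generated by the letters *)

Section Content.
Variables (R : realType) (f : int -> int).
Variable C : monster_idx -> monster_idx -> R[i].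
Hypothesis fm1 : f (-1) = 1.
Hypothesis hC : is_coloring f C.
Local Notation I := monster_idx.
Local Notation Q := {freeg monster_idx}.
Local Notation K := R[i].
Local Notation L := (monstrous f C).
Local Notation ch := (monster_charge f).
Local Notation cf := (coloring_form C).
Local Notation br := (@bracket R I monster_matrix ch C).
Local Notation hom := (@root_space R I monster_matrix ch C).
Local Notation alpha := (<< idx_m1 >> : Q).
Local Notation beta n := (<< idx_pos n >> : Q).
Let CC := coloringCC hC.

Variables ca cb : forall n, 'M[K]_(ch (idx_pos n)).
Hypothesis cab : forall n, ca n *m cb n = 1%:M.
Variable N : nat.

Local Notation X := (letters f N).
Local Notation elt := (letter_elt C fm1 cb (N := N)).
Local Notation ldeg := (letter_deg (f := f) (N := N)).
Local Notation G := {ffun X -> nat}.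

(** Degrees are refined from roots to multisets of letters: letters with the same root may carry
    different eigenvalues of a group element. *)
Definition unit_content (x : X) : G := [ffun y => (y == x) : nat].
Definition content_degree (g : G) : Q := \sum_x ldeg x *+ g x.
Definition letter_first (x : X) : nat := (tagged x).2.+1.
Definition letter_second (x : X) : nat := ((tag x).+1 - (tagged x).2)%N.
Definition content_first (g : G) : nat := (\sum_x g x * letter_first x)%N.
Definition content_second (g : G) : nat := (\sum_x g x * letter_second x)%N.
Local Notation qdeg := content_degree.
Local Notation mono := (lie_mono br elt unit_content).

Lemma content_degreeD g h : qdeg (g + h) = qdeg g + qdeg h.
Proof. by rewrite -big_split; apply: eq_bigr => x _; rewrite ffunE mulrnDr. Qed.

Lemma sum_unit_content (A : nmodType) (F : X -> A) x : \sum_y F y *+ unit_content x y = F x.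
Proof.
rewrite (bigD1 x) //= ffunE eqxx big1 ?addr0 // => y /negPf yx.
by rewrite ffunE yx.
Qed.

Lemma content_degreeU x : qdeg (unit_content x) = ldeg x.
Proof. exact: sum_unit_content. Qed.

Lemma content_firstD g h : content_first (g + h) = (content_first g + content_first h)%N.
Proof. by rewrite -big_split; apply: eq_bigr => x _; rewrite ffunE mulnDl. Qed.

Lemma content_first0 : content_first 0 = 0%N.
Proof. by rewrite /content_first big1 // => x _; rewrite ffunE. Qed.

Lemma content_firstU x : content_first (unit_content x) = letter_first x.
Proof.
rewrite /content_first (bigD1 x) //= ffunE eqxx big1 ?addn0 ?mul1n // => y /negPf yx.
by rewrite ffunE yx.
Qed.

Lemma letter_secondE (x : X) : (0 < letter_second x)%N /\
  (letter_first x + letter_second x = (tag x).+2)%N.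
Proof. by rewrite /letter_first /letter_second; have := ltn_ord (tagged x).2; lia. Qed.

Lemma II_first_letter x : II_first (ldeg x) = - (letter_first x)%:Z.
Proof.
rewrite /letter_deg /w_degree II_firstN II_firstD II_firstMn !II_firstU /letter_first.
by rewrite -mulrS natz.
Qed.

Lemma II_second_letter x : II_second (ldeg x) = - (letter_second x)%:Z.
Proof.
rewrite /letter_deg /w_degree II_secondN II_secondD II_secondMn !II_secondU /letter_second /=.
have := ltn_ord (tagged x).2; rewrite mulNrn natz => jn.
by congr (- _); rewrite -subzn //; exact: ltnW.
Qed.

Lemma II_first_sum (J : Type) (r : seq J) (F : J -> Q) :
  II_first (\sum_(j <- r) F j) = \sum_(j <- r) II_first (F j).
Proof. by apply: (big_morph II_first II_firstD); rewrite -(mulr0n (0 : Q)) II_firstMn. Qed.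
Lemma II_second_sum (J : Type) (r : seq J) (F : J -> Q) :
  II_second (\sum_(j <- r) F j) = \sum_(j <- r) II_second (F j).
Proof. by apply: (big_morph II_second II_secondD); rewrite -(mulr0n (0 : Q)) II_secondMn. Qed.

Lemma content_II g : II_degree (qdeg g) = (- (content_first g)%:Z, - (content_second g)%:Z).
Proof.
rewrite II_degreeE /content_degree II_first_sum II_second_sum.
rewrite !(big_morph Posz PoszD erefl) -!sumrN; congr pair; apply: eq_bigr => x _.
  by rewrite II_firstMn II_first_letter -mulr_natl natz mulrN -PoszM.
by rewrite II_secondMn II_second_letter -mulr_natl natz mulrN -PoszM.
Qed.

Lemma elt_root x : hom (qdeg (unit_content x)) (elt x).
Proof. by rewrite content_degreeU; exact: letter_elt_root. Qed.

Lemma mono_lift a z : lie_mono br elt ldeg a z -> exists2 g, qdeg g = a & mono g z.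
Proof.
elim=> [x|x a' u _ [g <- mg]].
  by exists (unit_content x); [exact: content_degreeU | constructor].
by exists (unit_content x + g); rewrite ?content_degreeD ?content_degreeU //; constructor.
Qed.

(** The letters of the tensor algebra are indexed by plain natural numbers, so the matrices are
    extended by 0 outside their range. *)
Definition nat_matrix (A : forall n, 'M[K]_(ch (idx_pos n))) (n k l : nat) : K :=
  match insub k : option 'I_(ch (idx_pos n)), insub l : option 'I_(ch (idx_pos n)) with
  | Some k', Some l' => A n k' l' | _, _ => 0 end.

Lemma nat_matrixE A n (k l : 'I_(ch (idx_pos n))) : nat_matrix A n k l = A n k l.
Proof. by rewrite /nat_matrix !valK. Qed.

Lemma nat_matrix_mul n k k' : (k < ch (idx_pos n))%N -> (k' < ch (idx_pos n))%N ->
  \sum_(l < ch (idx_pos n)) nat_matrix ca n k l * nat_matrix cb n l k' = (k == k')%:R.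
Proof.
move=> hk hk'; have := cab n => /matrixP/(_ (Ordinal hk) (Ordinal hk')); rewrite !mxE => <-.
by apply: eq_bigr => l _; rewrite (nat_matrixE ca (Ordinal hk)) (nat_matrixE cb _ (Ordinal hk')).
Qed.

Local Notation M := {freeg (seq letter) / K}.
Let op := @word_op R f C (nat_matrix ca) (nat_matrix cb).
Let op_lin : forall g, linear (op g) := word_op_linear C (nat_matrix ca) (nat_matrix cb).
Let op_rel := word_op_rel fm1 hC nat_matrix_mul.
Local Notation rhoQ := (@rho R I monster_matrix ch C M op).

Lemma rho_f_m1 : rhoQ (- alpha) (f_m1 C fm1) = opF C.
Proof.
rewrite /f_m1 /f_elt /gen_elt (rho_class CC op_lin op_rel); apply/funext => u /=.
by rewrite eqxx.
Qed.

Lemma rho_v_pos n l : rhoQ (- beta n) (@v_pos R f C cb n l) = mul_letter (l : nat, 0, n).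
Proof.
have ca_cb : cb n *m ca n = 1%:M by apply: mulmx1C; exact: cab.
apply/funext => u; rewrite /v_pos (lin_sum (rho_linearl CC op_lin op_rel _ u)).
transitivity (\sum_l' (cb n *m ca n) l l' *: mul_letter (l' : nat, 0, n) u); last first.
  rewrite ca_cb (bigD1 l) //= mxE eqxx scale1r big1 ?addr0 // => l' nl.
  by rewrite mxE eq_sym (negPf nl) scale0r.
under [RHS]eq_bigr do rewrite mxE scaler_suml.
rewrite exchange_big; apply: eq_bigr => k _.
rewrite (linZ (rho_linearl CC op_lin op_rel _ u)).
rewrite /f_pos /f_elt /gen_elt (rho_class CC op_lin op_rel) /= eqxx /opFn scaler_sumr.
by apply: eq_bigr => l' _; rewrite nat_matrixE scalerA.
Qed.

Lemma rho_w_elt n l j u : (j <= n)%N -> rhoQ (w_degree n j) (@w_elt R f C fm1 cb n l j) u =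
  (n ^_ j)%:R *: mul_letter (l : nat, j, (n - j)%N) u.
Proof.
elim: j u => [|j IH] u jn; first by rewrite w_degree0 rho_v_pos ffactn0 scale1r subn0.
rewrite w_degreeS (rho_br CC op_lin op_rel); last exact: f_m1_root.
have jn' : (j <= n)%N by exact: ltnW.
rewrite -/(w_elt C fm1 cb l j) rho_f_m1.
have -> : rhoQ (w_degree n j) (w_elt C fm1 cb l j) =
    fun u => (n ^_ j)%:R *: mul_letter (l : nat, j, (n - j)%N) u.
  by apply/funext => v; exact: IH.
rewrite (colored_commZr _ _ _ _ _ (linear_opF C)).
have := congr1 (fun g => g u) (opF_comm C (l : nat, j, n - j)%N).
rewrite {1}/letter_degree /= subnKC // -/(w_degree n j) => ->.
by rewrite /phiF /lower_letter /= ffactnSr natrM -scalerA subnS.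
Qed.

Definition word_letter (x : X) : letter :=
  ((tagged x).1 : nat, (tagged x).2 : nat, (tag x - (tagged x).2)%N).

Lemma word_letter_inj : injective word_letter.
Proof.
move=> [n1 [l1 j1]] [n2 [l2 j2]] [el ej en].
have e : n1 = n2.
  apply: ord_inj; have := ltn_ord j1; have := ltn_ord j2.
  by rewrite /= in el ej en *; lia.
case: _ / e l2 j2 el ej en => l2 j2 /= /ord_inj -> /ord_inj -> _.
by [].
Qed.

Local Notation rhoG := (fun (g : G) (x : L) => rhoQ (qdeg g) x).

(** A letter acts as left multiplication up to a falling factorial that is nonzero because j <= n.
    Distinct words in the letters thus reach distinct basis words from the empty word. *)
Lemma act_word_basis (s : seq X) : exists2 k : K, k != 0 &
  act_word rhoG elt unit_content s << [::] >> = k *: (<< map word_letter s >> : M).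
Proof.
elim: s => [|x s [k k0 IH]]; first by exists 1; rewrite ?oner_neq0 ?scale1r.
have jn : ((tagged x).2 <= tag x)%N by rewrite -ltnS; exact: ltn_ord.
exists (((tag x) ^_ (tagged x).2)%:R * k).
  by rewrite mulf_neq0 // pnatr_eq0 -lt0n ffact_gt0.
rewrite /act_word /= -/(act_word rhoG elt unit_content s _) IH content_degreeU.
rewrite /letter_elt /letter_deg rho_w_elt //.
by rewrite (linZ (mul_letter_linear _)) mul_letterU scalerA.
Qed.

Lemma letters_free : indep (fun p : seq X * unit =>
  act_word rhoG elt unit_content p.1 (<< [::] >> : M)).
Proof.
move=> s k us e [w []] ws; have [c c0 ec] := act_word_basis w.
have := congr1 (coeff (map word_letter w)) e; rewrite coeff0 (big_morph _ (coeffD _) (coeff0 _ _)).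
rewrite (bigD1_seq _ ws us) /= big1 ?addr0 => [|[w' []] nw].
  rewrite ec coeffZ coeffZ coeffU mul1r eqxx mulr1 => /eqP.
  by rewrite mulf_eq0 (negPf c0) orbF => /eqP.
have [c' _ ->] := act_word_basis w'.
rewrite coeffZ coeffZ coeffU mul1r; case: eqP => [ew|_]; last by rewrite !mulr0.
by case/eqP: nw; rewrite (inj_map word_letter_inj ew).
Qed.

Definition basis_elt (J : Type) (z : J -> L) (d : J * bool) : L :=
  if d.2 then br (z d.1) (z d.1) else z d.1.
Definition basis_content (J : Type) (b : J -> G) (d : J * bool) : G :=
  if d.2 then b d.1 + b d.1 else b d.1.
Definition basis_valid (J : Type) (b : J -> G) (d : J * bool) : bool :=
  d.2 ==> (parity_sign C (qdeg (b d.1)) == -1).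

(** The outcome of elimination in terms of the algebra itself: independence concerns elements rather
    than operators. The bound N restricts the first coordinate, which is the exponent of the outer
    polynomial variable. *)
Record free_basis (J : finType) (z : J -> L) (b : J -> G) : Prop := {
  free_basis_first : forall j, (0 < content_first (b j))%N;
  free_basis_in : forall d, lin_span (mono (basis_content b d)) (basis_elt z d);
  free_basis_span : forall g x, mono g x -> (content_first g <= N)%N ->
    lin_span (fun t => exists2 d, basis_valid b d /\ basis_content b d = g & t = basis_elt z d) x;
  free_basis_indep : forall (s : seq (J * bool)) (k : J * bool -> K), uniq s ->
    all (basis_valid b) s -> \sum_(d <- s) k d *: basis_elt z d = 0 ->
    forall d, d \in s -> k d = 0;
  free_basis_weight : forall (A : comNzRingType) (w : G -> A),
    (forall a b, w (a + b) = w a * w b) ->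
    logderiv N (\sum_x w (unit_content x) *: 'X^(letter_first x))
      (\sum_j log_monomial N (content_first (b j)) (w (b j)))
}.

Let linl := @br_linl R I monster_matrix ch C.
Let linr := @br_linr R I monster_matrix ch C.
Let homG (g : G) (x : L) := hom (qdeg g) x.
Let thetaG (a b : G) := cf (qdeg a) (qdeg b).

Let homG_br a b x y : homG a x -> homG b y -> homG (a + b) (br x y).
Proof. by rewrite /homG content_degreeD; exact: root_space_br. Qed.

Lemma mono_hom g x : mono g x -> hom (qdeg g) x.
Proof. exact: (lie_mono_hom homG_br elt_root). Qed.

Lemma mono_br g h x u : lin_span (mono g) x -> lin_span (mono h) u ->
  lin_span (mono (g + h)) (br x u).
Proof.
have h4 (a b : G) u1 v1 w1 : homG a u1 -> homG b v1 ->
    br u1 (br v1 w1) = br (br u1 v1) w1 + thetaG a b *: br v1 (br u1 w1).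
  by exact: root_space_jacobi.
exact: (@lie_span_br K L G br homG thetaG linl linr homG_br h4 X elt unit_content elt_root).
Qed.

Theorem free_basis_exists : exists (J : finType) (z : J -> L) (b : J -> G), free_basis z b.
Proof.
have h1 (x y w : G) : thetaG (x + y) w = thetaG x w * thetaG y w.
  by rewrite /thetaG content_degreeD (coloring_formDl CC).
have h2 (x y : G) : thetaG x y * thetaG y x = 1 by exact: (coloring_form_skew CC).
have h3 (x y : G) u v : homG x u -> homG y v -> br u v = - thetaG x y *: br v u.
  by exact: root_space_skew.
have h4 (x y : G) u v w : homG x u -> homG y v ->
    br u (br v w) = br (br u v) w + thetaG x y *: br v (br u w).
  by exact: root_space_jacobi.
have h5 (x : G) y : linear (rhoG x y) by exact: rho_linear.
have h6 (x y : G) u v w : homG x u ->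
    rhoG (x + y) (br u v) w = rhoG x u (rhoG y v w) - thetaG x y *: rhoG y v (rhoG x u w).
  by move=> hu; rewrite content_degreeD (rho_br CC op_lin op_rel).
have h7 x : (1 <= content_first (unit_content x))%N by rewrite content_firstU.
have h8 := @elim_basis_exists K L M G br homG thetaG linr homG_br h1 h2 h3 h4 content_first
  content_firstD content_first0.
have h9 := h8 rhoG h5 h6 N 1%N X elt unit_content isT elt_root h7.
have [J [z [b [ed ei es ev ew]]]] := h9; clear h1 h2 h3 h4 h5 h6 h7 h8 h9.
exists J, z, b; split.
- exact: ed.
- case=> j [|]; rewrite /basis_content /basis_elt /=; last exact: ei.
  exact: mono_br.
- move=> g x mx gN; apply: span_sub (es _ _ mx gN) => t [[j bj ->]|[j [bj odd] ->]].
    by exists (j, false).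
  by exists (j, true) => //; split=> //; apply/eqP.
- move=> s k us vs e d ds.
  have iv := ev _ (fun _ : unit => << [::] >> : M) letters_free.
  have zh j : hom (qdeg (b j)) (z j).
    by apply: root_space_span (ei j) => y; exact: mono_hom.
  have eh d' : hom (qdeg (basis_content b d')) (basis_elt z d').
    case: d' => j [|]; rewrite /basis_content /basis_elt //= content_degreeD.
    exact: root_space_br.
  (* Letting the relation act through its component of the root of d discards the terms with other
     roots; what remains is a relation among operators. *)
  pose a := qdeg (basis_content b d); pose s' := [seq d' <- s | qdeg (basis_content b d') == a].
  (* For odd z the commutator [z, z] acts as 2 z^2, so coefficients of squares are rescaled by 2. *)
  pose two (d : J * bool) : K := if d.2 then 2 else 1.
  have two0 d' : two d' != 0 by rewrite /two; case: ifP; rewrite ?oner_neq0 ?pnatr_eq0.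
  have := congr1 (fun x => rhoQ a x (<< [::] >> : M)) e.
  rewrite (lin_sum (rho_linearl CC op_lin op_rel _ _)).
  rewrite (lin0 (rho_linearl CC op_lin op_rel _ _)).
  rewrite (bigID (fun d' => qdeg (basis_content b d') == a)) /=.
  rewrite [X in _ + X]big1 ?addr0; last first.
    move=> d' nd; rewrite (linZ (rho_linearl CC op_lin op_rel _ _)).
    by rewrite (rho_homog CC op_lin op_rel _ (eh d')) ?scaler0 // eq_sym.
  pose phi (d : J * bool) : option (J * bool) * unit := (Some d, tt).
  pose k' (p : option (J * bool) * unit) : K := if p.1 is Some d' then k d' * two d' else 0.
  rewrite -big_filter -/s' => e'.
  have ds' : phi d \in map phi s' by rewrite map_f // mem_filter eqxx.
  suff : k' (phi d) = 0.
    by move=> /eqP; rewrite /k' /= mulf_eq0 (negPf (two0 d)) orbF => /eqP.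
  apply: (iv (map phi s') k') ds'.
    by rewrite map_inj_uniq ?filter_uniq // => x y [].
  rewrite big_map -[RHS]e' !big_seq; apply: eq_bigr => -[j sq] /=.
  rewrite mem_filter => /andP[/eqP ea js]; rewrite -ea.
  rewrite (linZ (rho_linearl CC op_lin op_rel _ _)) /k' /= -scalerA; congr (_ *: _).
  rewrite /basis_content /basis_elt /two; case: sq ea js => /= ea js; last by rewrite scale1r.
  rewrite content_degreeD (rho_br CC op_lin op_rel) // /colored_comm.
  have : basis_valid b (j, true) := allP vs _ js.
  rewrite /basis_valid /= /parity_sign => /eqP ->.
  by rewrite scaleN1r opprK -mulr2n -[RHS]scaler_nat.
- by move=> A w wM; have := ew A w wM; rewrite /weight_poly;
    under eq_bigr do rewrite content_firstU.
Qed.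

End Content.

(** * Supertraces of triangular actions *)

Section Trace.
Variables (K : fieldType) (V : lmodType K).
Implicit Types (W : set V) (phi : V -> V).

Lemma is_basis_coord W n (b : 'I_n -> V) p (x : 'I_p -> V) :
  is_basis W b -> (forall j, W (x j)) ->
  exists M : 'M[K]_(n, p), forall j, x j = \sum_i M i j *: b i.
Proof.
case=> _ bW xW; have h j : exists c : 'rV[K]_n, x j = \sum_i c 0 i *: b i.
  by have [c [e _]] := bW _ (xW j); exists c.
have [c hc] := choice h; exists (\matrix_(i, j) c j 0 i) => j.
by rewrite hc; apply: eq_bigr => i _; rewrite mxE.
Qed.

Lemma is_basis_inj W n (b : 'I_n -> V) p (M M' : 'M[K]_(n, p)) : is_basis W b ->
  (forall j, \sum_i M i j *: b i = \sum_i M' i j *: b i) -> M = M'.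
Proof.
case=> bW hW e; apply/matrixP => i j; have [c [_ cu]] := hW _ (bW i).
have e1 : c = delta_mx 0 i.
  apply: cu; rewrite (bigD1 i) //= mxE !eqxx scale1r big1 ?addr0 // => k /negPf ki.
  by rewrite mxE ki scale0r.
have : c = \row_k ((k == i)%:R + (M k j - M' k j)).
  apply: cu; under eq_bigr do rewrite mxE scalerDl scalerBl.
  rewrite big_split sumrB /= e subrr addr0 (bigD1 i) //= eqxx scale1r big1 ?addr0 //.
  by move=> k /negPf ->; rewrite scale0r.
rewrite e1 => /rowP/(_ i); rewrite !mxE !eqxx -[LHS]addr0 => /addrI /esym/eqP.
by rewrite subr_eq0 => /eqP.
Qed.

Lemma comb_mulmx n p q (b : 'I_n -> V) (x : 'I_p -> V) (P : 'M[K]_(n, p)) (Q : 'M[K]_(p, q)) :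
  (forall j, x j = \sum_i P i j *: b i) ->
  forall j, \sum_i Q i j *: x i = \sum_i (P *m Q) i j *: b i.
Proof.
move=> e j; under eq_bigr do rewrite e scaler_sumr.
rewrite exchange_big; apply: eq_bigr => i _; rewrite mxE scaler_suml.
by apply: eq_bigr => k _; rewrite scalerA mulrC.
Qed.

(** The two transition matrices are inverse to each other although their sizes are not assumed
    equal, and the trace is cyclic. This makes the choice in [trace_on] unambiguous. *)
Lemma trace_basis_change W phi n (b : 'I_n -> V) (M : 'M[K]_n) n' (b' : 'I_n' -> V) (M' : 'M[K]_n') :
  linear phi -> is_basis W b -> (forall j, phi (b j) = \sum_i M i j *: b i) ->
  is_basis W b' -> (forall j, phi (b' j) = \sum_i M' i j *: b' i) -> \tr M = \tr M'.
Proof.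
move=> lphi hb eM hb' eM'.
have [P eP] := is_basis_coord hb (proj1 hb'); have [P' eP'] := is_basis_coord hb' (proj1 hb).
have idE p (x : 'I_p -> V) j : \sum_i (1%:M : 'M[K]_p) i j *: x i = x j.
  rewrite (bigD1 j) //= mxE eqxx scale1r big1 ?addr0 // => i /negPf ij.
  by rewrite mxE ij scale0r.
have PP' : P *m P' = 1%:M.
  by apply: (is_basis_inj hb) => j; rewrite -(comb_mulmx _ eP) -eP' idE.
have P'P : P' *m P = 1%:M.
  by apply: (is_basis_inj hb') => j; rewrite -(comb_mulmx _ eP') -eP idE.
have PM : M *m P = P *m M'.
  apply: (is_basis_inj hb) => j; rewrite -(comb_mulmx _ eM) -(comb_mulmx _ eP) -eM'.
  by rewrite eP (lin_sum lphi); apply: eq_bigr => i _; rewrite (linZ lphi).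
have -> : M' = P' *m M *m P by rewrite -mulmxA PM mulmxA P'P mul1mx.
by rewrite mxtrace_mulC mulmxA PP' mul1mx.
Qed.

Lemma trace_onE W phi n (b : 'I_n -> V) (M : 'M[K]_n) : linear phi ->
  is_basis W b -> (forall j, phi (b j) = \sum_i M i j *: b i) -> trace_on W phi = \tr M.
Proof.
move=> lphi hb eM; apply: xget_unique; first by exists n, b, M.
by move=> _ [n' [b' [M' [hb' eM' ->]]]]; exact: (trace_basis_change lphi hb' eM' hb eM).
Qed.

Section Triangular.
Variables (J : finType) (P : pred J) (z : J -> V) (W : set V).
Hypothesis zW : forall j, P j -> W (z j).
Hypothesis Wz : forall x, W x -> lin_span (fun y => exists2 j, P j & y = z j) x.
Hypothesis z_indep : forall (s : seq J) (k : J -> K), uniq s -> all P s ->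
  \sum_(j <- s) k j *: z j = 0 -> forall j, j \in s -> k j = 0.

Lemma span_finite (S : pred J) x : lin_span (fun y => exists2 j, S j & y = z j) x ->
  exists2 c : J -> K, (forall j, ~~ S j -> c j = 0) & x = \sum_j c j *: z j.
Proof.
elim=> [|k _ u [j Sj ->] _ [c c0 ->]].
  by exists (fun=> 0) => //; rewrite big1 // => j _; rewrite scale0r.
exists (fun i => (i == j)%:R * k + c i) => [i Si|].
  rewrite c0 //; case: eqP => [ij|]; last by rewrite mul0r addr0.
  by rewrite ij Sj in Si.
under [RHS]eq_bigr do rewrite scalerDl; rewrite big_split /=; congr (_ + _).
rewrite (bigD1 j) //= eqxx mul1r big1 ?addr0 // => i /negPf ->.
by rewrite mul0r scale0r.
Qed.

Lemma sum_support (c : J -> K) : (forall j, ~~ P j -> c j = 0) ->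
  \sum_j c j *: z j = \sum_(i < #|P|) c (enum_val i) *: z (enum_val i).
Proof.
move=> c0; rewrite -(big_enum_val (A := P) (fun j => c j *: z j)) [LHS](bigID P) /= [X in _ + X]big1 ?addr0 // => j Pj.
by rewrite c0 ?scale0r.
Qed.

Lemma triangular_basis : is_basis W (fun i : 'I_#|P| => z (enum_val i)).
Proof.
split=> [i|x Wx]; first by apply: zW; exact: enum_valP.
have [c c0 ->] := span_finite (Wz Wx); exists (\row_i c (enum_val i)); split.
  by rewrite sum_support //; apply: eq_bigr => i _; rewrite mxE.
move=> c' e; apply/rowP => i; rewrite mxE; apply/eqP; rewrite -subr_eq0; apply/eqP.
have Pi := enum_valP i.
pose k j := c j - c' 0 (enum_rank_in Pi j).
have ki i' : k (enum_val i') = c (enum_val i') - c' 0 i' by rewrite /k enum_valK_in.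
rewrite -ki; apply: (z_indep (s := enum P) (k := k)); rewrite ?enum_uniq ?mem_enum //.
  by apply/allP => j; rewrite mem_enum.
rewrite big_enum big_enum_val; under eq_bigr do rewrite ki scalerBl.
by rewrite sumrB -e sum_support ?subrr.
Qed.

(** No order on J is needed: the trace sees only the coefficient of z_j in [phi (z j)], so the
    remainder may involve any other basis element. *)
Lemma trace_on_triangular phi (lam : J -> K) : linear phi ->
  (forall j, P j -> lin_span (fun y => exists2 i, P i && (i != j) & y = z i)
     (phi (z j) - lam j *: z j)) ->
  trace_on W phi = \sum_(j | P j) lam j.
Proof.
move=> lphi tri.
have h (j : 'I_#|P|) : exists c : J -> K, [/\ forall i, ~~ P i -> c i = 0,
    c (enum_val j) = lam (enum_val j) & phi (z (enum_val j)) = \sum_i c i *: z i].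
  have Pj := enum_valP j; have [c c0 e] := span_finite (tri _ Pj).
  exists (fun i => (i == enum_val j)%:R * lam i + c i); split=> [i Pi||].
  - rewrite c0 ?(negPf Pi) // addr0; case: eqP => [ij|]; last by rewrite mul0r.
    by move: Pi; rewrite ij => /negP; case; exact: Pj.
  - by rewrite eqxx mul1r c0 ?addr0 // eqxx andbF.
  - under eq_bigr do rewrite scalerDl; rewrite big_split -e /= (bigD1 (enum_val j)) //=.
    rewrite eqxx mul1r big1 ?addr0 => [|i /negPf ->]; last by rewrite mul0r scale0r.
    by rewrite addrC subrK.
have [c hc] := choice h.
rewrite (trace_onE (M := \matrix_(i, j) c j (enum_val i)) lphi triangular_basis).
  rewrite [RHS]big_enum_val; apply: eq_bigr => i _; rewrite mxE.
  by have [] := hc i.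
move=> j; have [c0 _ ->] := hc j; rewrite sum_support //.
by apply: eq_bigr => i _; rewrite mxE.
Qed.

End Triangular.

End Trace.

(** * Triangular action of a group element on the basis *)

Section Action.
Variables (R : realType) (f : int -> int).
Variable C : monster_idx -> monster_idx -> R[i].
Hypothesis fm1 : f (-1) = 1.
Hypothesis hC : is_coloring f C.
Local Notation I := monster_idx.
Local Notation Q := {freeg monster_idx}.
Local Notation K := R[i].
Local Notation L := (monstrous f C).
Local Notation ch := (monster_charge f).
Local Notation cf := (coloring_form C).
Local Notation br := (@bracket R I monster_matrix ch C).
Local Notation hom := (@root_space R I monster_matrix ch C).
Local Notation part := (@graded_part R I monster_matrix ch C).
Let CC := coloringCC hC.

Lemma graded_part_in (P : set Q) a (x : L) : P a -> hom a x -> part P x.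
Proof.
move=> Pa hx; exists 1%N, (fun=> 1), (fun=> x); split; first by move=> _; exists a.
by rewrite big_ord1 scale1r.
Qed.

Lemma graded_part_span (P : set Q) (x : L) : part P x ->
  lin_span (fun y => exists2 a, P a & hom a y) x.
Proof.
by case=> n [c [v [hv ->]]]; apply: span_sum => i _; apply/spanZ/span_in; exact: hv.
Qed.

Lemma root_space_neg a (x : L) : II_first a < 0 -> hom a x -> @L_neg R f C x.
Proof. exact: graded_part_in. Qed.

Variable phi : L -> L.
Hypothesis phi_linear : linear phi.
Hypothesis phi_graded : forall m n x, L_ m n x -> L_ m n (phi x).
Hypothesis phi_neg : super_morphism_on (@L_neg R f C) phi.
Hypothesis phi_f : forall k : 'I_(ch idx_m1), phi (monster_f C k) = monster_f C k.

Lemma phi_br (x y : L) : L_neg x -> L_neg y -> phi (br x y) = br (phi x) (phi y).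
Proof. by case: phi_neg => h _ _; exact: h. Qed.

Lemma phi_f_m1 : phi (f_m1 C fm1) = f_m1 C fm1.
Proof. exact: phi_f. Qed.

Lemma f_mono_first g x : lie_mono br (@f_elt R I monster_matrix ch C) (@f_degree I ch) g x ->
  II_first g <= -1.
Proof.
by elim=> [p|p h u _ IH]; rewrite ?II_firstD /f_degree II_firstN II_firstU //; lia.
Qed.

(** In the root (-1, -(n+1)) an f-monomial has a single factor, because each factor contributes -1
    to the first coordinate; so the span of the f_{n,k} is preserved. *)
Lemma phi_f_pos n (k : 'I_(ch (idx_pos n))) :
  lin_span (fun y => exists2 k' : 'I_(ch (idx_pos n)), xpredT k' & y = f_pos C k') (phi (f_pos C k)).
Proof.
have h : L_ (-1) (- n.+1%:Z) (f_pos C k).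
  apply: graded_part_in (f_pos_root _ k).
  by rewrite /= II_degreeE II_firstN II_secondN II_firstU II_secondU.
apply: span_bind (graded_part_span (phi_graded h)) _ => y [a ea hy].
have [e1 e2] : II_first a = -1 /\ II_second a = - n.+1%:Z by rewrite /II_first /II_second ea.
have l1 : II_first a < 0 by rewrite e1.
have lU i : 0 <= II_first << i >> by rewrite II_firstU.
apply: span_bind (negative_span II_firstD lU l1 hy) _ => t mt.
case: mt e1 e2 => [[i k']|p g u mu] e1 e2.
  move: e2; rewrite /f_degree II_secondN II_secondU /= => /oppr_inj ei.
  have {}ei : i = idx_pos n by apply: val_inj.
  by clear e1; case: _ / (esym ei) k' => k'; apply: span_in; exists k'.
by have := f_mono_first mu; move: e1; rewrite II_firstD /f_degree II_firstN II_firstU; lia.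
Qed.

Lemma phi_f_matrix n : exists A : 'M[K]_(ch (idx_pos n)),
  forall k, phi (f_pos C k) = \sum_k' A k k' *: f_pos C k'.
Proof.
have h (k : 'I_(ch (idx_pos n))) : exists c : 'I_(ch (idx_pos n)) -> K,
    phi (f_pos C k) = \sum_k' c k' *: f_pos C k'.
  by have [c _ e] := span_finite (phi_f_pos k); exists c.
have [c hc] := choice h.
exists (\matrix_(k, k') c k k') => k; rewrite hc.
by apply: eq_bigr => k' _; rewrite mxE.
Qed.

Lemma schur_form m (A : 'M[K]_m) : exists S : 'M[K]_m * 'M[K]_m * 'M[K]_m,
  [/\ S.1.1 *m S.1.2 = 1%:M, S.1.2 *m A = S.2 *m S.1.2
    & forall i j : 'I_m, (i < j)%N -> S.2 i j = 0].
Proof.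
(* The theorem of Schur is applied in positive size; size 0 occurs when f vanishes at an index. *)
case: m A => [|m] A; first by exists (0, 0, 0); split; [apply/matrixP => -[]|apply/matrixP => -[]|case].
have [P uP /is_trig_mxP tP] := Schur A (ltn0Sn m).
have iP : P \in unitmx by exact: unitarymx_unit.
exists (invmx P, P, conjmx P A); split=> //=; first by rewrite mulVmx.
by rewrite conjumx // mulmxKV.
Qed.

Lemma triangular_generators : exists (ca cb T : forall n, 'M[K]_(ch (idx_pos n))),
  [/\ forall n, ca n *m cb n = 1%:M,
      forall n l, phi (@v_pos R f C cb n l) = \sum_l' T n l l' *: v_pos C cb l'
    & forall n (l l' : 'I_(ch (idx_pos n))), (l < l')%N -> T n l l' = 0].
Proof.
pose A n := sval (cid (phi_f_matrix n)).
have hA n : forall k, phi (f_pos C k) = \sum_k' A n k k' *: f_pos C k'.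
  exact: (svalP (cid (phi_f_matrix n))).
pose S n := sval (cid (schur_form (A n))).
have hS n := svalP (cid (schur_form (A n))).
exists (fun n => (S n).1.1), (fun n => (S n).1.2), (fun n => (S n).2); split.
- by move=> n; case: (hS n).
- move=> n l; rewrite /v_pos (lin_sum phi_linear).
  transitivity (\sum_k ((S n).1.2 *m A n) l k *: f_pos C k).
    under eq_bigr do rewrite (linZ phi_linear) hA scaler_sumr.
    rewrite exchange_big; apply: eq_bigr => k _; rewrite mxE scaler_suml.
    by apply: eq_bigr => k' _; rewrite scalerA.
  have [_ -> _] := hS n.
  under [RHS]eq_bigr do rewrite scaler_sumr.
  rewrite [RHS]exchange_big; apply: eq_bigr => k _; rewrite mxE scaler_suml.
  by apply: eq_bigr => k' _; rewrite scalerA.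
- by move=> n l l'; case: (hS n) => _ _; apply.
Qed.

Section Triangular.
Variables ca cb T : forall n, 'M[K]_(ch (idx_pos n)).
Hypothesis cab : forall n, ca n *m cb n = 1%:M.
Hypothesis phi_v : forall n l, phi (@v_pos R f C cb n l) = \sum_l' T n l l' *: v_pos C cb l'.
Hypothesis T_trig : forall n (l l' : 'I_(ch (idx_pos n))), (l < l')%N -> T n l l' = 0.
Variable N : nat.
Local Notation X := (letters f N).
Local Notation elt := (letter_elt C fm1 cb (N := N)).
Local Notation ldeg := (letter_deg (f := f) (N := N)).
Local Notation G := {ffun X -> nat}.
Local Notation qdeg := (@content_degree f N).
Local Notation mono := (lie_mono br elt (@unit_content f N)).

Lemma w_degree_first n j : II_first (w_degree n j) = - j.+1%:Z.
Proof.
by rewrite /w_degree II_firstN II_firstD II_firstMn !II_firstU -mulrS natz.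
Qed.

Lemma phi_w n l j : phi (@w_elt R f C fm1 cb n l j) = \sum_l' T n l l' *: w_elt C fm1 cb l' j.
Proof.
elim: j => [|j IH]; first exact: phi_v.
rewrite /w_elt /= phi_br; first last.
- by apply: root_space_neg (w_elt_root C fm1 cb l j); rewrite w_degree_first.
- by apply: root_space_neg (f_m1_root C fm1); rewrite II_firstN II_firstU.
rewrite phi_f_m1 -/(w_elt C fm1 cb l j) IH (lin_sum (br_linr _)).
by apply: eq_bigr => l' _; rewrite (linZ (br_linr _)).
Qed.

Definition letter_height (x : X) : nat := (tagged x).1.
Definition letter_eigen (x : X) : K := T (tag x) (tagged x).1 (tagged x).1.
(** The matrix of g sends v_l to a combination of v_{l'} with l' <= l, so the total of the indices l
    does not increase; it measures triangularity, while the product of the diagonal entries is the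
    eigenvalue. *)
Definition height (g : G) : nat := (\sum_x g x * letter_height x)%N.
Definition eigen (g : G) : K := \prod_x letter_eigen x ^+ g x.

Lemma heightD g h : height (g + h) = (height g + height h)%N.
Proof. by rewrite -big_split; apply: eq_bigr => x _; rewrite ffunE mulnDl. Qed.
Lemma eigenD g h : eigen (g + h) = eigen g * eigen h.
Proof. by rewrite -big_split; apply: eq_bigr => x _; rewrite ffunE exprD. Qed.

Lemma heightU x : height (unit_content x) = letter_height x.
Proof.
rewrite /height (bigD1 x) //= ffunE eqxx big1 ?addn0 ?mul1n // => y /negPf yx.
by rewrite ffunE yx.
Qed.
Lemma eigenU x : eigen (unit_content x) = letter_eigen x.
Proof.
rewrite /eigen (bigD1 x) //= ffunE eqxx big1 ?mulr1 ?expr1 // => y /negPf yx.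
by rewrite ffunE yx.
Qed.

Definition lower_mono (g : G) (t : L) := exists h, [/\ mono h t, qdeg h = qdeg g & (height h < height g)%N].

Lemma mono_first g x : mono g x -> (0 < content_first g)%N.
Proof.
by elim=> [y|y h u _ IH]; rewrite ?content_firstD content_firstU // addn_gt0 IH orbT.
Qed.

Lemma mono_neg g x : mono g x -> L_neg x.
Proof.
move=> mx; apply: root_space_neg (mono_hom mx).
by rewrite /II_first content_II /= oppr_lt0 ltz_nat; exact: mono_first mx.
Qed.

(** By induction from [phi w, phi u] - a b [w, u] = [phi w - a w, phi u] + a [w, phi u - b u]: both
    terms on the right have the same root and strictly smaller height. *)
Lemma phi_mono g x : mono g x -> lin_span (lower_mono g) (phi x - eigen g *: x).
Proof.
have letter y : lin_span (lower_mono (unit_content y)) (phi (elt y) - letter_eigen y *: elt y).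
  rewrite /letter_elt phi_w (bigD1 (tagged y).1) //= -/(letter_eigen y) addrAC subrr add0r.
  apply: span_sum => l' nl; case: (ltngtP (tagged y).1 l') => h.
  - by rewrite T_trig // scale0r; exact: span0.
  - have [y' [<- qy hy]] : exists y' : X, [/\ elt y' = w_elt C fm1 cb l' (tagged y).2,
        ldeg y' = ldeg y & letter_height y' = l'].
      by exists (Tagged (fun n : 'I_N => ('I_(ch (idx_pos n)) * 'I_n.+1)%type) (l', (tagged y).2)).
    apply/spanZ/span_in; exists (unit_content y'); split.
    + exact: lie_mono1.
    + exact: etrans (content_degreeU _) (etrans qy (esym (content_degreeU _))).
    + apply: leq_ltn_trans (eq_leq (heightU y')) (leq_trans _ (eq_leq (esym (heightU y)))).
      by rewrite hy.
  - by move: nl; rewrite (ord_inj h) eqxx.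
elim=> [y|y g' u mu IH]; first by rewrite eigenU.
rewrite phi_br; last exact: mono_neg mu; last exact: (mono_neg (lie_mono1 br elt (@unit_content f N) y)).
rewrite eigenD eigenU.
set w := elt y; set a := letter_eigen y; set b := eigen g'.
have e : br (phi w) (phi u) - (a * b) *: br w u =
    br (phi w - a *: w) (phi u) + a *: br w (phi u - b *: u).
  rewrite (linB (br_linl _)) (linB (br_linr _)) (linZ (br_linl _)) (linZ (br_linr _)).
  by rewrite scalerBr scalerA addrA subrK.
rewrite e; apply: spanD.
  have su : lin_span (fun t => exists h, [/\ mono h t, qdeg h = qdeg g' & (height h <= height g')%N])
      (phi u).
    rewrite -(subrK (b *: u) (phi u)); apply: spanD.
      by apply: span_sub IH => t [h [m1 q1 h1]]; exists h; split=> //; exact: ltnW.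
    by apply/spanZ/span_in; exists g'.
  apply: (span_image (br_linl (phi u))) (letter y) _ => t [h [mt qh hh]].
  apply: (span_image (br_linr t)) su _ => v [h' [mv qh' hh']].
  have := mono_br (span_in mt) (span_in mv); apply: span_sub => r mr.
  exists (h + h'); split=> //; first by rewrite !content_degreeD qh qh'.
  by rewrite !heightD -addSn leq_add.
apply: spanZ; apply: (span_image (br_linr w)) IH _ => t [h [mt qh hh]].
apply: span_in; exists (unit_content y + h); split.
- exact: lie_monoS.
- by rewrite !content_degreeD qh.
- by rewrite !heightD ltn_add2l.
Qed.

Variables (J : finType) (z : J -> L) (b : J -> G).
Hypothesis hB : free_basis fm1 cb z b.
Local Notation D := (J * bool)%type.
Local Notation bc := (basis_content b).
Local Notation be := (basis_elt z).
Local Notation valid := (basis_valid C b).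

Definition lower_basis a h (t : L) :=
  exists2 d : D, [&& valid d, qdeg (bc d) == a & (height (bc d) < h)%N] & t = be d.

Lemma content_first_eq (g h : G) : qdeg g = qdeg h -> content_first g = content_first h.
Proof. by move=> e; have := congr1 II_degree e; rewrite !content_II => -[/oppr_inj []]. Qed.
Lemma content_second_eq (g h : G) : qdeg g = qdeg h -> content_second g = content_second h.
Proof. by move=> e; have := congr1 II_degree e; rewrite !content_II => -[_ /oppr_inj []]. Qed.

Lemma linear_sub_scale k : linear (fun x : L => phi x - k *: x).
Proof.
move=> c x y; rewrite phi_linear !scalerDr scalerN !scalerA [c * k]mulrC opprD addrACA.
by [].
Qed.

Lemma phi_basis d : (content_first (bc d) <= N)%N ->
  lin_span (lower_basis (qdeg (bc d)) (height (bc d))) (phi (be d) - eigen (bc d) *: be d).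
Proof.
move=> dN; apply: (span_image (linear_sub_scale (eigen (bc d)))) (free_basis_in hB d) _ => x mx.
apply: span_bind (phi_mono mx) _ => t [h [mt qh hh]].
have hN : (content_first h <= N)%N by rewrite (content_first_eq qh).
apply: span_sub (free_basis_span hB mt hN) => r [d' [vd ed] ->]; exists d' => //.
by rewrite vd ed qh eqxx hh.
Qed.

Lemma phi_lower_basis a h t : lower_basis a h t -> 
  (forall g, qdeg g = a -> (content_first g <= N)%N) -> lin_span (lower_basis a h) (phi t).
Proof.
case=> d /and3P[vd /eqP qd hd] -> aN.
rewrite -(subrK (eigen (bc d) *: be d) (phi _)); apply: spanD.
  apply: span_sub (phi_basis (aN _ qd)) => r [d' /and3P[v' q' h'] ->].
  exists d' => //; rewrite v' -qd q' /=; exact: ltn_trans h' hd.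
by apply/spanZ/span_in; exists d => //; rewrite vd qd eqxx.
Qed.

Lemma iter_phi_basis k d : (content_first (bc d) <= N)%N ->
  lin_span (lower_basis (qdeg (bc d)) (height (bc d)))
    (iter k phi (be d) - eigen (bc d) ^+ k *: be d).
Proof.
move=> dN; elim: k => [|k IH]; first by rewrite scale1r subrr; exact: span0.
rewrite [iter k.+1 _ _]/= -(subrK (eigen (bc d) ^+ k *: be d) (iter k phi (be d))).
rewrite (linD phi_linear) (linZ phi_linear) -addrA; apply: spanD.
  apply: (span_image phi_linear IH) => t ht; apply: phi_lower_basis ht _ => g qg.
  by rewrite (content_first_eq qg).
rewrite exprSr -scalerA -scalerBr; apply: spanZ; exact: phi_basis.
Qed.

Lemma iter_linear k : linear (iter k phi).
Proof. by elim: k => [|k IH] c x y //=; rewrite IH phi_linear. Qed.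

Definition content_parity (g : G) : K := parity_sign C (qdeg g).

Lemma content_parity_sqr g : content_parity g = 1 \/ content_parity g = -1.
Proof.
have /eqP : content_parity g * content_parity g = 1 by exact: coloring_form_skew.
by rewrite -expr2 sqrf_eq1 => /orP[] /eqP; [left|right].
Qed.

Definition bidegree_is (m n : nat) (d : D) :=
  [&& valid d, content_first (bc d) == m & content_second (bc d) == n].

Lemma trace_iter k m n e : (0 < m)%N -> (0 < n)%N -> (m + n <= N)%N ->
  trace_on (part [set a | II_degree a = (- m%:Z, - n%:Z) /\ parity_sign C a = e])
    (iter k phi) =
  \sum_(d | bidegree_is m n d && (content_parity (bc d) == e)) eigen (bc d) ^+ k.
Proof.
move=> m0 n0 mnN; set W := part _.
have mN : (m <= N)%N by apply: leq_trans mnN; exact: leq_addr.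
have be_hom d : hom (qdeg (bc d)) (be d).
  by apply: root_space_span (free_basis_in hB d) => y; exact: mono_hom.
apply: (trace_on_triangular (z := be)).
- move=> d /andP[/and3P[vd /eqP fd /eqP sd] /eqP pd].
  by apply: graded_part_in (be_hom d); split=> //; rewrite content_II fd sd.
- move=> x /graded_part_span Wx; apply: span_bind Wx _ => y [a [ea pa] hy].
  have sy := letters_span fm1 hC cab ea m0 n0 mnN hy; apply: (span_bind sy) => t /mono_lift[g qg mt].
  have := ea; rewrite -qg content_II => -[/oppr_inj [fg] /oppr_inj [sg]].
  have gN : (content_first g <= N)%N by rewrite fg.
  apply: span_sub (free_basis_span hB mt gN) => r [d [vd ed] ->]; exists d => //.
  by rewrite /bidegree_is vd ed fg sg !eqxx /content_parity qg pa eqxx.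
- move=> s c us /allP sP e0 d ds; apply: (free_basis_indep hB us _ e0 ds).
  by apply/allP => d' /sP /andP[/and3P[]].
- exact: iter_linear.
- move=> d /andP[/and3P[vd /eqP fd /eqP sd] /eqP pd].
  have dN : (content_first (bc d) <= N)%N by rewrite fd.
  apply: span_sub (iter_phi_basis k dN) => t [d' /and3P[v' /eqP q' h'] ->]; exists d' => //.
  rewrite /bidegree_is v' (content_first_eq q') fd (content_second_eq q') sd !eqxx.
  rewrite /content_parity q' -pd eqxx /=.
  by apply: contraTneq h' => ->; rewrite ltnn.
Qed.

Lemma supertrace_iter k m n : (0 < m)%N -> (0 < n)%N -> (m + n <= N)%N ->
  supertrace (iter k phi) (- m%:Z) (- n%:Z) =
  \sum_(d | bidegree_is m n d) content_parity (bc d) * eigen (bc d) ^+ k.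
Proof.
move=> m0 n0 mnN; rewrite /supertrace !trace_iter //.
rewrite [RHS](bigID (fun d => content_parity (bc d) == 1)) /=; congr (_ + _).
  by apply: eq_bigr => d /andP[_ /eqP ->]; rewrite mul1r.
rewrite -sumrN; apply: eq_big => [d|d /andP[_ /eqP ->]]; last by rewrite mulN1r.
have n11 : (1 == -1 :> K) = false.
  by rewrite -subr_eq0 opprK -mulr2n pnatr_eq0.
by have [->|->] := content_parity_sqr (bc d); rewrite ?eqxx ?n11 // eq_sym n11.
Qed.

End Triangular.
End Action.

(** * From traces on root spaces to a logarithmic derivative *)

Lemma divn_divn m d : (0 < m)%N -> (d %| m)%N -> (m %/ (m %/ d) = d)%N.
Proof. by move=> m0 dm; rewrite divnA // mulKn. Qed.

(** Only k = m / s can satisfy s = m / k. *)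
Lemma sum_divisors_pick (K : nzRingType) (m n s t : nat) (g : nat -> K) :
  (0 < s)%N -> (0 < m)%N -> (0 < n)%N ->
  \sum_(k <- divisors (gcdn m n)) (if (s == m %/ k)%N && (t == n %/ k)%N then g k else 0) =
  if (s %| m)%N && (n == t * (m %/ s))%N then g (m %/ s)%N else 0.
Proof.
move=> s0 m0 n0; have g0 : (0 < gcdn m n)%N by rewrite gcdn_gt0 m0.
have dE k : k \in divisors (gcdn m n) -> [/\ (0 < k)%N, (k %| m)%N & (k %| n)%N].
  by rewrite -dvdn_divisors // dvdn_gcd => /andP[km kn]; rewrite (dvdn_gt0 m0 km).
case: ifP => [/andP[sm /eqP nt]|bad]; last first.
  rewrite big1_seq // => k /andP[_ /dE[k0 km kn]].
  case: ifP => // /andP[/eqP es /eqP et]; case/negP: (negbT bad).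
  rewrite es et divn_divn // divnK // eqxx andbT.
  by apply/dvdnP; exists k; rewrite mulnC divnK.
have q0 : (0 < m %/ s)%N by rewrite divn_gt0 // dvdn_leq.
have qD : (m %/ s)%N \in divisors (gcdn m n).
  rewrite -dvdn_divisors // dvdn_gcd; apply/andP; split; apply/dvdnP.
    by exists s; rewrite mulnC divnK.
  by exists t.
rewrite (bigD1_seq _ qD) ?divisors_uniq //= big1_seq ?addr0 => [|k /andP[nk /dE[k0 km kn]]].
  rewrite divn_divn // eqxx [in (n %/ _)%N]nt mulnK // eqxx //.
case: eqP => //= es; case/eqP: nk.
by rewrite es divn_divn.
Qed.

(** The joint contribution of z, of parity e and eigenvalue a, and of [z, z] when e = -1. With q = m
    / s it should be s (e a)^q. For e = -1 and q even, z gives -s a^q, and [z, z], of bidegree (2s,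
    2t), adds 2s a^q, which corrects the sign. *)
Lemma sum_divisors_orbit (K : fieldType) (m n s t : nat) (e a : K) :
  e = 1 \/ e = -1 -> (1 == -1 :> K) = false -> (0 < s)%N -> (0 < m)%N -> (0 < n)%N ->
  \sum_(k <- divisors (gcdn m n)) (m %/ k)%:R *
     ((if (s == m %/ k)%N && (t == n %/ k)%N then e * a ^+ k else 0)
      + (if [&& e == -1, (s + s == m %/ k)%N & (t + t == n %/ k)%N] then (a * a) ^+ k else 0)) =
  if (s %| m)%N && (n == t * (m %/ s))%N then s%:R * (e * a) ^+ (m %/ s) else 0.
Proof.
move=> he n11 s0 m0 n0.
transitivity (\sum_(k <- divisors (gcdn m n))
   (if (s == m %/ k)%N && (t == n %/ k)%N then s%:R * (e * a ^+ k) else 0)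
  + \sum_(k <- divisors (gcdn m n)) (if (s + s == m %/ k)%N && (t + t == n %/ k)%N
      then (e == -1)%:R * (2 * s%:R * (a * a) ^+ k) else 0)).
  rewrite -big_split; apply: eq_bigr => k _ /=; rewrite mulrDr; congr (_ + _).
    by case: ifP => [/andP[/eqP <-]|]; rewrite ?mulr0.
  case: (e == -1) => /=; last by rewrite mulr0 mul0r if_same.
  by case: ifP => [/andP[/eqP <- _]|]; rewrite ?mulr0 // mul1r natrD; ring.
rewrite !sum_divisors_pick ?addn_gt0 ?s0 //.
case: (boolP (s %| m)%N) => /= [/dvdnP[q em]|sm]; last first.
  rewrite ifN ?addr0 // negb_and; apply/orP; left; apply: contra sm.
  by apply: dvdn_trans; rewrite addnn -mul2n dvdn_mull.
have q0 : (0 < q)%N by move: m0; rewrite em muln_gt0 => /andP[].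
rewrite em addnn -mul2n dvdn_pmul2r // mulnK // divnMr //.
case: (boolP (2 %| q)%N) => [/dvdnP[r er]|oq] /=.
  have -> : ((t + t) * (q %/ 2) = t * q)%N by rewrite er mulnK //; lia.
  case: ifP => _; last by rewrite addr0.
  have -> : (a * a) ^+ (q %/ 2) = a ^+ q by rewrite {2}er mulnC exprM expr2 er mulnK.
  have -> : (e * a) ^+ q = a ^+ q.
    by rewrite er mulnC !exprM; congr (_ ^+ _); have [->|->] := he; rewrite ?mul1r ?mulN1r ?sqrrN.
  by have [->|->] := he; rewrite ?n11 ?eqxx /= ?mulr0n ?mulr1n; ring.
rewrite addr0; case: ifP => _ //.
rewrite exprMn; have [->|->] := he; first by rewrite expr1n.
rewrite -signr_odd; have -> : odd q by move: oq; rewrite dvdn2 negbK.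
by rewrite expr1.
Qed.

Section Weights.
Variables (R : realType) (f : int -> int).
Variable C : monster_idx -> monster_idx -> R[i].
Hypothesis fm1 : f (-1) = 1.
Hypothesis hC : is_coloring f C.
Local Notation K := R[i].
Local Notation ch := (monster_charge f).
Let CC := coloringCC hC.
Variable T : forall n, 'M[K]_(ch (idx_pos n)).
Variable N : nat.
Local Notation X := (letters f N).
Local Notation G := {ffun X -> nat}.

(** The parity enters as a sign, so that sums of weights are supertraces; the variable here records
    the second coordinate, the outer one the first. *)
Definition weight (g : G) : {poly K} :=
  (content_parity C g * eigen T g) *: 'X^(content_second g).

Lemma content_parityD g h : content_parity C (g + h : G) = content_parity C g * content_parity C h.
Proof. by rewrite /content_parity content_degreeD (parity_signD CC). Qed.

Lemma content_secondD g h : content_second (g + h : G) = (content_second g + content_second h)%N.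
Proof. by rewrite -big_split; apply: eq_bigr => x _; rewrite ffunE mulnDl. Qed.

Lemma content_secondU x : content_second (unit_content x : G) = letter_second x.
Proof.
rewrite /content_second (bigD1 x) //= ffunE eqxx big1 ?addn0 ?mul1n // => y /negPf yx.
by rewrite ffunE yx.
Qed.

Lemma weightD g h : weight (g + h) = weight g * weight h.
Proof.
rewrite /weight content_parityD eigenD content_secondD exprD.
by rewrite -!mul_polyC !polyCM [RHS]mulrACA (mulrACA _ _ (content_parity C h)%:P).
Qed.

Definition letter_poly : {poly {poly K}} :=
  \sum_x weight (unit_content x) *: 'X^(letter_first x).

Lemma letter_parity n j : parity_sign C (w_degree n j) = parity_sign C (- << idx_pos n >>).
Proof.
elim: j => [|j IH]; first by rewrite w_degree0.
rewrite w_degreeS (parity_signD CC) IH {1}/parity_sign.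
by rewrite (coloring_formNl CC) (coloring_formNl CC) (cf_alpha fm1 hC) mul1r.
Qed.

(** For n + 2 = a + b there is exactly one letter over each v_l of bidegree (a, b), the one with j =
    a - 1; so the coefficient depends only on a + b. *)
Lemma letter_poly_coef a b : (0 < a)%N -> (0 < b)%N ->
  (letter_poly`_a)`_b = \sum_(n < N) \sum_(l < ch (idx_pos n))
    if (n.+2 == a + b)%N then parity_sign C (- << idx_pos n >>) * T n l l else 0.
Proof.
move=> a0 b0; rewrite /letter_poly !coef_sum.
pose F (n : 'I_N) (p : 'I_(ch (idx_pos n)) * 'I_n.+1) : K :=
  if (p.2.+1 == a)%N && (n.+1 - p.2 == b)%N
  then parity_sign C (- << idx_pos n >>) * T n p.1 p.1 else 0.
transitivity (\sum_(x : X) F (tag x) (tagged x)).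
  apply: eq_bigr => x _; rewrite coefZ coefXn /weight /F.
  rewrite eigenU /content_parity content_degreeU /letter_deg letter_parity content_secondU.
  rewrite -/(letter_first x) -/(letter_second x) [a == _]eq_sym.
  case: eqP => _ /=; last by rewrite mulr0 coef0.
  by rewrite mulr1 coefZ coefXn [b == _]eq_sym; case: eqP => _; rewrite ?mulr1 ?mulr0.
rewrite -(@sig_big_dep _ _ _ _ (fun n : 'I_N => ('I_(ch (idx_pos n)) * 'I_n.+1)%type)
  xpredT (fun _ _ => true) F) /=.
apply: eq_bigr => n _.
rewrite -(pair_bigA _ (fun l j => F n (l, j))) /=; apply: eq_bigr => l _.
rewrite /F /=; case: eqP => e; last first.
  rewrite big1 // => j _; case: ifP => // /andP[/eqP e1 /eqP e2]; case: e.
  by have := ltn_ord j; lia.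
have h : (a.-1 < n.+1)%N by lia.
rewrite (bigD1 (Ordinal h)) //= prednK // eqxx /=.
have -> : (n.+1 - a.-1 == b)%N by lia.
rewrite big1 ?addr0 // => j nj; case: ifP => // /andP[/eqP e1 _].
by case/eqP: nj; apply: val_inj; rewrite /= -e1.
Qed.

Lemma letter_poly_coef_shift a b : (0 < a)%N -> (0 < b)%N ->
  (letter_poly`_a)`_b = (letter_poly`_1)`_(a + b).-1.
Proof.
move=> a0 b0; rewrite !letter_poly_coef // ?addnS; last by lia.
by rewrite add1n prednK // addn_gt0 a0.
Qed.

Lemma letter_poly_coef0 a : (letter_poly`_a)`_0 = 0.
Proof.
rewrite /letter_poly !coef_sum big1 // => x _; rewrite coefZ coefXn.
case: eqP => _; last by rewrite mulr0 coef0.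
rewrite mulr1 /weight coefZ coefXn content_secondU.
by have [] := letter_secondE fm1 x; case: (letter_second x) => // s _ _; rewrite mulr0.
Qed.

Lemma letter_poly0 : letter_poly`_0 = 0.
Proof.
by rewrite /letter_poly coef_sum big1 // => x _; rewrite coefZ coefXn /letter_first /= mulr0.
Qed.

End Weights.

Section LieTrace.
Variables (R : realType) (f : int -> int).
Variable C : monster_idx -> monster_idx -> R[i].
Hypothesis fm1 : f (-1) = 1.
Hypothesis hC : is_coloring f C.
Local Notation K := R[i].
Local Notation L := (monstrous f C).
Local Notation ch := (monster_charge f).
Variable phi : L -> L.
Hypothesis phi_linear : linear phi.
Hypothesis phi_graded : forall m n x, L_ m n x -> L_ m n (phi x).
Hypothesis phi_neg : super_morphism_on (@L_neg R f C) phi.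
Hypothesis phi_f : forall k : 'I_(ch idx_m1), phi (monster_f C k) = monster_f C k.

(** The factor m / k is m times 1 / k, in accordance with the outer logarithmic derivative, and each
    z_j together with [z_j, z_j] accounts for one [log_monomial]. The row a = 1 of p is not named
    here: it can be read off afterwards from the same formula with m = 1. *)
Theorem lie_trace N : exists (p H : {poly {poly K}}),
  [/\ logderiv N p H, p`_0 = 0, forall a, (p`_a)`_0 = 0,
      forall a b, (0 < a)%N -> (0 < b)%N -> (p`_a)`_b = (p`_1)`_(a + b).-1
    & forall m n, (0 < m)%N -> (0 < n)%N -> (m + n <= N)%N ->
      \sum_(k <- divisors (gcdn m n))
        (m %/ k)%:R * supertrace (iter k phi) (- (m %/ k)%:Z) (- (n %/ k)%:Z) = (H`_m)`_n].
Proof.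
have [ca [cb [T [cab phi_v T_trig]]]] := triangular_generators fm1 phi_linear phi_graded.
have [J [z [b hB]]] := free_basis_exists fm1 hC cab N.
exists (letter_poly C T N), (\sum_j log_monomial N (content_first (b j)) (weight C T (b j))).
split.
- exact: (free_basis_weight hB (weightD hC T (N := N))).
- exact: letter_poly0.
- exact: letter_poly_coef0.
- exact: letter_poly_coef_shift.
move=> m n m0 n0 mnN.
have mN : (m <= N)%N by apply: leq_trans mnN; exact: leq_addr.
have g0 : (0 < gcdn m n)%N by rewrite gcdn_gt0 m0.
transitivity (\sum_(k <- divisors (gcdn m n)) \sum_j (m %/ k)%:R *
  ((if (content_first (b j) == m %/ k)%N && (content_second (b j) == n %/ k)%N
    then content_parity C (b j) * eigen T (b j) ^+ k else 0)
  + (if [&& content_parity C (b j) == -1, (content_first (b j) + content_first (b j) == m %/ k)%N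
     & (content_second (b j) + content_second (b j) == n %/ k)%N]
     then (eigen T (b j) * eigen T (b j)) ^+ k else 0))).
  rewrite !big_seq; apply: eq_bigr => k; rewrite -dvdn_divisors // dvdn_gcd => /andP[km kn].
  have k0 := dvdn_gt0 m0 km.
  have mk0 : (0 < m %/ k)%N by rewrite divn_gt0 // dvdn_leq.
  have nk0 : (0 < n %/ k)%N by rewrite divn_gt0 // dvdn_leq.
  have mnk : (m %/ k + n %/ k <= N)%N.
    by apply: leq_trans mnN; apply: leq_add; exact: leq_div.
  rewrite (supertrace_iter hC phi_linear phi_neg phi_f cab phi_v T_trig hB k mk0 nk0 mnk).
  rewrite -mulr_sumr; congr (_ * _); rewrite big_mkcond /=.
  rewrite -(pair_bigA _ (fun j s => if bidegree_is C b (m %/ k) (n %/ k) (j, s)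
    then content_parity C (basis_content b (j, s)) * eigen T (basis_content b (j, s)) ^+ k else 0)).
  apply: eq_bigr => j _; rewrite big_bool /= addrC; congr (_ + _).
  rewrite /bidegree_is /basis_valid /basis_content /= -/(content_parity C (b j)).
  rewrite content_firstD content_secondD content_parityD // eigenD.
  by case: eqP => //= ->; rewrite mulrNN mulr1 mul1r.
rewrite exchange_big coef_sum coef_sum; apply: eq_bigr => j _ /=.
have s0 := free_basis_first hB j.
have n11 : (1 == -1 :> K) = false by rewrite -subr_eq0 opprK -mulr2n pnatr_eq0.
rewrite (sum_divisors_orbit _ _ (content_parity_sqr hC (b j)) n11 s0 m0 n0).
rewrite log_monomial_coef //; case: (boolP (_ %| _)%N) => dm /=; last by rewrite coef0.
rewrite /weight exprZn -exprM -polyC_natr mul_polyC scalerA coefZ coefXn.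
by case: eqP => _; rewrite ?mulr1 ?mulr0.
Qed.

End LieTrace.

(** * Faber polynomials *)

Lemma coef_shift_sum (A : comNzRingType) B (c : nat -> A) (P : {poly A}) n : (n <= B)%N ->
  ((\sum_(k < B) c k.+1 *: 'X^(k.+2)) * P)`_n.+1 = \sum_(1 <= j < n.+1) c j * P`_(n - j).
Proof.
move=> nB; rewrite mulr_suml coef_sum big_add1 /=.
rewrite -(big_mkord xpredT (fun k => (c k.+1 *: 'X^(k.+2) * P)`_n.+1)).
rewrite (big_cat_nat _ (n := n)) //= [X in _ + X]big1_seq ?addr0.
  apply: eq_big_nat => k /andP[_ kn].
  by rewrite -scalerAl coefZ coefXnM ltnNge ltnS kn /= subSS.
move=> k /andP[_]; rewrite mem_index_iota => /andP[nk _].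
by rewrite -scalerAl coefZ coefXnM !ltnS nk mulr0.
Qed.

Section Grunsky.
Variables (A : comNzRingType) (B : nat) (f : nat -> A).
Implicit Types (p H : {poly {poly A}}).

(* W = sum f(i + j - 1) p^i q^j, where the outer variable is p and the inner one q. *)
Definition grunsky_poly : {poly {poly A}} :=
  \sum_(n < B) \sum_(i < n.+1) (f n.+1 *: 'X^((n - i).+1))%:P * 'X^(i.+1).

Local Notation W := grunsky_poly.
Local Notation q := ('X%:P : {poly {poly A}}).
Local Notation a := (\sum_(n < B) (f n.+1)%:P%:P * 'X^(n.+2) : {poly {poly A}}).
Local Notation aq := ((\sum_(n < B) f n.+1 *: 'X^(n.+2))%:P : {poly {poly A}}).

Lemma grunsky_poly_coef m n : (m + n <= B.+1)%N ->
  W`_m`_n = if (0 < m)%N && (0 < n)%N then f (m + n).-1 else 0.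
Proof.
move=> mnB; rewrite /W coef_sum coef_sum.
under eq_bigr => k _.
  rewrite coef_sum coef_sum.
  under eq_bigr => i _ do rewrite coefCM coefXn mulr_natr coefMn coefZ coefXn.
  over.
case: ifP => [/andP[m0 n0]|mn0].
  have kB : ((m + n).-2 < B)%N by lia.
  rewrite (bigD1 (Ordinal kB)) //= [X in _ + X]big1 ?addr0.
    have iB : (m.-1 < (m + n).-2.+1)%N by lia.
    rewrite (bigD1 (Ordinal iB)) //= [X in _ + X]big1 ?addr0.
      rewrite (prednK m0) eqxx mulr1n.
      have -> : (n == ((m + n).-2 - m.-1).+1)%N by apply/eqP; lia.
      by rewrite mulr1; congr f; lia.
    move=> i /eqP ni; have -> : (m == i.+1) = false.
      by apply/negP => /eqP e; apply: ni; apply: val_inj => /=; lia.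
    by rewrite mulr0n.
  move=> k /eqP nk; rewrite big1 // => i _.
  case: (m =P i.+1) => [ei|_]; last by rewrite mulr0n.
  have -> : (n == (k - i).+1) = false.
    apply/negP => /eqP e; apply: nk; apply: val_inj => /=.
    by have := ltn_ord i; lia.
  by rewrite mulr0 mul0rn.
rewrite big1 // => k _; rewrite big1 // => i _.
case: (m =P i.+1) => [ei|_]; last by rewrite mulr0n.
have -> : (n == (k - i).+1) = false by apply/negP => /eqP e; move: mn0; rewrite ei e.
by rewrite mulr0 mul0rn.
Qed.

(** A telescoping sum. Up to truncation it says (q - p)(1 - W) = p q (F(p) - F(q)), which ties W to
    the generating function of the Faber polynomials. *)
Lemma grunsky_poly_factor : (q - 'X) * W = 'X * aq - q * a.
Proof.
rewrite /W mulr_sumr rmorph_sum /= !mulr_sumr -sumrB; apply: eq_bigr => n _.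
have -> : \sum_(i < n.+1) (f n.+1 *: 'X^((n - i).+1))%:P * 'X^(i.+1) =
    (f n.+1)%:P%:P * ('X * q) * \sum_(i < n.+1) q ^+ (n - i) * 'X ^+ i.
  rewrite mulr_sumr; apply: eq_bigr => i _.
  rewrite -mul_polyC rmorphM /= rmorphXn /= !exprS; ring.
rewrite mulrCA -(subrXX q 'X n.+1) -mul_polyC rmorphM /= rmorphXn /= !exprS; ring.
Qed.

(* The coefficient of p^(m+1) q^(n+1) in (q - p) times (1 - W) H = p dW/dp. *)
Lemma grunsky_recursion N H m n : logderiv N W H -> (m < N)%N -> (m.+1 + n.+1 <= B)%N ->
  (0 < m)%N -> (0 < n)%N ->
  H`_(m.+1)`_n = H`_m`_(n.+1) + f (m + n)
   + \sum_(1 <= j < n) f j * H`_m`_(n - j) - \sum_(1 <= i < m) f i * H`_(m - i)`_n.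
Proof.
move=> hH mN mnB m0 n0.
have W0 : W`_0 = 0.
  rewrite /W coef_sum big1 // => k _; rewrite coef_sum big1 // => i _.
  by rewrite coefCM coefXn mulr0.
have e : ((q - 'X) + (q * a - 'X * aq)) * H = (q - 'X) * ((1 - W) * H).
  have -> : q * a - 'X * aq = - ((q - 'X) * W) by rewrite grunsky_poly_factor opprB.
  ring.
have d : (q - 'X) * ('X * W^`()) = 'X * aq - q * ('X * a^`()) + 'X * W.
  have /(congr1 (fun p => 'X * p^`())) := grunsky_poly_factor.
  rewrite !derivM !derivB !derivM !derivC derivX => h.
  transitivity ('X * ((0 - 1) * W + (q - 'X) * W^`()) + 'X * W); first by ring.
  rewrite h; ring.
have [r er] : exists r, ((q - 'X) + (q * a - 'X * aq)) * H =
    'X * aq - q * ('X * a^`()) + 'X * W + 'X^(N.+1) * r.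
  case: hH => r er; exists ((q - 'X) * r); rewrite e er -d; ring.
have := congr1 (fun p : {poly {poly A}} => p`_(m.+1)`_(n.+1)) er.
have H0 : H`_0 = 0 by rewrite (logderiv_coef W0 hH (leq0n N)) mul0r add0r big_ord0.
have ea : a = \sum_(n < B) (f n.+1)%:P *: 'X^(n.+2).
  by apply: eq_bigr => k _; rewrite mul_polyC.
have aH : (a * H)`_(m.+1)`_n = \sum_(1 <= i < m) f i * H`_(m - i)`_n.
  rewrite ea (coef_shift_sum (fun i => (f i)%:P)); last by lia.
  rewrite coef_sum big_nat_recr //= subnn H0 mulr0 coef0 addr0.
  by apply: eq_bigr => i _; rewrite coefCM.
have Hm0 : H`_m`_0 = 0.
  have -> : H`_m = m%:R * W`_m + \sum_(i < m) W`_i * H`_(m - i).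
    by rewrite (logderiv_coef W0 hH) // ltnW.
  have w0 i : W`_i`_0 = 0.
    rewrite /W coef_sum coef_sum big1 // => k _; rewrite coef_sum coef_sum big1 // => j _.
    by rewrite coefCM coefXn mulr_natr coefMn coefZ coefXn mulr0 mul0rn.
  rewrite coefD mulr_natl coefMn w0 mul0rn add0r coef_sum big1 // => i _.
  by rewrite coefM big_ord1 w0 mul0r.
have aqH : ((\sum_(k < B) f k.+1 *: 'X^(k.+2)) * H`_m)`_(n.+1) = \sum_(1 <= j < n) f j * H`_m`_(n - j).
  rewrite (coef_shift_sum f); last by lia.
  by rewrite big_nat_recr //= subnn Hm0 mulr0 addr0.
rewrite -/W; cbv beta; rewrite mulrDl !mulrBl -!mulrA.
rewrite !(coefD, coefB, coefN, coefXM, coefCM) /= ?(coefD, coefB, coefN, coefXM, coefCM) /=.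
have a'0 : a^`()`_m`_n = 0.
  rewrite coef_deriv coefMn ea coef_sum coef_sum big1 ?mul0rn // => k _.
  by rewrite coefZ coefCM coefXn coefMn coef1 (gtn_eqF n0) mul0rn mulr0.
rewrite coefXnM ltnS mN aH aqH a'0 coefC (gtn_eqF m0) coef0.
rewrite grunsky_poly_coef; last by lia.
rewrite m0 /= addnS /= subr0 addr0 add0r => <-; ring.
Qed.

Lemma grunsky_poly0 : W`_0 = 0.
Proof.
rewrite /W coef_sum big1 // => k _; rewrite coef_sum big1 // => i _.
by rewrite coefCM coefXn mulr0.
Qed.

Lemma grunsky_poly_0 i : W`_i`_0 = 0.
Proof.
rewrite /W coef_sum coef_sum big1 // => k _; rewrite coef_sum coef_sum big1 // => j _.
by rewrite coefCM coefXn mulr_natr coefMn coefZ coefXn mulr0 mul0rn.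
Qed.

Section Coefficients.
Variables (N : nat) (H : {poly {poly A}}).
Hypothesis hH : logderiv N W H.

Lemma grunsky_coef0 m : (m <= N)%N -> H`_m`_0 = 0.
Proof.
move=> mN; rewrite (logderiv_coef grunsky_poly0 hH) //.
rewrite coefD mulr_natl coefMn grunsky_poly_0 mul0rn add0r coef_sum big1 // => i _.
by rewrite coefM big_ord1 grunsky_poly_0 mul0r.
Qed.

Lemma grunsky_coef1 m : (m <= N)%N -> (m <= B)%N -> (0 < m)%N -> H`_m`_1 = m%:R * f m.
Proof.
move=> mN mB m0; rewrite (logderiv_coef grunsky_poly0 hH) //.
rewrite coefD mulr_natl coefMn grunsky_poly_coef ?addn1 // m0 /= mulr_natl.
rewrite coef_sum big1 ?addr0 // => i _.
rewrite coefM big_ord_recl big_ord1 /= grunsky_poly_0 mul0r add0r.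
case: (posnP i) => [->|i0]; first by rewrite grunsky_poly0 coef0 mul0r.
by rewrite grunsky_coef0 ?mulr0 // (leq_trans (leq_subr _ _)).
Qed.

Lemma grunsky_coef_first n : (n <= B)%N -> (0 < N)%N -> (0 < n)%N -> H`_1`_n = f n.
Proof.
move=> nB N0 n0; rewrite (logderiv_coef grunsky_poly0 hH) // big_ord1 grunsky_poly0 mul0r addr0.
by rewrite mul1r grunsky_poly_coef ?n0.
Qed.

(* [faber_coef m i] is the coefficient of q^i in q^m P_m(F), where P_m is the m-th
   Faber polynomial of F = q^-1 + sum f(n) q^n. *)
Definition faber_coef m i : A := (i == 0)%:R + H`_m`_(i - m).

Hypothesis f0 : f 0 = 0.
(** The coefficients of q F(q); the value 1 stands for f(-1), which is outside the domain of f
    here. *)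
Definition shifted_coef s : A := if s is s'.+1 then f s' else 1.

(** This is P_{m+1} = F P_m - sum_{1 <= k < m} f(k) P_{m-k} - (m+1) f(m) multiplied by q^(m+1). For
    i > m + 1 it is [grunsky_recursion]; for i = m + 1 the constant enters; below, only the leading
    terms of the P_{m-k} contribute. *)
Lemma faber_coef_recursion m i : (m < N)%N -> (0 < m)%N -> (i < B)%N -> (m < B)%N ->
  faber_coef m.+1 i = \sum_(s < i.+1) shifted_coef s * faber_coef m (i - s)%N
    - (\sum_(1 <= k < m) if (k < i)%N then f k * faber_coef (m - k)%N (i - k.+1)%N else 0)
    - (i == m.+1)%:R * (m.+1%:R * f m).
Proof.
move=> mN m0 iB mB; rewrite /faber_coef big_ord_recl /= mul1r subn0.
have h0 k : (k <= N)%N -> H`_k`_0 = 0 by exact: grunsky_coef0.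
case: i iB => [|i] iB.
  by rewrite big_ord0 addr0 !sub0n !h0 ?(ltnW mN) // big1 // mul0r !subr0.
rewrite big_ord_recr /= /bump /= add1n subnn sub0n h0 ?(ltnW mN) //.
rewrite eqxx /= addr0 mulr1 !add0r eqSS subSS.
under eq_bigr => s _.
  rewrite ?add0n ?add1n subSS subn_eq0 leqNgt ltn_ord add0r -subnDA [(_ + m)%N]addnC subnDA; over.
rewrite ?add0n.
have -> : \sum_(1 <= k < m) (if (k < i.+1)%N then f k * ((i.+1 - k.+1 == 0)%N%:R +
      H`_(m - k)`_(i.+1 - k.+1 - (m - k))) else 0)
    = (if (i < m)%N then f i else 0) + \sum_(1 <= k < m) f k * H`_(m - k)`_(i - m).
  transitivity (\sum_(1 <= k < m) ((if k == i then f i else 0) + f k * H`_(m - k)`_(i - m))).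
    apply: eq_big_nat => k /andP[k0 km]; rewrite ltnS subSS.
    case: (leqP k i) => ki.
      have -> : (i - k - (m - k) = i - m)%N by lia.
      rewrite subn_eq0 mulrDr mulr_natr; congr (_ + _).
      case: eqP => [->|/eqP ne]; first by rewrite leqnn.
      by rewrite leqNgt ltn_neqAle ki ne.
    have -> : (i - m = 0)%N by lia.
    rewrite h0 ?mulr0 ?addr0 ?gtn_eqF //.
    by rewrite (leq_trans (leq_subr _ _)) // ltnW.
  rewrite big_split /=; congr (_ + _); rewrite -big_mkcond /=.
  case: (posnP i) => [->|i0].
    by rewrite f0 if_same big1.
  by rewrite big_nat1_eq i0.
case: (ltngtP i m) => im.
- have e1 : (i.+1 - m = 0)%N by lia.
  have e2 : (i - m = 0)%N by lia.
  rewrite e1 e2 !h0 ?(ltnW mN) // big1 ?add0r => [|s _]; last first.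
    by rewrite ?sub0n ?h0 ?mulr0 // ltnW.
  rewrite mul0r subr0 big_nat_cond big1 ?addr0 ?subrr // => k /andP[/andP[_ km] _].
  by rewrite h0 ?mulr0 // (leq_trans (leq_subr _ _)) // ltnW.
- have e1 : (i = m + (i - m))%N by lia.
  set n := (i - m)%N in e1 *; have n0 : (0 < n)%N by lia.
  rewrite mul0r subr0 add0r (grunsky_recursion hH) //; try lia.
  have -> : (i.+1 - m = n.+1)%N by lia.
  rewrite -e1; congr (_ - _).
  rewrite -addrA; congr (_ + _); rewrite addrC; congr (_ + _).
  rewrite -(big_mkord xpredT (fun s => f s * H`_m`_(n - s))).
  have ni : (n <= i)%N by exact: leq_subr.
  rewrite [RHS](big_cat_nat _ (n := n)) //=.
  rewrite [X in _ = _ + X]big1_seq ?addr0.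
    by rewrite [RHS]big_ltn // f0 mul0r add0r.
  move=> s /andP[_]; rewrite mem_index_iota => /andP[ns _].
  have -> : (n - s = 0)%N by lia.
  by rewrite h0 ?mulr0 // ltnW.
- rewrite im subnn h0 // subSnn grunsky_coef1 ?(ltnW mN) ?(ltnW mB) //.
  rewrite big1 => [|s _]; last by rewrite sub0n h0 ?mulr0 // ltnW.
  rewrite !add0r big_nat_cond big1 => [|k /andP[/andP[_ km] _]]; last first.
    by rewrite h0 ?mulr0 // (leq_trans (leq_subr _ _)) // ltnW.
  rewrite mul1r subr0; ring.
Qed.

End Coefficients.

End Grunsky.

Lemma eqX_of_coef (A : comNzRingType) N (p q : {poly A}) :
  (forall i, (i <= N)%N -> p`_i = q`_i) -> eqX N p q.
Proof.
move=> h; exists (drop_poly N.+1 (p - q)).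
have e := poly_take_drop N.+1 (p - q).
have t0 : take_poly N.+1 (p - q) = 0.
  apply/polyP => i; rewrite coef_take_poly coef0; case: ltnP => // iN.
  by rewrite coefB h // subrr.
by move: e; rewrite t0 add0r mulrC => ->; rewrite addrC subrK.
Qed.

Lemma eqXexp (A : comNzRingType) N (p q : {poly A}) k : eqX N p q -> eqX N (p ^+ k) (q ^+ k).
Proof.
move=> e; elim: k => [|k IH]; first exact: eqX_refl.
by rewrite !exprS; exact: eqXM.
Qed.

Lemma size_polyB (A : nzRingType) (p q : {poly A}) : (size (p - q)%R <= maxn (size p) (size q))%N.
Proof. by rewrite -(size_polyN q); exact: size_polyD. Qed.

(** * Existence, uniqueness and values of Faber polynomials *)

Section Faber.
Variable f : int -> int.
Hypothesis nf : normalized f.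
Local Notation fn := (fun n : nat => f n%:Z).

Implicit Types P Q : {poly int}.

Section Truncation.
Variable B : nat.

Definition shifted_poly : {poly int} := \poly_(i < B) f (i%:Z - 1).
Local Notation u := shifted_poly.

Lemma shifted_poly_coef i : (i < B)%N -> u`_i = shifted_coef fn i.
Proof.
rewrite coef_poly => -> /=; case: i => [|i] /=; first by case: nf => h _; rewrite sub0r h.
by rewrite -addn1 PoszD addrK.
Qed.

Lemma coef_powE k (n : int) : (absz (n + k%:Z)%R < B)%N ->
  coef_pow f k n = if - k%:Z <= n then (u ^+ k)`_(absz (n + k%:Z)) else 0.
Proof.
move=> nB; rewrite /coef_pow; case: ifP => // _.
set N := absz _ in nB *.
apply: (eqX_coef (N := N)) => //; apply: eqXexp; apply: eqX_of_coef => i iN.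
by rewrite !coef_poly ltnS iN (leq_ltn_trans iN nB).
Qed.

(** q^m P(F) modulo q^B for P of degree at most m: the pole is cleared by writing F^k q^m = (q F)^k
    q^(m-k). *)
Definition eval_series m (P : {poly int}) : {poly int} :=
  \sum_(k < m.+1) P`_k *: (u ^+ k * 'X^(m - k)).

Lemma eval_series_coef m P i : (size P <= m.+1)%N -> (i < B)%N ->
  (eval_series m P)`_i = \sum_(k < size P) P`_k * coef_pow f k (i%:Z - m%:Z).
Proof.
move=> sP iB; rewrite /eval_series coef_sum.
rewrite (big_ord_widen_cond m.+1 xpredT (fun k => P`_k * coef_pow f k (i%:Z - m%:Z))) //=.
rewrite [RHS]big_mkcond /=; apply: eq_bigr => k _; rewrite coefZ.
case: ltnP => [_|sk]; last by rewrite nth_default // mul0r.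
have km : (k <= m)%N by rewrite -ltnS.
congr (_ * _); rewrite coefMXn; case: ltnP => h.
  by rewrite /coef_pow ifF //; apply/negbTE; lia.
rewrite coef_powE; last by lia.
rewrite ifT; last by lia.
by congr (_ `_ _); lia.
Qed.

Lemma eval_seriesD m P Q : eval_series m (P + Q) = eval_series m P + eval_series m Q.
Proof.
by rewrite /eval_series -big_split; apply: eq_bigr => k _; rewrite coefD scalerDl.
Qed.
Lemma eval_seriesZ m c P : eval_series m (c *: P) = c *: eval_series m P.
Proof.
by rewrite /eval_series scaler_sumr; apply: eq_bigr => k _; rewrite coefZ scalerA.
Qed.
Lemma eval_series0 m : eval_series m 0 = 0.
Proof. by rewrite /eval_series big1 // => k _; rewrite coef0 scale0r. Qed.
Lemma eval_seriesX m P : eval_series m.+1 ('X * P) = u * eval_series m P.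
Proof.
rewrite /eval_series big_ord_recl coefXM /= scale0r add0r mulr_sumr.
by apply: eq_bigr => k _; rewrite coefXM /= /bump /= -scalerAr mulrA -exprS.
Qed.
Lemma eval_series_shift m d P : (size P <= m.+1)%N ->
  eval_series (d + m) P = 'X^d * eval_series m P.
Proof.
move=> sP; rewrite /eval_series mulr_sumr.
rewrite (big_ord_widen_cond (d + m).+1 xpredT
  (fun k => 'X^d * (P`_k *: (shifted_poly ^+ k * 'X^(m - k))))) //=; last by lia.
rewrite [RHS]big_mkcond /=; apply: eq_bigr => k _; case: ltnP => km.
  rewrite -scalerAr; congr (_ *: _); rewrite mulrCA -exprD; congr (_ * 'X^_); lia.
by rewrite nth_default ?scale0r // (leq_trans sP).
Qed.
Lemma eval_seriesC m c : eval_series m c%:P = c *: 'X^m.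
Proof.
by rewrite -[m]addn0 eval_series_shift ?size_polyC_leq1 // /eval_series big_ord1 coefC /= mul1r mulrC -scalerAl mul1r addn0.
Qed.

End Truncation.

Lemma faber_exists : exists P : nat -> {poly int},
  [/\ forall m, (size (P m) <= m.+1)%N, P 1 = 'X &
      forall m, (0 < m)%N -> P m.+1 = 'X * P m - \sum_(1 <= k < m) fn k *: P (m - k)%N
        - (m.+1%:R * fn m)%:P].
Proof.
(* Course-of-values recursion: the list carries P m, ..., P 1. The range k < m keeps P 0 out of the
   recursion. *)
pose step (l : seq {poly int}) (m : nat) := 'X * l`_0 - \sum_(1 <= k < m) fn k *: l`_k
  - (m.+1%:R * fn m)%:P.
pose L := fix L m := if m is m'.+1 then (if m' is 0 then 'X else step (L m') m') :: L m' else [::].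
pose P m := (L m)`_0.
have LP m k : (k < m)%N -> (L m)`_k = P (m - k)%N.
  elim: m k => // m IH [|k] km; first by rewrite subn0.
  by rewrite subSS -IH.
have rec m : (0 < m)%N -> P m.+1 = 'X * P m - \sum_(1 <= k < m) fn k *: P (m - k)%N
        - (m.+1%:R * fn m)%:P.
  case: m => // m _; rewrite {1}/P /= {1}/step; congr (_ - _ - _).
  by apply: eq_big_nat => k /andP[_ km]; congr (_ *: _); exact: (LP m.+1).
exists P; split => // m; elim/ltn_ind: m => [[|[|m]]] IH.
- by rewrite /P size_poly0.
- by rewrite /P /= size_polyX.
rewrite rec //; apply: leq_trans (size_polyB _ _) _.
rewrite geq_max (leq_trans (size_polyC_leq1 _)) // andbT.
apply: leq_trans (size_polyB _ _) _; rewrite geq_max; apply/andP; split.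
  apply: leq_trans (size_polyMleq _ _) _; rewrite size_polyX /=; exact: IH.
rewrite big_nat; apply: (big_ind (fun p : {poly int} => size p <= m.+3)%N) => [|p p' h h'|k /andP[k0 km]].
- by rewrite size_poly0.
- by apply: leq_trans (size_polyD _ _) _; rewrite geq_max h h'.
apply: leq_trans (size_scale_leq _ _) _; apply: leq_trans (IH _ _) _; lia.
Qed.

(** For a nonzero D of degree r, the coefficient of q^-r in D(F) is the leading coefficient of D,
    since lower powers of F have smaller poles. *)
Lemma faber_unique m P Q : is_faber_poly f m P -> is_faber_poly f m Q -> P = Q.
Proof.
move=> hP hQ; apply/eqP; rewrite -subr_eq0; apply/negPn/negP => D0.
set D := P - Q in D0.
have ext (S : {poly int}) K n : (size S <= K)%N ->
    \sum_(k < size S) S`_k * coef_pow f k n = \sum_(k < K) S`_k * coef_pow f k n.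
  move=> sK; rewrite (big_ord_widen_cond K xpredT (fun k => S`_k * coef_pow f k n)) //=.
  rewrite big_mkcond /=; apply: eq_bigr => k _; case: ltnP => // sk.
  by rewrite nth_default // mul0r.
have hD n : n <= 0 -> \sum_(k < size D) D`_k * coef_pow f k n = 0.
  move=> n0; pose K := maxn (size D) (maxn (size P) (size Q)).
  rewrite (ext D K) ?leq_maxl //.
  under eq_bigr do rewrite coefB mulrBl.
  rewrite sumrB -!ext ?hP ?hQ ?subrr // /K ?leq_max ?leqnn ?orbT //.
have s0 : (0 < size D)%N by rewrite size_poly_gt0.
have := hD (- (size D).-1%:Z); rewrite oppr_le0 => /(_ isT).
rewrite -(prednK s0) big_ord_recr /= big1 => [|k _]; last first.
  rewrite /coef_pow ifF ?mulr0 //; apply/negbTE; have := ltn_ord k; lia.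
rewrite add0r /coef_pow lexx addNr /=.
have -> : (\poly_(i < 1) f (i%:Z - 1)) = 1 :> {poly int}.
  apply/polyP => i; rewrite coef_poly coef1; case: i => //=.
  by case: nf.
rewrite expr1n coef1 mulr1 => /eqP; rewrite -/(lead_coef D) lead_coef_eq0.
by rewrite (negPf D0).
Qed.

(** The recursively built polynomials and the coefficients of H satisfy the same recursion; the
    resulting polynomial is a Faber polynomial, and uniqueness identifies it with P. *)
Lemma faber_value B N H m P : logderiv N (grunsky_poly B fn) H -> (m <= N)%N -> (m < B)%N ->
  (0 < m)%N -> is_faber_poly f m P ->
  (size P <= m.+1)%N /\
  forall i, (i < B)%N -> (eval_series B m P)`_i = faber_coef H m i.
Proof.
move=> hH mN mB m0 hP.
have [FP [FPs FP1 FPr]] := faber_exists.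
have f00 : fn 0 = 0 by case: nf.
have val k i : (0 < k)%N -> (k <= m)%N -> (i < B)%N ->
    (eval_series B k (FP k))`_i = faber_coef H k i.
  elim/ltn_ind: k i => [[//|[|k]]] IH i _ km iB.
    rewrite FP1 -[ 'X]mulr1 eval_seriesX eval_seriesC expr0 scale1r mulr1.
    rewrite shifted_poly_coef // /faber_coef; case: i iB => [|i] iB /=.
      by rewrite (grunsky_coef0 hH) ?addr0 // (leq_trans km).
    rewrite add0r subn1 /=; case: i iB => [|i] iB.
      by rewrite (grunsky_coef0 hH) // (leq_trans km).
    by rewrite (grunsky_coef_first hH) //; lia.
  rewrite FPr // !eval_seriesD -[- _%:P]scaleN1r -scaleN1r !eval_seriesZ eval_seriesX eval_seriesC.
  rewrite (faber_coef_recursion hH) //; try lia.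
  rewrite (big_morph (eval_series B k.+2) (eval_seriesD B k.+2) (eval_series0 B k.+2)).
  rewrite !coefD !scaleN1r !coefN.
  congr (_ - _ - _).
  - rewrite coefM; apply: eq_bigr => s _.
    rewrite shifted_poly_coef; last by apply: leq_ltn_trans iB; rewrite -ltnS.
    by rewrite IH //; [lia | apply: leq_ltn_trans iB; exact: leq_subr].
  - rewrite coef_sum; apply: eq_big_nat => j /andP[j0 jk].
    rewrite eval_seriesZ coefZ; have e : (k.+2 = j.+1 + (k.+1 - j))%N by lia.
    rewrite {1}e eval_series_shift ?FPs // coefXnM ltnS leqNgt.
    case: ltnP => ji /=; last by rewrite mulr0.
    by congr (_ * _); apply: IH; lia.
  - by rewrite coefZ coefXn mulrC.
have FPf : is_faber_poly f m (FP m).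
  move=> n n0; case: (lerP (- m%:Z) n) => nm; last first.
    rewrite lt_eqF // big1 // => k _; rewrite /coef_pow ifF ?mulr0 //.
    apply/negbTE; have := ltn_ord k; have := FPs m; lia.
  have [i en im] : exists2 i : nat, n = i%:Z - m%:Z & (i <= m)%N.
    by exists (absz (n + m%:Z)); lia.
  rewrite en -(eval_series_coef (B := B)) ?FPs ?(leq_ltn_trans im) // val ?(leq_ltn_trans im) //.
  rewrite /faber_coef (_ : (i - m = 0)%N) ?(grunsky_coef0 hH) ?addr0 //; last by lia.
  by congr (_%:R); congr nat_of_bool; lia.
by rewrite (faber_unique hP FPf); split=> // i iB; apply: val.
Qed.

End Faber.

(** * Coefficients of replicable series *)

(* [approx phi p N]: phi(x) = p(x) + O(x^N) as x tends to 0 through positive values. *)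
Section Approximation.
Variable K : numFieldType.
Implicit Types (phi psi : K -> K) (p q : {poly K}).

Definition approx phi p N := exists c x0 : K, [/\ 0 <= c, 0 < x0, x0 <= 1 &
  forall x, 0 < x -> x < x0 -> `|phi x - p.[x]| <= c * x ^+ N].

Lemma approx_poly p N : approx (horner p) p N.
Proof. by exists 0, 1; split=> // x _ _; rewrite subrr normr0 mul0r. Qed.

Lemma approx_eq phi psi p N : (forall x, 0 < x -> x < 1 -> phi x = psi x) ->
  approx phi p N -> approx psi p N.
Proof.
move=> e [c [x0 [c0 h0 h1 h]]]; exists c, x0; split=> // x xp xl.
by rewrite -e ?h // (lt_le_trans xl).
Qed.

Lemma approxD phi psi p q N : approx phi p N -> approx psi q N ->
  approx (fun x => phi x + psi x) (p + q) N.
Proof.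
move=> [c [x0 [c0 h0 h1 h]]] [c' [x0' [c0' h0' h1' h']]].
(* Both radii are at most 1, so their product lies below each of them and no minimum in the
   partially ordered field is needed. *)
exists (c + c'), (x0 * x0'); split.
- exact: addr_ge0.
- exact: mulr_gt0.
- by rewrite mulr_ile1 // ltW.
move=> x xp xl; rewrite hornerD opprD addrACA mulrDl; apply: le_trans (ler_normD _ _) _.
apply: lerD; [apply: h => //|apply: h' => //]; apply: lt_le_trans xl _.
  by rewrite ler_piMr // ltW.
by rewrite ler_piMl // ltW.
Qed.

Lemma horner_bound p x : 0 <= x -> x <= 1 -> `|p.[x]| <= \sum_(i < size p) `|p`_i|.
Proof.
move=> x0 x1; rewrite horner_coef; apply: le_trans (ler_norm_sum _ _ _) _.
apply: ler_sum => i _; rewrite normrM ler_piMr // normrX exprn_ile1 // ger0_norm //.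
Qed.

Lemma approxM phi psi p q N : approx phi p N -> approx psi q N ->
  approx (fun x => phi x * psi x) (p * q) N.
Proof.
move=> [c [x0 [c0 h0 h1 h]]] [c' [x0' [c0' h0' h1' h']]].
pose b := \sum_(i < size p) `|p`_i|; pose b' := \sum_(i < size q) `|q`_i|.
have b0 : 0 <= b by apply: sumr_ge0.
have b0' : 0 <= b' by apply: sumr_ge0.
exists (c * (c' + b') + b * c'), (x0 * x0'); split.
- by rewrite addr_ge0 ?mulr_ge0 ?addr_ge0.
- exact: mulr_gt0.
- by rewrite mulr_ile1 // ltW.
move=> x xp xl.
have xx0 : x < x0 by apply: lt_le_trans xl _; rewrite ler_piMr // ltW.
have xx0' : x < x0' by apply: lt_le_trans xl _; rewrite ler_piMl // ltW.
have x1 : x <= 1 by apply: le_trans h1; exact: ltW.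
have xN0 : 0 <= x ^+ N by rewrite exprn_ge0 // ltW.
have xN : x ^+ N <= 1 by rewrite exprn_ile1 // ltW.
have e1 := h x xp xx0; have e2 := h' x xp xx0'.
rewrite hornerM.
have -> : phi x * psi x - p.[x] * q.[x] = (phi x - p.[x]) * psi x + p.[x] * (psi x - q.[x]) by ring.
apply: le_trans (ler_normD _ _) _; rewrite !normrM mulrDl; apply: lerD.
  rewrite mulrAC; apply: ler_pM => //.
  rewrite -[psi x](subrK q.[x]); apply: le_trans (ler_normD _ _) _; apply: lerD.
    by apply: le_trans e2 _; rewrite ler_piMr.
  exact/horner_bound/x1/ltW.
rewrite -mulrA; apply: ler_pM => //; exact/horner_bound/x1/ltW.
Qed.

Lemma approxZ k phi p N : approx phi p N -> approx (fun x => k * phi x) (k *: p) N.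
Proof.
move=> h; rewrite -mul_polyC; apply: approxM h.
by apply: approx_eq (approx_poly k%:P N) => x _ _; rewrite hornerC.
Qed.

Lemma approxX k phi p N : approx phi p N -> approx (fun x => phi x ^+ k) (p ^+ k) N.
Proof.
move=> h; elim: k => [|k IH].
  by apply: approx_eq (approx_poly 1 N) => x _ _; rewrite hornerC expr0.
by rewrite exprS; apply: approx_eq (approxM h IH) => x _ _; rewrite exprS.
Qed.

Lemma approx_sum (J : eqType) (r : seq J) (phi : J -> K -> K) (p : J -> {poly K}) N :
  (forall j, j \in r -> approx (phi j) (p j) N) ->
  approx (fun x => \sum_(j <- r) phi j x) (\sum_(j <- r) p j) N.
Proof.
elim: r => [|j r IH] h.
  rewrite big_nil.
  by apply: approx_eq (approx_poly 0 N) => x _ _; rewrite horner0 big_nil.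
have hr : forall i, i \in r -> approx (phi i) (p i) N.
  by move=> i ir; apply: h; rewrite inE ir orbT.
rewrite big_cons; apply: approx_eq (approxD (h j (mem_head _ _)) (IH hr)) => x _ _.
by rewrite big_cons.
Qed.

Lemma approx_monomial k N : approx (fun x => x ^+ k) 'X^k N.
Proof. by apply: approx_eq (approx_poly 'X^k N) => x _ _; rewrite hornerXn. Qed.

(** At the first index i < N where the coefficients might differ, x^i is divided out of p - q; the
    constant term left over is O(x), hence zero. *)
Lemma approx_unique phi p q N : approx phi p N -> approx phi q N ->
  forall i, (i < N)%N -> p`_i = q`_i.
Proof.
move=> hp hq; have [c [x0 [c0 h0 h1 h]]] : approx (fun=> 0) (p - q) N.
  have := approxD hp (approxZ (-1) hq); rewrite scaleN1r; apply: approx_eq => x _ _.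
  by rewrite mulN1r subrr.
elim/ltn_ind => i IH iN; apply/eqP; rewrite -subr_eq0 -coefB; set r := p - q in h *.
pose s := drop_poly i r.
have er : r = 'X^i * s.
  rewrite -[LHS](poly_take_drop i) (_ : take_poly i r = 0) ?add0r 1?mulrC //.
  apply/polyP => j; rewrite coef_take_poly coef0; case: ltnP => // ji.
  by rewrite coefB IH ?subrr // (ltn_trans ji).
have si : s`_0 = r`_i by rewrite coef_drop_poly add0n.
pose s' := drop_poly 1 s.
have es : s = (s`_0)%:P + 'X * s'.
  rewrite -{1}(poly_take_drop 1 s) expr1 [_ * 'X]mulrC; congr (_ + _).
  by apply/polyP => -[|j]; rewrite coef_take_poly coefC.
pose b := \sum_(j < size s') `|s'`_j|.
have b0 : 0 <= b by apply: sumr_ge0.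
have bound x : 0 < x -> x < x0 -> `|s`_0| <= (c + b) * x.
  move=> xp xl; have x1 : x <= 1 by apply: le_trans h1; exact: ltW.
  have := h x xp xl; rewrite sub0r normrN er hornerM hornerXn normrM normrX.
  rewrite (gtr0_norm xp) => hx.
  have sx : `|s.[x]| <= c * x.
    rewrite -(ler_pM2l (exprn_gt0 i xp)); apply: le_trans hx _.
    rewrite mulrCA -exprSr; apply: ler_wpM2l => //.
    by rewrite -(subnK iN) exprD ler_piMl ?exprn_ge0 ?exprn_ile1 // ltW.
  have -> : s`_0 = s.[x] - x * s'.[x] by rewrite {2}es hornerD hornerC hornerM hornerX addrK.
  apply: le_trans (ler_normB _ _) _; rewrite mulrDl; apply: lerD => //.
  by rewrite normrM (gtr0_norm xp) mulrC ler_pM2r // horner_bound // ltW.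
rewrite -si -normr_eq0; apply/negPn/negP => sn0.
have sp : 0 < `|s`_0| by rewrite lt_def sn0 normr_ge0.
(* The point is below x0 because the fraction multiplying x0 / 2 is at most 1, and it is small
   enough that (c + b) x is less than the norm of [s_0]. *)
pose x := (`|s`_0| * x0) / (`|s`_0| + (c + b) + 1) / 2.
have Dp : 0 < `|s`_0| + (c + b) + 1 by rewrite ltr_wpDl ?addr_ge0.
have xp : 0 < x by rewrite !divr_gt0 ?mulr_gt0.
have ex : x = `|s`_0| / (`|s`_0| + (c + b) + 1) * (x0 / 2).
  by rewrite /x -!mulrA; congr (_ * _); rewrite mulrCA.
have xs : x <= `|s`_0| / (`|s`_0| + (c + b) + 1).
  rewrite ex; apply: ler_piMr; first by rewrite divr_ge0 // ltW.
  by rewrite ler_pdivrMr // mul1r (le_trans h1) // ler1n.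
have xl : x < x0.
  rewrite ex; apply: le_lt_trans (_ : x0 / 2 < _); last first.
    by rewrite ltr_pdivrMr // ltr_pMr // ltr1n.
  apply: ler_piMl; first by rewrite divr_ge0 // ltW.
  by rewrite ler_pdivrMr // mul1r -addrA lerDl !addr_ge0.
suff h2 : (c + b) * x < `|s`_0| by have := le_lt_trans (bound x xp xl) h2; rewrite ltxx.
apply: le_lt_trans (_ : (c + b) * (`|s`_0| / (`|s`_0| + (c + b) + 1)) < _).
  by rewrite ler_wpM2l ?addr_ge0.
rewrite mulrA ltr_pdivrMr // mulrC ltr_pM2l //.
by rewrite -addrA addrCA ltrDl addr_gt0.
Qed.

End Approximation.

(** * The nome, remainders of q-series and sums over roots of unity *)

Section Nome.
Local Open Scope classical_set_scope.
Variable R : realType.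
Local Notation K := R[i].
Implicit Types (z w tau : K).

Lemma cexpD z w : cexp (z + w) = cexp z * cexp w.
Proof.
case: z w => [a b] [c d]; rewrite /cexp /= expRD cosD sinD; simpc.
by congr (_ +i* _); ring.
Qed.

Lemma cexp0 : cexp (0 : K) = 1.
Proof. by rewrite /cexp /= expR0 cos0 sin0 !mul1r. Qed.

Lemma norm_cexp z : `|cexp z| = (expR (complex.Re z))%:C.
Proof.
rewrite normc_def /cexp /= !exprMn -mulrDr cos2Dsin2 mulr1 sqrtr_sqr.
by rewrite ger0_norm // expR_ge0.
Qed.

Lemma cexp_neq0 z : cexp z != 0.
Proof.
rewrite -normr_eq0 norm_cexp eq_complex /= eqxx andbT.
by rewrite gt_eqF // expR_gt0.
Qed.

Lemma nomeD z w : nome (z + w) = nome z * nome w.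
Proof. by rewrite /nome mulrDr cexpD. Qed.

Lemma nome0 : nome (0 : K) = 1.
Proof. by rewrite /nome mulr0 cexp0. Qed.

Lemma nome_natl n z : nome (n%:R * z) = nome z ^+ n.
Proof.
elim: n => [|n IH]; first by rewrite mul0r nome0 expr0.
by rewrite -natr1 mulrDl mul1r nomeD IH exprSr.
Qed.

Lemma nome_neq0 z : nome z != 0. Proof. exact: cexp_neq0. Qed.

Lemma nomeE z : nome z = cexp ((- (2 * pi * complex.Im z)) +i* (2 * pi * complex.Re z)).
Proof.
case: z => a b; rewrite /nome; congr cexp; rewrite -(rmorph_nat (real_complex R) 2); simpc => /=.
by congr (_ +i* _); ring.
Qed.

Lemma norm_nome z : `|nome z| = (expR (- (2 * pi * complex.Im z)))%:C.
Proof. by rewrite nomeE norm_cexp. Qed.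

Lemma nome_qterm f tau k : nome tau * qterm f tau k = (f (k%:Z - 1))%:~R * nome tau ^+ k.
Proof.
rewrite /qterm mulrCA; congr (_ * _); rewrite -{1}[nome tau]expr1z.
by rewrite -expfzDr ?nome_neq0 // addrC subrK.
Qed.

Lemma geometric_tail (t : K) B n : 0 <= t -> t <= 1 / 2 ->
  \sum_(B <= k < n) t ^+ k <= 2 * t ^+ B.
Proof.
move=> t0 t2; case: (leqP B n) => [Bn|nB]; last first.
  by rewrite big_geq ?mulr_ge0 ?exprn_ge0 // ltnW.
have -> : n = (B + (n - B))%N by rewrite subnKC.
set d := (n - B)%N; suff : \sum_(B <= k < B + d) t ^+ k <= 2 * t ^+ B - 2 * t ^+ (B + d).
  move/le_trans; apply; rewrite lerBlDr lerDl mulr_ge0 // exprn_ge0 //.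
elim: d => [|d IH]; first by rewrite addn0 big_geq // subrr.
rewrite addnS big_nat_recr ?leq_addr //=.
apply: le_trans (lerD IH (lexx _)) _; rewrite -subr_ge0 exprS.
have -> : 2 * t ^+ B - 2 * (t * t ^+ (B + d)) - (2 * t ^+ B - 2 * t ^+ (B + d) + t ^+ (B + d))
  = (1 - 2 * t) * t ^+ (B + d) by ring.
rewrite mulr_ge0 ?exprn_ge0 // subr_ge0 mulrC.
by move: t2; rewrite ler_pdivlMr // ltr0n.
Qed.

(** Convergence at the single point tau = i bounds the coefficients by a multiple of rho^-k, where
    rho is the norm of the nome there. For nomes of norm at most rho / 2 the tail is then dominated
    by a geometric series, whose sum gives the factor 2. *)
Lemma qseries_bound f : qconvergent R f -> exists C rho : K, [/\ 0 <= C, 0 < rho &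
  forall B tau, 0 < complex.Im tau -> `|nome tau| <= rho / 2 ->
  `|nome tau * qeval f tau - \sum_(k < B) (f (k%:Z - 1))%:~R * nome tau ^+ k|
    <= C * (`|nome tau| / rho) ^+ B].
Proof.
move=> cf; set tau0 : K := 'i.
have im0 : 0 < complex.Im tau0 by rewrite /tau0 /= ltr01.
pose rho := `|nome tau0|.
have rp : 0 < rho by rewrite normr_gt0 nome_neq0.
have [C0 C0p hC0] : exists2 C0 : K, 0 <= C0 & forall k, `|qterm f tau0 k| <= C0.
  have /cvgrPdist_lt /(_ 1 ltr01) [N _ hN] := cvg_series_cvg_0 (cf _ im0).
  exists (1 + \sum_(k < N) `|qterm f tau0 k|).
    by rewrite addr_ge0 // sumr_ge0.
  move=> k; case: (ltnP k N) => kN.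
    rewrite (bigD1 (Ordinal kN)) //= addrCA lerDl addr_ge0 // sumr_ge0 //.
  have := hN k kN; rewrite /= sub0r normrN => /ltW h.
  by apply: le_trans h _; rewrite lerDl sumr_ge0.
have hc k : `|(f (k%:Z - 1))%:~R * (rho ^+ k : K)| <= C0 * rho.
  have e : `|(f (k%:Z - 1))%:~R * (rho ^+ k : K)| = `|qterm f tau0 k| * rho.
    rewrite -[RHS]normrM [qterm _ _ _ * _]mulrC nome_qterm !normrM !normrX; congr (_ * _ ^+ _).
    exact: normr_id.
  rewrite e; apply: ler_wpM2r; [exact: ltW | exact: hC0].
exists (2 * (C0 * rho)), rho; split => //; first by rewrite !mulr_ge0 // ltW.
move=> B tau imt small; set z := nome tau in small *.
pose t := `|z| / rho.
have t0 : 0 <= t by rewrite divr_ge0 // ltW.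
have t2 : t <= 1 / 2 by rewrite ler_pdivrMr // mulrC mulrA mulr1.
have term k : `|(f (k%:Z - 1))%:~R * z ^+ k| <= C0 * rho * t ^+ k.
  have -> : `|(f (k%:Z - 1))%:~R * z ^+ k| = `|(f (k%:Z - 1))%:~R * (rho ^+ k : K)| * t ^+ k.
    rewrite !normrM !normrX (gtr0_norm rp) -mulrA -exprMn /t mulrCA divff ?mulr1 //.
    by rewrite gt_eqF.
  by rewrite ler_wpM2r // exprn_ge0.
have part n : (B <= n)%N ->
    `|z * series (qterm f tau) n - \sum_(k < B) (f (k%:Z - 1))%:~R * z ^+ k|
     <= 2 * (C0 * rho) * t ^+ B.
  move=> Bn; rewrite /series /= mulr_sumr.
  rewrite (eq_bigr (fun k : nat => (f (k%:Z - 1))%:~R * z ^+ k) (fun k _ => nome_qterm f tau k)).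
  rewrite -(big_mkord xpredT (fun k => (f (k%:Z - 1))%:~R * z ^+ k)).
  rewrite (big_cat_nat _ (n := B)) //= addrAC subrr add0r.
  apply: le_trans (ler_norm_sum _ _ _) _.
  apply: le_trans (ler_sum _ (fun k _ => term k)) _.
  rewrite -mulr_sumr [2 * _]mulrC -[X in _ <= X]mulrA; apply: ler_wpM2l.
    by rewrite mulr_ge0 // ltW.
  exact: geometric_tail.
apply/ler_addgt0Pr => e e0.
have zp : 0 < `|z| by rewrite normr_gt0 nome_neq0.
have /cvgrPdist_lt /(_ (e / `|z|) (divr_gt0 e0 zp)) [N _ hN] := cf _ imt.
have := hN (maxn N B) (leq_maxl _ _) => /= h.
rewrite -/(qeval f tau) in h.
set S := series _ _ in h.
have -> : z * qeval f tau - \sum_(k < B) (f (k%:Z - 1))%:~R * z ^+ k =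
  (z * S - \sum_(k < B) (f (k%:Z - 1))%:~R * z ^+ k) + z * (qeval f tau - S) by ring.
apply: le_trans (ler_normD _ _) _; apply: lerD; first exact/part/leq_maxr.
by rewrite normrM mulrC -ler_pdivlMr // ltW.
Qed.

(** By the double angle formula cos x = 1 forces sin (x / 2) = 0, but x / 2 lies strictly between 0
    and pi. It shows that exp(2 pi i / d) is a primitive root. *)
Lemma cos_eq1_lt (x : R) : 0 < x -> x < 2 * pi -> cos x <> 1.
Proof.
move=> x0 x2 cx; have hx : x = (x / 2) *+ 2 by rewrite -mulr_natr divfK.
have s0 : sin (x / 2) = 0.
  move: cx; rewrite {1}hx cos_mulr2n => /eqP; rewrite subr_eq -mulr2n.
  rewrite -[X in _ == X]/(1 *+ 2) eqr_pMn2r // => /eqP c1.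
  by apply/eqP; rewrite -sqrf_eq0 sin2cos2 c1 subrr.
have : 0 < sin (x / 2) by rewrite sin_gt0_pi // divr_gt0 //= ltr_pdivrMr // mulrC.
by rewrite s0 ltxx.
Qed.

(* The sum of zeta^(b (k - 1)) over b < d, for zeta = exp(2 pi i / d); the exponent
   -1 is avoided by multiplying by zeta^b. *)
Lemma root_sum d k : (0 < d)%N ->
  \sum_(b < d) nome (b%:R / d%:R : K) ^+ k / nome (b%:R / d%:R : K)
  = if (d %| absz (k%:Z - 1)%R)%N then d%:R else 0.
Proof.
move=> d0; set zeta := nome (d%:R^-1 : K).
have dn0 : d%:R != 0 :> K by rewrite pnatr_eq0 -lt0n.
have zb b : nome (b%:R / d%:R : K) = zeta ^+ b by rewrite nome_natl.
have z0 : zeta != 0 by exact: nome_neq0.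
have zd : zeta ^+ d = 1.
  rewrite -nome_natl divff // nomeE /cexp /= mulr0 mulr1 oppr0 expR0 !mul1r.
  by rewrite mulrC mulr_natr cos2pi sin2pi.
have zprim r : (0 < r)%N -> (r < d)%N -> zeta ^+ r <> 1.
  move=> r0 rd; rewrite -nome_natl.
  have -> : (r%:R / d%:R : K) = (r%:R / d%:R : R)%:C.
    by rewrite rmorphM fmorphV !rmorph_nat.
  rewrite nomeE /cexp /= mulr0 oppr0 expR0 !mul1r => -[c1 _]; move: c1.
  apply: cos_eq1_lt.
    by rewrite !mulr_gt0 ?pi_gt0 ?invr_gt0 ?ltr0n.
  rewrite gtr_pMr ?mulr_gt0 ?pi_gt0 //.
  by rewrite ltr_pdivrMr ?ltr0n // mul1r ltr_nat.
under eq_bigr do rewrite zb -exprM mulnC exprM -expr_div_n.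
set w := zeta ^+ k / zeta.
have wd : w ^+ d = 1 by rewrite expr_div_n -exprM mulnC exprM zd expr1n divr1.
have w1 : (w == 1) = (d %| absz (k%:Z - 1)%R)%N.
  rewrite /w -(inj_eq (mulIf z0)) divfK // mul1r.
  have zmod r : zeta ^+ r = zeta ^+ (r %% d).
    by rewrite {1}(divn_eq r d) exprD mulnC exprM zd expr1n mul1r.
  have z1 r : (zeta ^+ r == 1) = (d %| r)%N.
    rewrite zmod /dvdn; case: (posnP (r %% d)) => [->|r0]; first by rewrite expr0 eqxx.
    by apply/negbTE/eqP; apply: zprim => //; rewrite ltn_mod.
  case: k @w wd => [|k] w wd; first by rewrite expr0 eq_sym -[zeta]expr1 z1.
  rewrite exprS -[X in _ == X]mulr1 (inj_eq (mulfI z0)) z1.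
  by rewrite -addn1 PoszD addrK.
case: ifP w1 => [_ /eqP ->|_ /eqP w1].
  by under eq_bigr do rewrite expr1n; rewrite sumr_const card_ord.
have : (w - 1) * \sum_(b < d) w ^+ b = 0 by rewrite -subrX1 wd subrr.
by move/eqP; rewrite mulf_eq0 subr_eq0 => /orP[/eqP //|/eqP].
Qed.

End Nome.

(** * Asymptotic comparison of both sides of the replication identity *)

Section ReplicableCoefficients.
Variable R : realType.
Local Notation K := R[i].

Lemma pos_complexP (x : K) : 0 < x -> x < 1 ->
  exists2 r : R, x = r%:C & 0 < r < 1.
Proof.
case: x => a b; rewrite !ltcE /= => /andP[/eqP -> ap] /andP[_ a1].
by exists a; rewrite ?ap.
Qed.

(* The point of the imaginary axis at which the nome is x ^ y. *)
Definition tau_of (y : R) (x : K) : K := 0 +i* (- (y * ln (complex.Re x)) / (2 * pi)).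

Lemma tau_of_im y x : 0 < y -> 0 < x -> x < 1 -> 0 < complex.Im (tau_of y x).
Proof.
move=> y0 x0 x1; have [r -> /andP[r0 r1]] := pos_complexP x0 x1.
by rewrite /= divr_gt0 ?mulr_gt0 ?pi_gt0 // oppr_gt0 pmulr_rlt0 // ln_lt0 // r0.
Qed.

Lemma nome_tau_of (n : nat) x : 0 < x -> x < 1 -> nome (tau_of n%:R x) = x ^+ n.
Proof.
move=> x0 x1; have [r -> /andP[r0 r1]] := pos_complexP x0 x1.
rewrite nomeE /cexp /= mulr0 cos0 sin0 mulr0 mulr1.
have -> : - (2 * pi * (- (n%:R * ln r) / (2 * pi))) = n%:R * ln r.
  by move: (pi : R) (lt0r_neq0 (pi_gt0 R)) => p p0; field.
rewrite expRM_natl lnK //.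
by rewrite -rmorphXn.
Qed.

(** For m = a d and tau of nome x^m, the point a tau / d has nome x^(a^2). Working with x instead of
    the nome of tau makes all exponents integral at once. *)
Lemma tau_of_frac (a b d : nat) x : 0 < x -> x < 1 -> (0 < d)%N ->
  (a%:R * tau_of (a * d)%N%:R x + b%:R) / d%:R = tau_of (a * a)%N%:R x + b%:R / d%:R.
Proof.
move=> x0 x1 d0; rewrite mulrDl; congr (_ + _).
have dn0 : d%:R != 0 :> R by rewrite pnatr_eq0 -lt0n.
have -> : a%:R = (a%:R : R)%:C :> K by rewrite rmorph_nat.
have -> : d%:R^-1 = (d%:R^-1 : R)%:C :> K by rewrite fmorphV rmorph_nat.
rewrite /tau_of; simpc; congr (_ +i* _).
move: (pi : R) (lt0r_neq0 (pi_gt0 R)) => p p0; rewrite !natrM; field.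
by rewrite dn0 p0.
Qed.

(** The truncation of q F(q) at q = x^s w, as a polynomial in x; the factor q removes the pole. *)
Definition laurent_poly (f : int -> int) (B s : nat) (w : K) : {poly K} :=
  \sum_(k < B) ((f (k%:Z - 1))%:~R * w ^+ k) *: 'X^(s * k).

Lemma approx_qeval f s (b d : nat) B : qconvergent R f -> (0 < s)%N -> 
  approx (fun x => x ^+ s * nome (b%:R / d%:R) * qeval f (tau_of s%:R x + b%:R / d%:R))
    (laurent_poly f B s (nome (b%:R / d%:R))) B.
Proof.
move=> cf s0; have [C [rho [C0 rp h]]] := qseries_bound cf.
have imq : complex.Im (b%:R / d%:R : K) = 0.
  have -> : (b%:R / d%:R : K) = (b%:R / d%:R : R)%:C by rewrite rmorphM fmorphV !rmorph_nat.
  by [].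
set w := nome _; have w1 : `|w| = 1 by rewrite norm_nome imq mulr0 oppr0 expR0.
have rp2 : 0 < rho / 2 by rewrite divr_gt0.
have rp3 : 0 < 1 + rho / 2 by rewrite addr_gt0.
(* This radius is below both rho / 2, where the remainder bound applies, and 1, where x^s <= x. *)
exists (C / rho ^+ B), (rho / 2 / (1 + rho / 2)); split.
- by rewrite divr_ge0 // exprn_ge0 // ltW.
- exact: divr_gt0.
- by rewrite ler_pdivrMr // mul1r lerDr.
move=> x x0 xl.
have xr : x <= rho / 2.
  apply: le_trans (ltW xl) _; rewrite ler_pdivrMr //.
  by rewrite ler_peMr ?lerDl // ltW.
have x1 : x < 1 by apply: lt_le_trans xl _; rewrite ler_pdivrMr // mul1r lerDr.
set tau := tau_of _ _ + _; have nt : nome tau = x ^+ s * w by rewrite /tau nomeD nome_tau_of.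
have nn : `|nome tau| = x ^+ s.
  by rewrite nt normrM w1 mulr1 ger0_norm // exprn_ge0 // ltW.
have xs : x ^+ s <= x.
  by rewrite -(prednK s0) exprS ler_piMr ?exprn_ile1 // ltW.
have imt : 0 < complex.Im tau.
  by rewrite /tau raddfD /= imq addr0 tau_of_im // ltr0n.
have := h B tau imt; rewrite nn => /(_ (le_trans xs xr)).
rewrite nt /laurent_poly horner_sum.
have -> : \sum_(i < B) (((f (i%:Z - 1))%:~R * w ^+ i) *: 'X^(s * i)).[x] =
    \sum_(k < B) (f (k%:Z - 1))%:~R * (x ^+ s * w) ^+ k.
  apply: eq_bigr => k _; rewrite hornerZ hornerXn exprMn -exprM.
  by rewrite -mulrA [w ^+ k * _]mulrC.
move/le_trans; apply.
rewrite -[X in _ <= X]mulrA ler_wpM2l // expr_div_n mulrC ler_wpM2l //.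
  by rewrite invr_ge0 exprn_ge0 // ltW.
by apply: lerXn2r => //; rewrite nnegrE ?exprn_ge0 // ltW.
Qed.

Section Comparison.
Variables (F : int -> int) (fr : nat -> int -> int) (m : nat) (P : {poly int}).
Hypothesis hF : replicable_with R F fr.
Hypothesis m0 : (0 < m)%N.
Hypothesis hP : forall tau : K, 0 < complex.Im tau ->
  \sum_(d <- divisors m) \sum_(b < d)
     qeval (fr (m %/ d)%N) (((m %/ d)%:R * tau + b%:R) / d%:R)
  = (map_poly intr P).[qeval F tau].
Variable B : nat.

(** The nome is x^m, so P_m(F) has a pole of order m * m in x, which the factor clears. *)
Definition faber_value_at (x : K) : K :=
  x ^+ (m * m) * (map_poly intr P).[qeval F (tau_of m%:R x)].

(** With a = m / d the nome is x^(a^2) w, where w is the root of unity attached to b / d.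
    [laurent_poly] carries one factor x^(a^2) w too many; the inverse of w and the exponent m * m -
    a * a turn it into x^(m m). *)
Definition hecke_term (d b : nat) : {poly K} :=
  (nome (b%:R / d%:R : K))^-1 *: ('X^(m * m - (m %/ d) * (m %/ d)) *
    laurent_poly (fr (m %/ d)%N) B ((m %/ d) * (m %/ d)) (nome (b%:R / d%:R))).

Lemma approx_hecke :
  approx faber_value_at (\sum_(d <- divisors m) \sum_(b < d) hecke_term d b) B.
Proof.
pose T (d b : nat) (x : K) := (nome (b%:R / d%:R : K))^-1 *
  (x ^+ (m * m - (m %/ d) * (m %/ d)) * (x ^+ ((m %/ d) * (m %/ d)) * nome (b%:R / d%:R)
    * qeval (fr (m %/ d)%N) (tau_of ((m %/ d) * (m %/ d))%N%:R x + b%:R / d%:R))).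
have hT d : d \in divisors m -> [/\ (0 < d)%N, (0 < m %/ d)%N & (m %/ d * d)%N = m].
  rewrite -dvdn_divisors // => dm; have d0 := dvdn_gt0 m0 dm.
  split; [exact: d0 | by rewrite (divn_gt0 _ d0); exact: dvdn_leq | exact: divnK].
apply: (@approx_eq _ (fun x => \sum_(d <- divisors m) \sum_(b < d) T d b x)); last first.
  apply: approx_sum => d dm; apply: approx_sum => b _.
  have [d0 a0 e] := hT d dm.
  apply: approxZ; apply: approxM; first exact: approx_monomial.
  apply: approx_qeval; last by rewrite muln_gt0 a0.
  by case: hF => h _ _; case: (h _ a0).
move=> x x0 x1; rewrite /faber_value_at -hP; last by rewrite tau_of_im // ltr0n.
rewrite mulr_sumr big_seq [RHS]big_seq; apply: eq_bigr => d dm; rewrite mulr_sumr.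
apply: eq_bigr => b _; have [d0 a0 e] := hT d dm.
have := tau_of_frac (m %/ d) b x0 x1 d0; rewrite e => ->; rewrite /T; set w := nome _; set q := qeval _ _.
have aa : (m %/ d * (m %/ d) <= m * m)%N by rewrite leq_mul // leq_div.
rewrite -{2}(subnK aa) exprD.
have w0 : w != 0 by exact: nome_neq0.
by rewrite [_ * w]mulrC -!mulrA (mulrCA _ w) mulKf.
Qed.

(** The exponent m m + m n selects a^2 (k - 1) = m n, and summing over b leaves d if d divides k - 1
    and 0 otherwise. With k - 1 = d s and m = a d this means n = a s, so the index is m n / a^2. *)
Lemma hecke_coef n : (m * m + m * n < B)%N -> (0 < n)%N ->
  (\sum_(d <- divisors m) \sum_(b < d) hecke_term d b)`_(m * m + m * n) =
  \sum_(d <- divisors m | (m %/ d %| n)%N)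
    d%:R * (fr (m %/ d)%N ((m * n) %/ (m %/ d) ^ 2)%:Z)%:~R.
Proof.
move=> nB n0; rewrite coef_sum big_seq [RHS]big_seq_cond [RHS]big_mkcondr /=.
apply: eq_bigr => d; rewrite -dvdn_divisors // => dm.
have d0 := dvdn_gt0 m0 dm; set a := (m %/ d)%N.
have a0 : (0 < a)%N by rewrite divn_gt0 // dvdn_leq.
have ead : (a * d = m)%N by rewrite divnK.
have aa : (a * a <= m * m)%N by rewrite leq_mul // leq_div.
have hk k : (m * m + m * n == m * m - a * a + a * a * k)%N = (a * a + m * n == a * a * k)%N.
  by apply/eqP/eqP; lia.
rewrite coef_sum /hecke_term -/a.
transitivity (\sum_(k < B) if (a * a + m * n == a * a * k)%N then
    (fr a (k%:Z - 1))%:~R * (if (d %| absz (k%:Z - 1)%R)%N then d%:R else 0) else 0 : K).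
  rewrite (eq_bigr (fun b : 'I_d => \sum_(k < B) (if (a * a + m * n == a * a * k)%N then
      (fr a (k%:Z - 1))%:~R * (nome (b%:R / d%:R : K) ^+ k / nome (b%:R / d%:R : K)) else 0))).
    rewrite exchange_big /=; apply: eq_bigr => k _; case: eqP => _; last by rewrite big1.
    by rewrite -root_sum // mulr_sumr.
  move=> b _; rewrite coefZ /laurent_poly mulr_sumr coef_sum mulr_sumr; apply: eq_bigr => k _.
  rewrite -scalerAr -exprD coefZ coefXn hk; case: eqP => _; last by rewrite !mulr0.
  by rewrite mulr1 mulrC -mulrA.
case: ifP => [/dvdnP[s es]|an].
  have emn : (m * n = a * a * (d * s))%N by rewrite -ead es; lia.
  have kB : ((d * s).+1 < B)%N.
    apply: leq_ltn_trans nB; rewrite emn -addn1 addnC; apply: leq_add.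
      by rewrite muln_gt0 m0.
    by rewrite leq_pmull // muln_gt0 a0.
  rewrite (bigD1 (Ordinal kB)) //= [X in _ + X]big1 ?addr0.
    rewrite emn -mulnS eqxx -addn1 PoszD addrK /= addnK dvdn_mulr // mulrC.
    by rewrite -mulnn mulKn // muln_gt0 a0.
  move=> k /eqP nk; case: eqP => // ek; case: nk; apply: val_inj => /=.
  by apply/eqP; rewrite -(eqn_pmul2l (_ : 0 < a * a)%N) ?muln_gt0 ?a0 // -ek emn mulnS.
rewrite big1 // => k _; case: eqP => // ek; case: ifP => [|_]; last by rewrite mulr0.
case: k ek => [[|k] kB] /= ek; first by move: ek; rewrite muln0; have := muln_gt0 a a; rewrite a0; lia.
rewrite -addn1 PoszD addrK /= addnK => /dvdnP[s es].
exfalso; move/negP: an; apply; apply/dvdnP; exists s.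
have ad : (0 < a * d)%N by rewrite ead.
apply/eqP; rewrite -(eqn_pmul2l ad) ead; apply/eqP.
by move: ek; rewrite mulnS => /addnI ->; rewrite es -ead; lia.
Qed.

Hypothesis sP : (size P <= m.+1)%N.

Lemma approx_faber : approx faber_value_at (map_poly intr (eval_series F B m P) \Po 'X^m) B.
Proof.
have eF : qeval F = qeval (fr 1%N) :> (K -> K).
  apply/funext => tau; rewrite /qeval.
  have -> : qterm F tau = qterm (fr 1%N) tau; last by [].
  apply/funext => k; rewrite /qterm; case: hF => _ e _; rewrite e //; lia.
have c1 : qconvergent R (fr 1%N) by case: hF => h _ _; case: (h 1%N isT).
have hv : approx (fun x => x ^+ m * qeval F (tau_of m%:R x)) (laurent_poly F B m 1) B.
  have := approx_qeval 0 1 B c1 m0; rewrite mul0r nome0 => h.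
  have -> : laurent_poly F B m 1 = laurent_poly (fr 1%N) B m 1.
    apply: eq_bigr => k _; case: hF => _ e _; rewrite e //; lia.
  by apply: approx_eq h => x _ _; rewrite mulr1 addr0 eF.
have eu : map_poly intr (shifted_poly F B) \Po 'X^m = laurent_poly F B m 1.
  rewrite /shifted_poly poly_def rmorph_sum /= raddf_sum /=; apply: eq_bigr => k _.
  by rewrite map_polyZ map_polyXn comp_polyZ comp_Xn_poly -exprM expr1n mulr1.
pose p : {poly K} := \sum_(k < m.+1) (P`_k)%:~R *: (laurent_poly F B m 1 ^+ k * 'X^(m * (m - k))).
have -> : map_poly intr (eval_series F B m P) \Po 'X^m = p.
  rewrite /eval_series rmorph_sum /= raddf_sum /=; apply: eq_bigr => k _.
  rewrite map_polyZ rmorphM /= rmorphXn /= map_polyXn comp_polyZ comp_polyM comp_Xn_poly.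
  by rewrite rmorphXn /= eu -exprM.
pose phi (x : K) := \sum_(k < m.+1) (P`_k)%:~R *
  ((x ^+ m * qeval F (tau_of m%:R x)) ^+ k * x ^+ (m * (m - k))).
apply: (@approx_eq _ phi); last first.
  apply: approx_sum => k _; apply: approxZ; apply: approxM; last exact: approx_monomial.
  exact: approxX.
move=> x x0 x1; rewrite /phi /faber_value_at (@horner_coef_wide _ m.+1); last first.
  by apply: leq_trans (size_poly _ _) sP.
rewrite mulr_sumr; apply: eq_bigr => k _; rewrite coef_map /= exprMn -exprM.
have km : (k <= m)%N by rewrite -ltnS.
have -> : x ^+ (m * m) = x ^+ (m * k) * x ^+ (m * (m - k)).
  by rewrite -exprD -mulnDr subnKC.
move: (x ^+ (m * k)) (x ^+ (m * (m - k))) (qeval _ _ ^+ k) => a b c; ring.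
Qed.

Lemma faber_hecke_coef n : (m * m + m * n < B)%N -> (0 < n)%N ->
  \sum_(d <- divisors m | (m %/ d %| n)%N)
    d%:R * (fr (m %/ d)%N ((m * n) %/ (m %/ d) ^ 2)%:Z)%:~R
  = ((eval_series F B m P)`_(m + n))%:~R :> K.
Proof.
move=> nB n0; rewrite -hecke_coef // (approx_unique approx_hecke approx_faber nB).
by rewrite -mulnDr coef_comp_poly_Xn // dvdn_mulr // mulKn // coef_map.
Qed.

End Comparison.

Theorem replicable_coef F fr N B H m n :
  replicable_with R F fr -> logderiv N (grunsky_poly B (fun k : nat => F k%:Z)) H ->
  (0 < m)%N -> (m <= N)%N -> (0 < n)%N -> (m * m + m * n < B)%N ->
  \sum_(d <- divisors m | (m %/ d %| n)%N)
    d%:R * (fr (m %/ d)%N ((m * n) %/ (m %/ d) ^ 2)%:Z)%:~R = (H`_m`_n)%:~R :> K.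
Proof.
move=> hF hH m0 mN n0 nB.
have nF : normalized F.
  case: hF => h e _; have [[n1 n2] _] := h 1%N isT; split.
    by rewrite -e ?n1.
  by rewrite -e ?n2.
have [_ _ /(_ m m0) [P fP eP]] := hF.
have mB : (m < B)%N by apply: leq_ltn_trans nB; rewrite -mulnDr leq_pmulr // addn_gt0 m0.
have [sP vP] := faber_value nF hH mN mB m0 fP.
rewrite (faber_hecke_coef hF m0 eP sP nB n0) vP.
  rewrite /faber_coef addKn gtn_eqF ?addn_gt0 ?m0 // add0r; by [].
by apply: leq_ltn_trans nB; rewrite -mulnDr leq_pmull.
Qed.

End ReplicableCoefficients.

(** * Moebius inversion *)

Section Divisors.
Variable A : nmodType.
Implicit Types (F : nat -> A) (n d e : nat).

Lemma sum_divisors_complement n F : (0 < n)%N ->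
  \sum_(d <- divisors n) F (n %/ d)%N = \sum_(d <- divisors n) F d.
Proof.
move=> n0; rewrite -(big_map (fun d => n %/ d)%N xpredT F); apply: perm_big.
apply: uniq_perm; rewrite ?divisors_uniq //.
  rewrite map_inj_in_uniq ?divisors_uniq // => d e; rewrite -!dvdn_divisors // => dn en h.
  by rewrite -(divn_divn n0 dn) h divn_divn.
move=> d; rewrite -dvdn_divisors //; apply/mapP/idP => [[e]|dn].
  by rewrite -dvdn_divisors // => en ->; apply/dvdnP; exists e; rewrite mulnC divnK.
exists (n %/ d)%N; last by rewrite divn_divn.
by rewrite -dvdn_divisors //; apply/dvdnP; exists d; rewrite mulnC divnK.
Qed.

Lemma sum_divisors_sub n e F (P : pred nat) : (0 < n)%N -> (0 < e)%N ->
  (forall d, (d %| e)%N = (d %| n)%N && P d) ->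
  \sum_(d <- divisors e) F d = \sum_(d <- divisors n | P d) F d.
Proof.
move=> n0 e0 h; rewrite -[RHS]big_filter; apply: perm_big.
apply: uniq_perm; rewrite ?filter_uniq ?divisors_uniq // => d.
by rewrite mem_filter -!dvdn_divisors // h andbC.
Qed.

Lemma sum_divisors_quot n d F : (0 < n)%N -> (d %| n)%N ->
  \sum_(k <- divisors (n %/ d)) F k = \sum_(k <- divisors n | (d * k %| n)%N) F k.
Proof.
move=> n0 dn; have d0 := dvdn_gt0 n0 dn.
apply: sum_divisors_sub => // [|k]; first by rewrite divn_gt0 // dvdn_leq.
rewrite dvdn_divRL // mulnC; case: (boolP (d * k %| n)%N) => h; rewrite ?andbF // andbT.
by apply/esym/(dvdn_trans _ h)/dvdn_mull.
Qed.

Lemma sum_divisors_multiple n d F : (0 < n)%N -> (d %| n)%N ->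
  \sum_(k <- divisors n | (d * k %| n)%N) F (d * k)%N = \sum_(e <- divisors n | (d %| e)%N) F e.
Proof.
move=> n0 dn; have d0 := dvdn_gt0 n0 dn.
rewrite -big_filter -(big_map (muln d) xpredT F) -[RHS]big_filter; apply: perm_big.
apply: uniq_perm; rewrite ?filter_uniq ?divisors_uniq //.
  rewrite map_inj_uniq ?filter_uniq ?divisors_uniq // => x y /eqP.
  by rewrite eqn_pmul2l // => /eqP.
move=> e; rewrite mem_filter -dvdn_divisors //; apply/mapP/andP => [[k]|[/dvdnP[k ->] kn]].
  by rewrite mem_filter => /andP[h _] ->; rewrite dvdn_mulr.
exists k; last by rewrite mulnC.
by rewrite mem_filter mulnC kn -dvdn_divisors // (dvdn_trans _ kn) // dvdn_mulr.
Qed.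

End Divisors.

Lemma mobius_prime_mul p c : prime p -> (0 < c)%N -> ~~ (p %| c)%N -> mobius (p * c) = - mobius c.
Proof.
move=> pp c0 pc; have p0 := prime_gt0 pp.
have pe : perm_eq (primes (p * c)) (p :: primes c).
  apply: uniq_perm => [||q]; rewrite ?primes_uniq //=.
    by rewrite primes_uniq mem_primes (negPf pc) !andbF.
  by rewrite primesM // primes_prime // inE.
rewrite /mobius (perm_all _ pe) (perm_size pe) /=.
rewrite lognM // logn_prime // eqxx lognE (negPf pc) !andbF /=.
have -> : all (fun q => logn q (p * c) == 1%N) (primes c) = all (fun q => logn q c == 1%N) (primes c).
  apply: eq_in_all => q; rewrite mem_primes => /and3P[pq _ qc].
  rewrite lognM // logn_prime //; case: (q =P p) => [e|_] //.
  by case/negP: pc; move: qc; rewrite e.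
by case: ifP => _; rewrite ?oppr0 // exprS mulN1r.
Qed.

Lemma mobius_square p d : prime p -> (0 < d)%N -> (p * p %| d)%N -> mobius d = 0.
Proof.
move=> pp d0 pd; rewrite /mobius ifN //; apply/allPn; exists p.
  by rewrite mem_primes pp d0 (dvdn_trans _ pd) // dvdn_mulr.
by rewrite neq_ltn -pfactor_dvdn // expnS expn1 pd orbT.
Qed.

(** With p the least prime factor of n, divisors c prime to p cancel against p c, and those
    divisible by p^2 contribute nothing. *)
Lemma mobius_sum n : (0 < n)%N -> \sum_(d <- divisors n) mobius d = (n == 1%N)%:R.
Proof.
move=> n0; case: (eqVneq n 1%N) => [->|n1].
  by rewrite (_ : divisors 1 = [:: 1%N]) // big_seq1.
have n1' : (1 < n)%N by rewrite ltn_neqAle eq_sym n1.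
set p := pdiv n; have pp : prime p := pdiv_prime n1'.
have p0 := prime_gt0 pp; have pn : (p %| n)%N := pdiv_dvd n.
rewrite (bigID (fun d => p %| d)%N) /= -(sum_divisors_multiple mobius n0 pn).
rewrite (bigID (fun c => p %| c)%N) /= big1_seq ?add0r => [|c /andP[/andP[h pc] _]].
  rewrite [X in X + _](eq_bigr (fun c => - mobius c)) => [|c /andP[pcn pc]].
    rewrite sumrN [X in - X + _](_ : _ = \sum_(i <- divisors n | ~~ (p %| i)%N) mobius i) ?addNr //.
    rewrite big_seq_cond [RHS]big_seq_cond; apply: eq_bigl => c.
    rewrite -dvdn_divisors //; case: (boolP (c %| n)%N) => //= cn.
    case: (boolP (p %| c)%N) => pc; rewrite ?andbF // andbT.
    by rewrite Gauss_dvd ?pn // prime_coprime.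
  apply: mobius_prime_mul => //.
  by case: c pc {pcn} => //; rewrite dvdn0.
apply: (mobius_square pp); first by apply: dvdn_gt0 h.
by rewrite dvdn_pmul2l.
Qed.

(** Collecting terms by e = d k leaves the sum of mu(d) over the divisors d of e, which vanishes
    unless e = 1. The index e will be the power of the group element. *)
Lemma mobius_inversion (A : comNzRingType) n (h : nat -> A) : (0 < n)%N ->
  \sum_(d <- divisors n) (mobius d)%:~R * (\sum_(k <- divisors (n %/ d)) h (d * k)%N) = h 1%N.
Proof.
move=> n0.
transitivity (\sum_(d <- divisors n) \sum_(e <- divisors n | (d %| e)%N) (mobius d)%:~R * h e).
  rewrite !big_seq; apply: eq_bigr => d; rewrite -dvdn_divisors // => dn.
  by rewrite (sum_divisors_quot (fun k => h (d * k)%N)) // sum_divisors_multiple // mulr_sumr.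
rewrite (exchange_big_dep xpredT) //=.
transitivity (\sum_(e <- divisors n) (e == 1%N)%:R * h e).
  rewrite !big_seq; apply: eq_bigr => e; rewrite -dvdn_divisors // => en.
  have e0 := dvdn_gt0 n0 en.
  rewrite -mulr_suml -(sum_divisors_sub (e := e) (fun d => (mobius d)%:~R)) //; last first.
    move=> d; case: (boolP (d %| e)%N) => de; rewrite ?andbF // andbT.
    by rewrite (dvdn_trans de).
  rewrite -rmorph_sum /= mobius_sum //.
  by case: eqP => _; rewrite ?mul1r ?mul0r.
have n1 : 1%N \in divisors n by rewrite -dvdn_divisors // dvd1n.
rewrite (bigD1_seq _ n1) ?divisors_uniq //= mul1r big1 ?addr0 // => e /negPf ->.
by rewrite mul0r.
Qed.

(** H is x p' times the truncated geometric series of p; the error contains p^(N+1), divisible by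
    x^(N+1) as p has no constant term. *)
Lemma logderiv_exists (A : comNzRingType) N (p : {poly A}) : p`_0 = 0 -> exists H, logderiv N p H.
Proof.
elim/poly_ind: p => [_|q c _]; first by exists 0; exists 0; rewrite deriv0 !mulr0 addr0.
rewrite coefD coefMX coefC add0r /= => ->; rewrite addr0.
have [p ep] : exists p, p = q * 'X by eexists.
rewrite -ep.
exists ((\sum_(k < N.+1) p ^+ k) * ('X * p^`())), (- q ^+ N.+1 * ('X * p^`())).
have e : (1 - p) * \sum_(k < N.+1) p ^+ k = 1 - p ^+ N.+1.
  by rewrite -[RHS]opprB subrX1 -mulNr opprB.
by rewrite [LHS]mulrA e {1}ep exprMn; ring.
Qed.

(** The recursion for a coefficient of H of total degree a + b uses only coefficients of p of total
    degree at most a + b. Hence agreement of the complex series with the integral one up to total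
    degree S passes to the logarithmic derivatives. *)
Lemma logderiv_coef_intr (A B : comNzRingType) (h : {rmorphism A -> B}) N S
    (p H : {poly {poly A}}) (p' H' : {poly {poly B}}) :
  logderiv N p H -> logderiv N p' H' -> p`_0 = 0 -> p'`_0 = 0 ->
  (forall a b, (a + b <= S)%N -> (p'`_a)`_b = h (p`_a)`_b) ->
  forall a b, (a <= N)%N -> (a + b <= S)%N -> (H'`_a)`_b = h (H`_a)`_b.
Proof.
move=> lH lH' p0 p0' e a; have [c] := ubnP a; elim: c a => // c IH a; rewrite ltnS => ac b aN abS.
rewrite (logderiv_coef p0' lH' aN) (logderiv_coef p0 lH aN) !coefD -!polyC_natr !coefCM.
rewrite rmorphD rmorphM rmorph_nat e //; congr (_ + _).
rewrite !coef_sum rmorph_sum; apply: eq_bigr => i _ /=.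
case: (posnP i) => [i0|i0]; first by rewrite i0 p0 p0' !mul0r !coef0 rmorph0.
rewrite !coefM rmorph_sum; apply: eq_bigr => j _ /=.
have [ia jb] := (ltn_ord i, ltn_ord j).
rewrite e ?IH ?rmorphM //; lia.
Qed.

(** * Comparison of the two sides and inversion *)

Section Assembly.
Variables (R : realType) (f : int -> int) (C : monster_idx -> monster_idx -> R[i]).
Variables (G : groupType) (act : G -> monstrous f C -> monstrous f C).
Variables (F : G -> int -> int) (fr : G -> nat -> int -> int).
Hypothesis hf : normalized f.
Hypothesis hC : is_coloring f C.
Hypothesis hact : super_action act.
Hypothesis hfix : forall g (k : 'I_(monster_charge f idx_m1)), act g (monster_f C k) = monster_f C k.
Hypothesis hF : forall g (n : int), -1 <= n -> supertrace (act g) (-1) (- n) = (F g n)%:~R.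
Hypothesis hrep : forall g, replicable_with R (F g) (fr g).

Definition str (g : G) (m n : nat) : R[i] := supertrace (act g) (- m%:Z) (- n%:Z).

Definition replicate_sum (g : G) (m n : nat) : R[i] :=
  \sum_(a <- divisors (gcdn m n)) (a%:R)^-1 * (fr g a ((m * n) %/ a ^ 2)%N%:Z)%:~R.

Lemma act_iter g k : act (g ^+ k)%g = iter k (act g).
Proof.
apply/funext => x; elim: k => [|k IH] /=; first by rewrite expg0 (act_one hact).
by rewrite expgS (act_mul hact) IH.
Qed.

Lemma supertrace_replicates g m n : (0 < m)%N -> (0 < n)%N ->
  \sum_(k <- divisors (gcdn m n)) (k%:R)^-1 * str (g ^+ k)%g (m %/ k) (n %/ k) =
  replicate_sum g m n.
Proof.
(* N covers the root in question; B exceeds both m m + m n, the exponent of x read off in the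
   asymptotic comparison, and the total degrees up to N at which W is evaluated. *)
move=> m0 n0; pose N := (m + n)%N; pose B := (m * m + m * n + N)%N.
have gG : (0 < gcdn m n)%N by rewrite gcdn_gt0 m0.
have mK : m%:R != 0 :> R[i] by rewrite pnatr_eq0 -lt0n.
have [p [H [lH p0 p00 pshift pH]]] := lie_trace (proj1 hf) hC (act_linear hact g)
  (act_graded hact g) (act_neg hact g) (hfix g) N.
pose W := grunsky_poly B (fun k : nat => F g k%:Z).
have W0 : W`_0 = 0 := grunsky_poly0 _ _.
have [H' lH'] := logderiv_exists N W0.
(* For m = 1 the trace formula has the single term k = 1 and H agrees with p in this row, so the
   first row of p is the supercharacter F_g. The shift property then gives all other rows. *)
have p1 b : (0 < b)%N -> (1 + b <= N)%N -> (p`_1)`_b = (F g b%:Z)%:~R.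
  move=> b0 bN; have N1 : (1 <= N)%N by lia.
  have <- : (H`_1)`_b = (p`_1)`_b.
    by rewrite (logderiv_coef p0 lH N1) big_ord1 p0 mul0r addr0 mul1r.
  rewrite -pH // gcd1n (_ : divisors 1 = [:: 1%N]) // big_seq1 !divn1 mul1r /=.
  by rewrite hF.
have pW a b : (a + b <= N)%N -> (p`_a)`_b = ((W`_a)`_b)%:~R.
  move=> abN; rewrite grunsky_poly_coef; last by rewrite /B; lia.
  case: (posnP a) => [->|a0] /=; first by rewrite p0 coef0.
  case: (posnP b) => [->|b0] /=; first by rewrite p00.
  by rewrite pshift // p1 //; lia.
have HH : (H`_m)`_n = ((H'`_m)`_n)%:~R.
  by apply: (logderiv_coef_intr (h := intr) lH' lH W0 p0 pW); rewrite /N // leq_addr.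
have rc := replicable_coef (hrep g) lH' m0 (leq_addr n m : (m <= N)%N) n0.
(* After multiplication by m, both m / k on the Lie side and d = m / a on the replicate side match
   the logarithmic derivative in the outer variable. *)
apply: (mulfI mK); rewrite mulr_sumr; transitivity (H`_m`_n).
  rewrite -pH //; rewrite !big_seq; apply: eq_bigr => k; rewrite -dvdn_divisors // dvdn_gcd.
  move=> /andP[km kn]; rewrite mulrA -act_iter; congr (_ * _).
  have k0 : k%:R != 0 :> R[i] by rewrite pnatr_eq0 -lt0n (dvdn_gt0 m0 km).
  by rewrite -[in LHS](divnK km) natrM mulfK.
rewrite HH -rc; last by rewrite /B /N; lia.
rewrite /replicate_sum mulr_sumr.
rewrite (sum_divisors_sub _ (P := fun d => d %| n)%N m0 gG); last by move=> d; rewrite dvdn_gcd.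
rewrite big_mkcond [RHS]big_mkcond.
rewrite -(sum_divisors_complement (fun a => if (a %| n)%N then m%:R * (a%:R^-1 *
  (fr g a ((m * n) %/ a ^ 2)%N%:Z)%:~R) else 0 : R[i]) m0) !big_seq.
apply: eq_bigr => d; rewrite -dvdn_divisors // => dm; case: ifP => // _.
rewrite mulrA; congr (_ * _); have d0 := dvdn_gt0 m0 dm.
have q0 : (m %/ d)%:R != 0 :> R[i] by rewrite pnatr_eq0 -lt0n divn_gt0 // dvdn_leq.
by rewrite -[in RHS](divnK dm) natrM mulnK // mulrAC mulfV // mul1r.
Qed.

Lemma supertrace_inversion g m n : (0 < m)%N -> (0 < n)%N ->
  str g m n = \sum_(a <- divisors (gcdn m n))
    \sum_(d <- divisors (gcdn m n) | (a * d %| gcdn m n)%N)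
      ((a * d)%N%:R)^-1 * (mobius d)%:~R
        * (fr (g ^+ d)%g a (((m * n) %/ (a ^ 2 * d ^ 2))%N)%:Z)%:~R.
Proof.
move=> m0 n0; set c := gcdn m n; have c0 : (0 < c)%N by rewrite gcdn_gt0 m0.
(* The sum of h(d k) over k is 1/d times the preceding identity for g^d at (m/d, n/d), because
   (g^d)^k = g^(d k). *)
pose h e := (e%:R)^-1 * str (g ^+ e)%g (m %/ e) (n %/ e).
have -> : str g m n = h 1%N by rewrite /h invr1 mul1r !divn1 expg1.
rewrite -(mobius_inversion h c0) [RHS](exchange_big_dep xpredT) //= !big_seq.
apply: eq_bigr => d; rewrite -dvdn_divisors // => dc.
have d0 := dvdn_gt0 c0 dc.
have [dm dn] : (d %| m)%N /\ (d %| n)%N by move: dc; rewrite dvdn_gcd => /andP[].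
have md0 : (0 < m %/ d)%N by rewrite divn_gt0 // dvdn_leq.
have nd0 : (0 < n %/ d)%N by rewrite divn_gt0 // dvdn_leq.
have ec : (c %/ d = gcdn (m %/ d) (n %/ d))%N.
  by apply/eqP; rewrite -(eqn_pmul2r d0) divnK // muln_gcdl !divnK.
have -> : \sum_(k <- divisors (c %/ d)) h (d * k)%N =
    d%:R^-1 * replicate_sum (g ^+ d)%g (m %/ d) (n %/ d).
  rewrite -supertrace_replicates // -ec mulr_sumr; apply: eq_bigr => k _.
  by rewrite /h natrM invfM -mulrA -expgnA !divnMA.
rewrite /replicate_sum -ec (sum_divisors_quot _ c0 dc) !mulr_sumr.
apply: eq_big => [a|a _]; first by rewrite mulnC.
have -> : ((m * n) %/ (a ^ 2 * d ^ 2) = (m %/ d * (n %/ d)) %/ a ^ 2)%N.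
  rewrite -{1}(divnK dm) -{1}(divnK dn) mulnACA mulnn divnMr // expn_gt0 d0 //.
by rewrite natrM invfM; ring.
Qed.

End Assembly.

Theorem corollary7p2 (R : realType) (f : int -> int)
  (C : monster_idx -> monster_idx -> R[i])
  (G : groupType) (act : G -> monstrous f C -> monstrous f C)
  (F : G -> int -> int) (fr : G -> nat -> int -> int) :
  normalized f ->
  is_coloring f C ->
  super_action act ->
  (forall (g : G) (m n : nat), (0 < m)%N -> (0 < n)%N ->
     supertrace (act g) m%:Z n%:Z = supertrace (act g) (- m%:Z) (- n%:Z)) ->
  (forall (g : G) (k : 'I_(monster_charge f idx_m1)),
     act g (monster_f C k) = monster_f C k) ->
  (forall (g : G) (k : 'I_(monster_charge f idx_m1)),
     act g (monster_e C k) = monster_e C k) ->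
  (forall (g : G) (n : int), -1 <= n ->
     supertrace (act g) (-1) (- n) = (F g n)%:~R) ->
  (forall g : G, replicable_with R (F g) (fr g)) ->
  forall (g : G) (m n : nat), (0 < m)%N -> (0 < n)%N ->
    supertrace (act g) m%:Z n%:Z = supertrace (act g) (- m%:Z) (- n%:Z) /\
    supertrace (act g) (- m%:Z) (- n%:Z) =
      \sum_(a <- divisors (gcdn m n))
        \sum_(d <- divisors (gcdn m n) | (a * d %| gcdn m n)%N)
          ((a * d)%N%:R)^-1 * (mobius d)%:~R
            * (fr (g ^+ d)%g a (((m * n) %/ (a ^ 2 * d ^ 2))%N)%:Z)%:~R.
Proof.
move=> hf hC hact hsym hfix _ hF hrep g m n m0 n0; split; first exact: hsym.
exact: (supertrace_inversion hf hC hact hfix hF hrep).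
Qed.
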